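(* Let $H\in(0,1)$, let $m>1$ be a fixed natural number, let $x_0\in\mathbb R$, $\theta\in\mathbb R$, and let $X=\{X_t,t\ge0\}$ be the fractional Ornstein--Uhlenbeck process with drift parameter $\theta$, initial value $x_0$ and Hurst parameter $H$, observed at the points $k/n$, $0\le k\le n^m$, $n\ge1$. (i) If $\theta<0$, then the estimator $$\hat\theta_n^{(3)}(m)=-\left(\frac{1}{H\Gamma(2H)n^m}\sum_{k=0}^{n^m-1}X_{k/n}^2\right)^{-\frac1{2H}}$$ is strongly consistent as $n\to\infty$, i.e. $\hat\theta_n^{(3)}(m)\to\theta$ almost surely. (ii) If $\theta>0$, then the estimator $$\hat\theta_n^{(4)}(m)=\frac{nX_{n^{m-1}}^2}{2\sum_{k=0}^{n^m-1}X_{k/n}^2}$$ is strongly consistent as $n\to\infty$, i.e. $\hat\theta_n^{(4)}(m)\to\theta$ almost surely.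
   Context: Let $B^H=\{B^H_t,t\in\mathbb R\}$ be a fractional Brownian motion with Hurst parameter $H\in(0,1)$, i.e. a centered Gaussian process with $\mathbf E B^H_tB^H_s=\frac12(|t|^{2H}+|s|^{2H}-|t-s|^{2H})$, taken in its continuous modification. The fractional Ornstein--Uhlenbeck process $X$ is the unique solution of $X_t=x_0+\theta\int_0^tX_s\,ds+B^H_t$, $t\ge0$; equivalently $X_t=x_0e^{\theta t}+\theta e^{\theta t}\int_0^te^{-\theta s}B^H_s\,ds+B^H_t$. $\Gamma$ is the Gamma function. *)

(* Defs.v *)
From HB Require Import structures.
From mathcomp Require Import all_boot all_order all_algebra.
From mathcomp Require Import all_classical all_reals all_analysis.

Set Implicit Arguments.
Unset Strict Implicit.
Unset Printing Implicit Defensive.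

Import Order.TTheory GRing.Theory Num.Theory.
Import numFieldNormedType.Exports.

Local Open Scope classical_set_scope.
Local Open Scope ring_scope.

(* Gaussian law with mean m and standard deviation s; the library's
   normal_prob m 0 is the uniform law on [0, 1], whereas the degenerate
   Gaussian law is the Dirac mass at m. *)
Definition gaussian_law (R : realType) (m s : R) (A : set R) : \bar R :=
  if s == 0 then \d_m A else normal_prob m s A.

Definition gaussian_rv d (T : measurableType d) (R : realType)
    (P : probability T R) (Y : T -> R) : Prop :=
  exists m s : R, forall A : set R, measurable A ->
    P (Y @^-1` A) = gaussian_law m s A.

(* Joint Gaussianity of the finite-dimensional distributions, by linear
   combinations. *)
Definition gaussian_process d (T : measurableType d) (R : realType)
    (P : probability T R) (B : R -> {RV P >-> R}) : Prop :=
  forall (k : nat) (t c : 'I_k -> R),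
    gaussian_rv P (fun w => \sum_(i < k) c i * B (t i) w).

Definition fractional_brownian_motion d (T : measurableType d) (R : realType)
    (P : probability T R) (H : R) (B : R -> {RV P >-> R}) : Prop :=
  [/\ gaussian_process B,
      (forall t, 'E_P[B t] = 0)%E,
      (forall t s, 'E_P[fun w => (B t w * B s w)%R]%E =
         (2^-1 * (`|t| `^ (2 * H) + `|s| `^ (2 * H)
                  - `|t - s| `^ (2 * H)))%:E) &
      {ae P, forall w, continuous (fun t => B t w)}].

(* Only the times t >= 0 of X are constrained.  The integrability clause makes
   the integral meaningful: Rintegral is total, with junk values outside the
   integrable functions. *)
Definition fractional_ornstein_uhlenbeck d (T : measurableType d)
    (R : realType) (P : probability T R) (x0 theta : R)
    (B X : R -> {RV P >-> R}) : Prop :=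
  {ae P, forall w, forall t, 0 <= t ->
     lebesgue_measure.-integrable `[0, t] (fun s => (X s w)%:E) /\
     X t w = x0 + theta * (\int[lebesgue_measure]_(s in `[0, t]) X s w)
             + B t w}.

Definition Gamma (R : realType) (a : R) : R :=
  \int[lebesgue_measure]_(x in `]0, +oo[) (x `^ (a - 1) * expR (- x)).

Section estimators.
Context d (T : measurableType d) (R : realType) (P : probability T R).
Implicit Types (X : R -> {RV P >-> R}) (m n : nat) (w : T).

Definition sum_sq_obs X m n w : R :=
  \sum_(0 <= k < n ^ m) (X (k%:R / n%:R) w) ^+ 2.

Definition theta3 (H : R) X m n w : R :=
  - ((H * Gamma (2 * H) * (n ^ m)%:R)^-1 * sum_sq_obs X m n w)
      `^ (- (2 * H)^-1).

Definition theta4 X m n w : R :=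
  n%:R * (X (n ^ m.-1)%:R w) ^+ 2 / (2 * sum_sq_obs X m n w).

Definition strongly_consistent (est : nat -> T -> R) (theta : R) : Prop :=
  {ae P, forall w, est n w @[n --> \oo] --> theta}.

End estimators.

(* Main.v *)
(* Case theta = - lam < 0.  By Gronwall's lemma, over a cell of the mesh 1/n the
   path satisfies X_((k+1)/n) = e^(-lam/n) X_(k/n) + (increment of B^H) up to
   (1 - e^(-lam/n)) times the oscillation of B^H on the cell, and chaining makes
   these oscillations uniformly small over n^p cells.  So the mean of the
   X_(k/n)^2 over n^M cells is asymptotic to the same mean for the Gaussian
   autoregression driven by the increments.  The expectation of the latter tends
   to H Gamma(2H) lam^(-2H); for M large its variance is O(n^(-2)), and it
   converges almost surely by Borel-Cantelli.  Finally the mean over n^M cells is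
   asymptotic to T^(-1) int_0^T X_s^2 ds with T = n^(M-1); the integral being
   monotone in T, its limit along this sequence passes to every T -> oo, hence
   back to the mean over n^m cells for every m > 1.

   Case theta > 0.  The discounted path e^(-theta t) X_t converges to some xi,
   which is also the limit of discounted sums of increments of B^H.  Those are
   Gaussian with variance bounded below, because their covariance with B^H_1 is,
   so P(|xi| <= eps) = O(eps) and xi is almost surely nonzero.  The ratio then
   converges to theta by comparison with a geometric series. *)

Require Import Defs.
From HB Require Import structures.
From mathcomp Require Import all_boot all_order all_algebra.
From mathcomp Require Import all_classical all_reals all_analysis.
From mathcomp Require Import measurable_realfun ring lra zify.

Set Implicit Arguments.
Unset Strict Implicit.
Unset Printing Implicit Defensive.

Import Order.TTheory GRing.Theory Num.Theory.
Import numFieldNormedType.Exports.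

Local Open Scope classical_set_scope.
Local Open Scope ring_scope.

(** * Moments of Gaussian variables *)

(** The exponent M has to depend on H. The autoregression remembers about n / lam steps, so every
    index of a covariance costs a factor O(n), while the absolute autocovariances of the noise sum
    over N cells only to O(N^(max(0, 2H - 1))). With N = n^M the resulting bound on the variance of
    the mean is of order n^4 N^(max(0, 2H - 1) - 1), which is O(n^(-2)) only once M is large, and
    the threshold grows without bound as H approaches 1. A small m is therefore out of reach of
    Borel-Cantelli by this bound, whence the passage through a monotone integral.

    Randomness enters only through finite linear combinations of values of B^H: their even moments,
    the covariance of two squares, and the bound on a Gaussian density by its peak. Everything else
    is pathwise and uses nothing of the noise but its continuity and small oscillation; no
    stochastic integral and no ergodic theorem appears. The constant H Gamma(2H) arises because the
    autocovariances are second differences of j^(2H): two summations by parts turn their geometric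
    sums into Riemann-Stieltjes sums of exp(-u) against u^(2H), whose limit is 2H Gamma(2H). *)

Section normal_moments.
Context (R : realType).
Implicit Types (m s x : R) (k : nat).
Local Notation mu := (@lebesgue_measure R).

Lemma normr_exp_le1D x k : `|x| ^+ k <= 1 + (x ^+ 2) ^+ k.+1.
Proof.
have [x1|x1] := leP `|x| 1.
  by rewrite (le_trans (exprn_ile1 _ _ x1))// lerDl exprn_ge0// sqr_ge0.
rewrite -(real_normK (num_real x)) -exprM (@le_trans _ _ (`|x| ^+ (2 * k.+1)))//.
  by rewrite ler_weXn2l ?ltW//; lia.
by rewrite lerDr.
Qed.

(** Doubling the standard deviation frees a Gaussian factor that absorbs any power, so integrability
    of all moments reduces to that of a normal density. *)
Lemma normal_fun_moment_bound s k : s != 0 -> exists2 C, 0 <= C &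
  forall m x, `|x - m| ^+ k * normal_fun m s x <= C * normal_fun m (2 * s) x.
Proof.
move=> s0; have s2 : 0 < s ^+ 2 by rewrite exprn_even_gt0.
(* The difference of the exponents 1 / (2 s^2) and 1 / (2 (2 s)^2). *)
pose c := 3 / (8 * s ^+ 2).
have c0 : 0 < c by rewrite divr_gt0// mulr_gt0.
exists (1 + (k.+1)`!%:R / c ^+ k.+1).
  by rewrite addr_ge0// divr_ge0// exprn_ge0// ltW.
move=> m x; set y := x - m.
have -> : normal_fun m s x = expR (- (c * y ^+ 2)) * normal_fun m (2 * s) x.
  rewrite /normal_fun -expRD; congr expR; rewrite /c -/y; field.
  by rewrite s0.
rewrite mulrA ler_wpM2r ?normal_fun_ge0// expRN ler_pdivrMr ?expR_gt0//.
have cy0 : 0 <= c * y ^+ 2 by rewrite mulr_ge0 ?sqr_ge0// ltW.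
have e1 : 1 <= expR (c * y ^+ 2) by rewrite -[leLHS]expR0 ler_expR.
have := @expR_ge1Dxn _ _ k cy0.
set E := expR _ => H.
have H2 : (c * y ^+ 2) ^+ k.+1 <= k.+1`!%:R * E.
  rewrite [leRHS]mulrC -ler_pdivrMr ?ltr0n ?fact_gt0//.
  by apply: le_trans H; rewrite lerDr.
apply: (le_trans (normr_exp_le1D _ _)).
rewrite mulrDl mul1r lerD//.
rewrite -mulrA (mulrC _^-1) mulrA ler_pdivlMr ?exprn_gt0//.
by rewrite -exprMn mulrC.
Qed.

Let pdf_moment m s k x := (x - m) ^+ k * normal_pdf m s x.

Lemma continuous_normal_moment m s k : s != 0 -> continuous (pdf_moment m s k).
Proof.
move=> s0 x; apply: cvgM; last exact: continuous_normal_pdf.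
apply: (@continuous_comp _ _ _ (fun x => x - m) (fun y => y ^+ k)).
  by apply: cvgB; [exact: cvg_id|exact: cvg_cst].
exact: exprn_continuous.
Qed.

Lemma measurable_normal_moment m s k : s != 0 ->
  measurable_fun setT (pdf_moment m s k).
Proof.
by move=> s0; apply: continuous_measurable_fun; exact: continuous_normal_moment.
Qed.

Lemma normal_moment_bound s k : s != 0 -> exists2 C, 0 <= C &
  forall m x, `|pdf_moment m s k x| <= C * normal_pdf m (2 * s) x.
Proof.
move=> s0; have [C C0 HC] := normal_fun_moment_bound k s0.
have s20 : 2 * s != 0 by rewrite mulf_neq0.
exists (normal_peak s * C / normal_peak (2 * s)).
  by rewrite divr_ge0 ?mulr_ge0// normal_peak_ge0.
move=> m x; rewrite /pdf_moment !normal_pdfE//=.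
rewrite [in leRHS]mulrA divfK ?gt_eqF ?normal_peak_gt0//.
rewrite mulrCA normrM ger0_norm ?normal_peak_ge0// -mulrA ler_wpM2l ?normal_peak_ge0//.
by rewrite normrM normrX (ger0_norm (normal_fun_ge0 _ _ _)).
Qed.

Lemma integrable_normal_moment m s k : s != 0 ->
  mu.-integrable setT (EFin \o pdf_moment m s k).
Proof.
move=> s0; have [C C0 HC] := normal_moment_bound k s0.
apply: (@le_integrable _ _ _ mu _ _ _ (fun x => (C%:E * (normal_pdf m (2 * s) x)%:E)%E)) => //.
- by apply/measurable_EFinP; exact: measurable_normal_moment.
- move=> x _ /=; rewrite lee_fin.
  by rewrite (le_trans (HC m x))// ler_norm.
- by apply: integrableZl => //; exact: integrable_normal_pdf.
Qed.

Lemma cvg_integral_ball_nat (f : R -> R) : mu.-integrable setT (EFin \o f) ->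
  (\int[mu]_(x in `[(- n%:R)%R, n%:R%R]) (f x)%:E)%E @[n --> \oo] --> (\int[mu]_x (f x)%:E)%E.
Proof.
move=> intf.
have /integrableP[/measurable_EFinP mf _] := intf.
pose fn (n : nat) : R -> R := f \_ `[- n%:R, n%:R].
have mI n : measurable_fun setT (fn n).
  by apply: (measurable_restrictT _ _).1 => //; exact: measurable_funTS.
have [] := @dominated_convergence _ _ _ mu setT measurableT
  (fun n x => (fn n x)%:E) (EFin \o f) (fun x => `|(f x)%:E|%E).
- by move=> n; apply/measurable_EFinP; exact: mI.
- exact/measurable_EFinP.
- apply: aeW => x _; apply: cvg_near_cst.
  near=> n; rewrite /fn patchE ifT// inE /= in_itv/= -ler_norml.
  by near: n; exact: nbhs_infty_ger.
- exact: integrable_abse.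
- apply: aeW => x n _ /=; rewrite /fn patchE; case: ifPn => // _.
  by rewrite normr0 lee_fin.
- move=> _ _ H; apply: cvg_trans H; apply: near_eq_cvg; near=> n.
  by rewrite [RHS]integral_mkcond restrict_EFin.
Unshelve. all: by end_near. Qed.

Lemma integral_derive0 (F f : R -> R) :
  (forall x, is_derive x 1 F (f x)) -> continuous f ->
  mu.-integrable setT (EFin \o f) ->
  F n%:R @[n --> \oo] --> 0 -> F (- n%:R) @[n --> \oo] --> 0 ->
  (\int[mu]_x (f x)%:E = 0)%E.
Proof.
move=> dF cf intf Fp Fn.
have H := cvg_integral_ball_nat intf.
have H2 : (\int[mu]_(x in `[(- n%:R)%R, n%:R%R]) (f x)%:E)%E @[n --> \oo] --> 0%E.
  suff : ((F n%:R - F (- n%:R))%R%:E)%E @[n --> \oo] --> 0%E.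
    apply: cvg_trans; apply: near_eq_cvg; near=> n.
    have n0 : (0 < n)%N by near: n; exact: nbhs_infty_gt.
    rewrite (@continuous_FTC2 _ f F)//.
    - by rewrite -subr_gt0 opprK addr_gt0// ltr0n.
    - exact: continuous_subspaceT.
    - have cF : continuous F.
        move=> x; apply: differentiable_continuous; apply/derivable1_diffP.
        by have [] := dF x.
      split => //.
      + by apply: cvg_at_right_filter; exact: cF.
      + by apply: cvg_at_left_filter; exact: cF.
    - by move=> x _; rewrite derive1E derive_val.
  apply: cvg_EFin; first exact: nearW.
  by rewrite -[X in _ --> X](subrr 0); apply: cvgB.
by rewrite (cvg_unique _ H H2).
Unshelve. all: by end_near. Qed.

Lemma is_derive_normal_pdf m s x : s != 0 ->
  is_derive x 1 (normal_pdf m s) (- (x - m) / s ^+ 2 * normal_pdf m s x).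
Proof.
move=> s0; rewrite normal_pdfE//.
rewrite /normal_fun.
have s20 : s ^+ 2 != 0 by rewrite sqrf_eq0.
apply: is_derive_eq.
rewrite !scaler0 ?addr0 ?add0r /GRing.scale/=.
by field.
Qed.


(** The integrand of order [k.+1] is bounded, hence the one of order [k] is O(1 / |u|). *)
Lemma cvg_normal_moment m s k (u : nat -> R) : s != 0 ->
  `|u n| @[n --> \oo] --> +oo -> pdf_moment m s k (m + u n) @[n --> \oo] --> 0.
Proof.
move=> s0 uy; have [C C0 HC] := normal_moment_bound k.+1 s0.
have s20 : 2 * s != 0 by rewrite mulf_neq0.
pose D := C * normal_peak (2 * s).
have HD n : u n != 0 -> `|pdf_moment m s k (m + u n)| <= D * `|u n|^-1.
  move=> un0; rewrite ler_pdivlMr ?normr_gt0// mulrC.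
  have -> : `|u n| * `|pdf_moment m s k (m + u n)| = `|pdf_moment m s k.+1 (m + u n)|.
    by rewrite -normrM /pdf_moment; congr `|_|; rewrite addrAC subrr add0r exprS mulrA.
  by rewrite (le_trans (HC _ _))// /D ler_wpM2l// normal_pdf_ub.
apply/norm_cvg0P.
have H0 : D * `|u n|^-1 @[n --> \oo] --> 0.
  rewrite -[X in _ --> X](mulr0 D); apply: cvgMr => //.
  by apply/gtr0_cvgV0 => //; near=> n; near: n; apply: (cvgry_gt uy).
apply: squeeze_cvgr (@cvg_cst _ (0 : R) _ _ _) H0.
near=> n; rewrite normr_ge0/= HD//.
rewrite -normr_gt0; near: n; exact: (cvgry_gt uy).
Unshelve. all: by end_near. Qed.

Lemma cvgy_norm_nat : `|n%:R| @[n --> \oo] --> (+oo : set_system R).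
Proof.
under eq_fun do rewrite normr_nat.
by apply/cvgryPge => A; exact: nbhs_infty_ger.
Qed.

Lemma cvgy_norm_shift (u : nat -> R) m : `|u n| @[n --> \oo] --> +oo ->
  `|u n - m| @[n --> \oo] --> +oo.
Proof.
move=> uy; apply/cvgryPge => A; near=> n.
have : A + `|m| <= `|u n| by near: n; exact: (cvgry_ge uy).
by have := ler_normB (u n - m) (- m); rewrite opprK subrK normrN; lra.
Unshelve. all: by end_near. Qed.

(** Integration by parts: the difference of the integrands is the derivative of - s^2 (x - m)^k
    times the density. For [k = 0] the coefficient vanishes, so the truncated [k.-1] does no
    harm. *)
Lemma integral_normal_momentS m s k : s != 0 ->
  (\int[mu]_x (pdf_moment m s k.+1 x)%:E =
   (k%:R * s ^+ 2)%:E * \int[mu]_x (pdf_moment m s k.-1 x)%:E)%E.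
Proof.
move=> s0.
have s20 : s ^+ 2 != 0 by rewrite sqrf_eq0.
have I1 := integrable_normal_moment m k.+1 s0.
have I2 := integrable_normal_moment m k.-1 s0.
pose f x := pdf_moment m s k.+1 x - k%:R * s ^+ 2 * pdf_moment m s k.-1 x.
have I3 : mu.-integrable setT (fun x => ((k%:R * s ^+ 2)%:E * (pdf_moment m s k.-1 x)%:E)%E).
  exact: integrableZl.
suff : (\int[mu]_x (f x)%:E = 0)%E.
  rewrite /f; under eq_integral do rewrite EFinB (EFinM (k%:R * s ^+ 2)).
  rewrite integralB//= integralZl//= => /eqP; rewrite sube_eq ?add0e; first by move/eqP.
    by apply: integrable_fin_num.
  rewrite fin_num_adde_defl//. 
  by rewrite fin_numM//; apply: integrable_fin_num.
pose F x := - s ^+ 2 * pdf_moment m s k x.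
have cF u : `|u n| @[n --> \oo] --> +oo -> F (u n) @[n --> \oo] --> 0.
  move=> uy; rewrite /F -[X in _ --> X](mulr0 (- s ^+ 2)); apply: cvgMr => //.
  have := @cvg_normal_moment m s k (fun n => u n - m) s0 (cvgy_norm_shift m uy).
  by under eq_fun do rewrite addrC subrK.
apply: (@integral_derive0 F).
- move=> x; rewrite /F /f /pdf_moment.
  have D2 := @is_derive_normal_pdf m s x s0.
  have D1 : is_derive x 1 (fun y => (y - m) ^+ k) (k%:R * (x - m) ^+ k.-1).
    have D0 := is_deriveX k (is_deriveB (is_derive_id x (1 : R)) (is_derive_cst m x (1 : R))).
    rewrite (_ : (fun y => _) = (id - cst m) ^+ k); last first.
      by apply/funext => y; rewrite exprfctE.
    by apply: (is_derive_eq D0); rewrite subr0 /GRing.scale/= mulr1.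
  have D3 := is_deriveZ (- s ^+ 2) (is_deriveM D1 D2).
  apply: (is_derive_eq D3); rewrite /GRing.scale/=.
  case: k {I1 I2 I3 f F cF D1 D3} => [|k] /=; first by field.
  by rewrite !exprS; field.
- move=> x; apply: cvgB; first exact: continuous_normal_moment.
  by apply: cvgM; [exact: cvg_cst|exact: continuous_normal_moment].
- rewrite /f; have := integrableB measurableT I1 I3.
  by apply: eq_integrable => // x _; rewrite /= EFinB (EFinM (k%:R * s ^+ 2)).
- exact/cF/cvgy_norm_nat.
- by apply: cF; under eq_fun do rewrite normrN; exact/cvgy_norm_nat.
Qed.

(** The double factorial (2q - 1)!!. *)
Definition odd_fact q : R := \prod_(i < q) (2 * i + 1)%:R.

Lemma odd_fact_ge0 q : 0 <= odd_fact q.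
Proof. exact: prodr_ge0. Qed.

Lemma integral_normal_moment0 m s : s != 0 ->
  (\int[mu]_x (pdf_moment m s 0 x)%:E = 1)%E.
Proof.
move=> s0; rewrite -(integral_normal_pdf m s); apply: eq_integral => x _.
by rewrite /pdf_moment expr0 mul1r.
Qed.

Lemma integral_normal_even m s q : s != 0 ->
  (\int[mu]_x (pdf_moment m s (2 * q) x)%:E = (odd_fact q * s ^+ (2 * q))%:E)%E.
Proof.
move=> s0; elim: q => [|q IH].
  by rewrite /odd_fact big_ord0 muln0 expr0 mul1r integral_normal_moment0.
rewrite (_ : (2 * q.+1)%N = (2 * q).+2); last by lia.
rewrite integral_normal_momentS//= IH -EFinM; congr EFin.
rewrite /odd_fact big_ord_recr/= !exprS addn1; ring.
Qed.

End normal_moments.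

Section gaussian_moments.
Context d (T : measurableType d) (R : realType) (P : probability T R).
Local Notation mu := (@lebesgue_measure R).

(** The density agrees almost everywhere with the Radon-Nikodym derivative, for which the change of
    variables is available. *)
Lemma ge0_integral_normal_prob m s (f : R -> \bar R) : s != 0 ->
  measurable_fun setT f -> (forall x, 0 <= f x)%E ->
  (\int[normal_prob m s]_x f x = \int[mu]_x (f x * (normal_pdf m s x)%:E))%E.
Proof.
move=> s0 mf f0.
have dom := normal_prob_dominates m s.
rewrite -(Radon_Nikodym_SigmaFinite.change_of_variables dom)//=.
apply: ge0_ae_eq_integral => //.
- apply: emeasurable_funM => //.
  exact: (measurable_int mu (Radon_Nikodym_SigmaFinite.f_integrable dom)).
- apply: emeasurable_funM => //; apply/measurable_EFinP.
  exact: measurable_normal_pdf.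
- by move=> x _; rewrite mule_ge0// Radon_Nikodym_SigmaFinite.f_ge0.
- by move=> x _; rewrite mule_ge0// lee_fin normal_pdf_ge0.
apply: ae_eqe_mul2l => /=.
apply: integral_ae_eq => //=.
- exact: Radon_Nikodym_SigmaFinite.f_integrable.
- by apply/measurable_EFinP; exact: measurable_normal_pdf.
- by move=> E _ mE; rewrite -Radon_Nikodym_SigmaFinite.f_integral.
Qed.

Lemma ge0_integral_law (Y : T -> R)
    (nu : {measure set (measurableTypeR R) -> \bar R}) (f : R -> \bar R) :
  measurable_fun setT Y ->
  (forall A : set R, measurable A -> P (Y @^-1` A) = nu A) ->
  measurable_fun setT f -> (forall x, 0 <= f x)%E ->
  (\int[P]_w f (Y w) = \int[nu]_x f x)%E.
Proof.
move=> mY0 law mf f0; pose Y' : T -> measurableTypeR R := Y.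
have mY : measurable_fun setT Y' by move=> _ A mA; exact: (mY0 measurableT A mA).
have := @ge0_integral_pushforward _ _ T (measurableTypeR R) R Y' mY P setT f measurableT mf (fun x _ => f0 x).
rewrite preimage_setT => <-.
by apply: eq_measure_integral => A mA _; exact: law.
Qed.

(** The second identity encodes the mean: compared with the first at [q = 1] it says that Y - m is
    centered. Both integrands are nonnegative, so the law can be substituted before any
    integrability is known. *)
Lemma gaussian_law_moments (Y : T -> R) (m s : R) : measurable_fun setT Y ->
  (forall A, measurable A -> P (Y @^-1` A) = gaussian_law m s A) ->
  (forall q, \int[P]_w ((Y w - m) ^+ (2 * q))%:E = (odd_fact R q * s ^+ (2 * q))%:E)%E /\
  (\int[P]_w ((Y w - m + 1) ^+ 2)%:E = (s ^+ 2 + 1)%:E)%E.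
Proof.
move=> mY law.
have mX (c : R) k : measurable_fun setT (fun x : R => (((x - c) ^+ k)%:E)%E).
  by apply/measurable_EFinP; apply: measurable_funX; exact: measurable_funB.
have pos (c x : R) q : (0 <= ((x - c) ^+ (2 * q))%:E)%E.
  by rewrite lee_fin exprM exprn_ge0// sqr_ge0.
have shift (y : R) : y - m + 1 = y - (m - 1) by ring.
under [X in _ /\ X = _]eq_integral do rewrite shift -[2%N]/(2 * 1)%N.
move: law; rewrite /gaussian_law; case: eqVneq => [->|s0] law.
  have E c q : (\int[P]_w ((Y w - c) ^+ (2 * q))%:E = ((m - c) ^+ (2 * q))%:E)%E.
    rewrite (@ge0_integral_law Y (@dirac _ (measurableTypeR R) m R) (fun x => ((x - c) ^+ (2 * q))%:E))//.
    rewrite integral_dirac//=; last exact: mX.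
    rewrite -[RHS]mul1e; congr (_ * _)%E.
    exact: (@diracT _ (measurableTypeR R) R m).
  rewrite E; split=> [q|]; last by congr EFin; ring.
  rewrite E subrr; congr EFin; case: q => [|q]; last by rewrite mulnS !exprS !mul0r mulr0.
  by rewrite /odd_fact big_ord0 mul1r.
have E c q : (\int[P]_w ((Y w - c) ^+ (2 * q))%:E =
   \int[mu]_x ((x - c) ^+ (2 * q) * normal_pdf m s x)%:E)%E.
  rewrite (@ge0_integral_law Y (normal_prob m s) (fun x => ((x - c) ^+ (2 * q))%:E))//.
  by rewrite ge0_integral_normal_prob//.
rewrite E; split=> [q|]; first by rewrite E integral_normal_even.
pose I k := integrable_normal_moment m k s0.
transitivity (\int[mu]_x (((x - m) ^+ 2 * normal_pdf m s x)%:E +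
  (2%:E * ((x - m) ^+ 1 * normal_pdf m s x)%:E + ((x - m) ^+ 0 * normal_pdf m s x)%:E)))%E.
  by apply: eq_integral => x _; rewrite -EFinM -!EFinD; congr EFin; ring.
have I1 : mu.-integrable setT (fun x => 2%:E * ((x - m) ^+ 1 * normal_pdf m s x)%:E)%E.
  by apply: integrableZl => //; exact: I.
rewrite integralD//; first last.
- by apply: integrableD => //; exact: I.
- exact: I.
rewrite integralD//; last exact: I.
rewrite integralZl//; last exact: I.
rewrite (integral_normal_momentS m 0 s0) (integral_normal_momentS m 1 s0) mulr0n mul0r mul0e mule0 add0e mul1r.
have I0 := integral_normal_moment0 m s0.
by rewrite /= I0 mule1 -EFinD.
Qed.

End gaussian_moments.

(** * Almost sure convergence from summable expectations *)

Section borel_cantelli.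
Context d (T : measurableType d) (R : realType) (P : probability T R).

Lemma sum_inv_sqr_le2 N : \sum_(i < N) (i.+1%:R ^+ 2)^-1 <= 2 :> R.
Proof.
suff : \sum_(i < N) (i.+1%:R ^+ 2)^-1 <= 2 - 2 / N.+1%:R :> R.
  by move/le_trans; apply; rewrite gerBl divr_ge0.
elim: N => [|N IH]; first by rewrite big_ord0 divr1 subrr.
rewrite big_ord_recr/=; apply: (le_trans (lerD IH (lexx _))).
rewrite -subr_ge0.
have N1 : 0 < N.+1%:R :> R by [].
have -> : 2 - 2 / N.+2%:R - (2 - 2 / N.+1%:R + (N.+1%:R ^+ 2)^-1) =
    (N%:R / (N.+1%:R ^+ 2 * N.+2%:R)) :> R.
  rewrite -(natr1 N) -(natr1 N.+1) -(natr1 N); field.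
  by rewrite !natr1 !pnatr_eq0.
by rewrite divr_ge0// mulr_ge0// exprn_ge0.
Qed.

(** The series of the [f n] has a finite integral, hence converges almost everywhere, and its terms
    tend to 0. *)
Lemma summable_expectation_cvg0 (f : nat -> T -> R) (C : R) (n0 : nat) :
  (forall n, measurable_fun setT (f n)) -> (forall n w, 0 <= f n w) ->
  (forall n, (n0 <= n)%N -> (\int[P]_w (f n w)%:E <= (C / n%:R ^+ 2)%:E)%E) ->
  {ae P, forall w, f n w @[n --> \oo] --> 0}.
Proof.
move=> mf f0 fC.
(* The index [n + n0.+1] is at least both [n0] and [n.+1], so [C / n.+1 ^ 2] bounds the expectation
   for every [n], zero included. *)
pose g n := f (n + n0.+1)%N.
have C0 : 0 <= C.
  have := fC n0.+1 (leqnSn _).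
  have : (0 <= \int[P]_w (f n0.+1 w)%:E)%E by apply: integral_ge0 => w _; rewrite lee_fin; exact: f0.
  by move=> /le_trans H /H; rewrite lee_fin pmulr_lge0// invr_gt0 exprn_gt0.
have mg n : measurable_fun setT (fun w => (g n w)%:E) by apply/measurable_EFinP; exact: mf.
have g0 n w : (0 <= (g n w)%:E)%E by rewrite lee_fin; exact: f0.
have ig : (\int[P]_w (\sum_(n <oo) (g n w)%:E) <= (C * 2)%:E)%E.
  rewrite integral_nneseries//; apply: lime_le.
    by apply: is_cvg_nneseries => n _ _; exact: integral_ge0.
  apply: nearW => N; rewrite big_mkord.
  apply: (@le_trans _ _ (\sum_(n < N) (C * (n.+1%:R ^+ 2)^-1)%:E)%E).
    apply: lee_sum => n _; have Hn : (n0 <= n + n0.+1)%N by lia.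
    apply: (le_trans (fC _ Hn)).
    rewrite lee_fin ler_wpM2l// lef_pV2 ?posrE ?exprn_gt0 ?ltr0n ?addnS//.
    by rewrite lerXn2r ?nnegrE// ler_nat ltnS leq_addr.
  by rewrite sumEFin lee_fin -mulr_sumr ler_wpM2l// sum_inv_sqr_le2.
have mS : measurable_fun setT (fun w => \sum_(n <oo) (g n w)%:E)%E.
  by apply: ge0_emeasurable_sum => // n w _ _.
have : {ae P, forall w, ((\sum_(n <oo) (g n w)%:E) \is a fin_num)%E}.
  have : P.-integrable setT (fun w => \sum_(n <oo) (g n w)%:E)%E.
    apply/integrableP; split => //.
    rewrite (eq_integral (fun w => \sum_(n <oo) (g n w)%:E)%E).
      by rewrite (le_lt_trans ig)// ltry.
    by move=> w _; rewrite gee0_abs//; apply: nneseries_ge0 => n _ _; exact: g0.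
  by move/integrable_ae => /(_ measurableT); apply: filterS => w; exact.
apply: filterS => w fin.
have bnd N : \sum_(0 <= n < N) g n w <= fine (\sum_(n <oo) (g n w)%:E)%E.
  rewrite -lee_fin fineK// -sumEFin.
  by apply: nneseries_lim_ge => n _ _.
have : cvgn (series (fun n => g n w)).
  apply: nondecreasing_is_cvgn.
    by apply/nondecreasing_seqP => n; rewrite seriesEnat/= big_nat_recr//= lerDl; exact: f0.
  by exists (fine (\sum_(n <oo) (g n w)%:E)%E) => _ [n _ <-]; exact: bnd.
by move/cvg_series_cvg_0; rewrite (cvg_shiftn n0.+1 (fun n => f n w)).
Qed.

End borel_cantelli.

(** * The algebra of random variables with all moments *)

Section all_moments.
Context d (T : measurableType d) (R : realType) (P : probability T R).
Implicit Types (f g : T -> R) (q : nat).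
Local Notation E f := (\int[P]_w f w)%R.

(** Even powers are nonnegative and dominate the others; asking for all of them gives a class closed
    under sums and products, on which the mean is linear without further integrability
    conditions. *)
Definition has_moments f := measurable_fun setT f /\
  forall q, P.-integrable setT (fun w => (f w ^+ (2 * q))%:E).

Lemma le_integrable_fun f g : measurable_fun setT f ->
  P.-integrable setT (EFin \o g) -> (forall w, `|f w| <= g w) ->
  P.-integrable setT (EFin \o f).
Proof.
move=> mf ig fg; apply: le_integrable ig => //; first exact/measurable_EFinP.
by move=> w _ /=; rewrite lee_fin (le_trans (fg w))// ler_norm.
Qed.

Lemma has_moments_integrable f : has_moments f -> P.-integrable setT (EFin \o f).
Proof.
move=> [mf intf]; apply: (@le_integrable_fun _ (fun w => f w ^+ (2 * 0) + f w ^+ (2 * 1))) => //.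
  by apply: (eq_integrable _ _ _ _ (integrableD _ (intf 0) (intf 1))).
move=> w; rewrite muln0 expr0 muln1 -(real_normK (num_real (f w))).
have := sqr_ge0 (`|f w| - 1); rewrite sqrrB1.
by have := normr_ge0 (f w); set a := `|f w|; nra.
Qed.

Lemma has_momentsP f : measurable_fun setT f ->
  (forall q, exists2 g : T -> R, P.-integrable setT (EFin \o g) &
     forall w, f w ^+ (2 * q) <= g w) -> has_moments f.
Proof.
move=> mf H; split=> // q; have [g ig fg] := H q.
apply: (@le_integrable_fun (fun w => f w ^+ (2 * q)) g) => //.
  exact: measurable_funX.
by move=> w; rewrite ger0_norm// exprM exprn_ge0// sqr_ge0.
Qed.

Lemma has_moments_cst (c : R) : has_moments (cst c).
Proof.
by split=> [|q]; [exact: measurable_cst|exact: (finite_measure_integrable_cst P (c ^+ (2 * q)))].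
Qed.

Lemma has_momentsM f g : has_moments f -> has_moments g ->
  has_moments (fun w => f w * g w).
Proof.
move=> [mf intf] [mg intg]; apply: has_momentsP; first exact: measurable_funM.
move=> q; exists (fun w => f w ^+ (2 * (2 * q)) + g w ^+ (2 * (2 * q))).
  by apply: (eq_integrable _ _ _ _ (integrableD _ (intf (2 * q)%N) (intg (2 * q)%N))).
move=> w; rewrite exprMn !(mulnC 2 (2 * q)) !(exprM _ (2 * q) 2).
set a := f w ^+ _; set b := g w ^+ _.
have := sqr_ge0 (a - b); rewrite sqrrB.
have := sqr_ge0 a; have := sqr_ge0 b; nra.
Qed.

Lemma has_momentsD f g : has_moments f -> has_moments g ->
  has_moments (fun w => f w + g w).
Proof.
move=> [mf intf] [mg intg]; apply: has_momentsP; first exact: measurable_funD.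
move=> q; exists (fun w => 2 ^+ (2 * q) * (f w ^+ (2 * q) + g w ^+ (2 * q))).
  have := integrableZl measurableT (2 ^+ (2 * q)) (integrableD measurableT (intf q) (intg q)).
  by apply: eq_integrable => // w _.
have ev (x : R) : x ^+ (2 * q) = `|x| ^+ (2 * q) by rewrite !exprM real_normK// num_real.
move=> w; rewrite ev (ev (f w)) (ev (g w)).
wlog fg : f g {mf intf mg intg} / `|g w| <= `|f w|.
  move=> H; have [|/ltW] := leP `|g w| `|f w|; first exact: H.
  by move=> /H; rewrite addrC (addrC (_ ^+ _)).
apply: (@le_trans _ _ ((2 * `|f w|) ^+ (2 * q))).
  rewrite lerXn2r ?nnegrE// ?mulr_ge0// (le_trans (ler_normD _ _))//.
  by rewrite mulr_natl mulr2n lerD.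
by rewrite exprMn ler_wpM2l ?exprn_ge0// lerDl exprn_ge0.
Qed.

Lemma has_momentsZ (c : R) f : has_moments f -> has_moments (fun w => c * f w).
Proof. by apply: has_momentsM; exact: has_moments_cst. Qed.

Lemma has_momentsB f g : has_moments f -> has_moments g ->
  has_moments (fun w => f w - g w).
Proof.
move=> hf hg; have := has_momentsD hf (has_momentsZ (-1) hg).
by under eq_fun do rewrite mulN1r.
Qed.

Lemma has_momentsX f q : has_moments f -> has_moments (fun w => f w ^+ q).
Proof.
move=> hf; elim: q => [|q IH]; first exact: (has_moments_cst 1).
by under eq_fun do rewrite exprS; exact: has_momentsM.
Qed.

Lemma has_moments_sum (I : Type) (r : seq I) (F : I -> T -> R) :
  (forall i, has_moments (F i)) -> has_moments (fun w => \sum_(i <- r) F i w).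
Proof.
move=> hF; elim: r => [|i r IH].
  by under eq_fun do rewrite big_nil; exact: has_moments_cst.
by under eq_fun do rewrite big_cons; exact: has_momentsD.
Qed.

Lemma meanD f g : has_moments f -> has_moments g ->
  E (fun w => f w + g w) = E f + E g.
Proof. by move=> hf hg; rewrite RintegralD//; exact: has_moments_integrable. Qed.

Lemma meanZ (c : R) f : has_moments f -> E (fun w => c * f w) = c * E f.
Proof. by move=> hf; rewrite RintegralZl//; exact: has_moments_integrable. Qed.

Lemma meanB f g : has_moments f -> has_moments g ->
  E (fun w => f w - g w) = E f - E g.
Proof. by move=> hf hg; rewrite RintegralB//; exact: has_moments_integrable. Qed.

Lemma mean_cst (c : R) : E (fun=> c) = c.
Proof. by rewrite Rintegral_cst// [X in fine X]probability_setT mulr1. Qed.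

Lemma mean_sum (I : Type) (r : seq I) (F : I -> T -> R) :
  (forall i, has_moments (F i)) ->
  E (fun w => \sum_(i <- r) F i w) = \sum_(i <- r) E (F i).
Proof.
move=> hF; elim: r => [|i r IH].
  by under eq_Rintegral do rewrite big_nil; rewrite mean_cst big_nil.
under eq_Rintegral do rewrite big_cons.
by rewrite meanD// ?IH ?big_cons//; exact: has_moments_sum.
Qed.

Lemma mean_ge0 f : (forall w, 0 <= f w) -> 0 <= E f.
Proof. by move=> f0; exact: Rintegral_ge0. Qed.

Lemma mean_EFin f : has_moments f -> (\int[P]_w (f w)%:E = (E f)%:E)%E.
Proof.
move=> hf; rewrite /Rintegral fineK//.
by apply: integrable_fin_num => //; exact: has_moments_integrable.
Qed.

Lemma gaussian_has_moments f : measurable_fun setT f -> gaussian_rv P f ->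
  has_moments f /\
  (E f = 0 ->
    (forall q, E (fun w => f w ^+ (2 * q)) = odd_fact R q * E (fun w => f w ^+ 2) ^+ q) /\
    exists2 s : R, s ^+ 2 = E (fun w => f w ^+ 2) &
      forall A, measurable A -> P (f @^-1` A) = gaussian_law 0 s A).
Proof.
move=> mf [m [s law]]; have [Hq H1] := gaussian_law_moments mf law.
have hfm : has_moments (fun w => f w - m).
  split; first exact: measurable_funB.
  move=> q; apply/integrableP; split.
    by apply/measurable_EFinP/measurable_funX; exact: measurable_funB.
  have pos w : 0 <= (f w - m) ^+ (2 * q) by rewrite exprM exprn_ge0// sqr_ge0.
  by under eq_integral do rewrite gee0_abs ?lee_fin ?pos//; rewrite Hq ltry.
have hf : has_moments f.
  have := has_momentsD hfm (has_moments_cst m).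
  by under eq_fun do rewrite subrK.
split=> // Ef0.
have h2 := Hq 1%N.
rewrite mean_EFin ?muln1 in h2; last exact: has_momentsX.
case: h2; rewrite /odd_fact big_ord1 mul1r => h2.
rewrite mean_EFin in H1; last by apply/has_momentsX/has_momentsD => //; exact: has_moments_cst.
case: H1 => H1.
(* The second moment of [f - m + 1] is s^2 + 1 by the law and s^2 - 2 m + 1 by linearity, since [f]
   is centered. *)
have m0 : m = 0.
  have hc := has_moments_cst.
  have h2f : has_moments (fun w => 2 * (f w - m)) by exact: has_momentsZ.
  have Em : E (fun w => f w - m) = - m.
    by rewrite (meanB hf (hc m)) Ef0 mean_cst add0r.
  have : E (fun w => (f w - m + 1) ^+ 2) = s ^+ 2 + 2 * - m + 1.
    transitivity (E (fun w => ((f w - m) ^+ 2 + 2 * (f w - m)) + 1)).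
      by apply: eq_Rintegral => w _; ring.
    rewrite (meanD (has_momentsD (has_momentsX 2 hfm) h2f) (hc 1)) mean_cst.
    by rewrite (meanD (has_momentsX 2 hfm) h2f) (meanZ 2 hfm) Em h2.
  by rewrite H1; lra.
subst m; split; last first.
  by exists s => //; rewrite -h2; apply: eq_Rintegral => w _; rewrite subr0.
move=> q; have := Hq q; under eq_integral do rewrite subr0.
rewrite mean_EFin; last exact: has_momentsX.
move=> [->]; congr (_ * _); rewrite exprM; congr (_ ^+ q).
by rewrite -h2; apply: eq_Rintegral => w _; rewrite subr0.
Qed.

End all_moments.

(** * Gaussian span of a fractional Brownian motion *)

Section gaussian_span.
Context d (T : measurableType d) (R : realType) (P : probability T R).
Context (H : R) (B : R -> {RV P >-> R}).
Hypothesis fbmB : fractional_brownian_motion H B.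
Implicit Types (G : T -> R) (t s : R).
Local Notation E f := (\int[P]_w f w)%R.

(** A list of pairs (coefficient, time), with repetitions allowed, makes the sum of two elements a
    concatenation. *)
Definition gauss_span G := exists s : seq (R * R),
  G = fun w => \sum_(p <- s) p.1 * B p.2 w.

Lemma gauss_span_B t : gauss_span (B t).
Proof. by exists [:: (1, t)]; apply/funext => w; rewrite big_seq1 mul1r. Qed.

Lemma gauss_spanD G1 G2 : gauss_span G1 -> gauss_span G2 ->
  gauss_span (fun w => G1 w + G2 w).
Proof.
move=> [s1 ->] [s2 ->]; exists (s1 ++ s2).
by apply/funext => w; rewrite big_cat.
Qed.

Lemma gauss_spanZ (c : R) G : gauss_span G -> gauss_span (fun w => c * G w).
Proof.
move=> [s ->]; exists [seq (c * p.1, p.2) | p <- s].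
apply/funext => w; rewrite big_map mulr_sumr.
by apply: eq_bigr => p _ /=; rewrite mulrA.
Qed.

Lemma gauss_spanB G1 G2 : gauss_span G1 -> gauss_span G2 ->
  gauss_span (fun w => G1 w - G2 w).
Proof.
move=> h1 h2; have := gauss_spanD h1 (gauss_spanZ (-1) h2).
by under eq_fun do rewrite mulN1r.
Qed.

Lemma gauss_span0 : gauss_span (fun=> 0).
Proof. by exists [::]; apply/funext => w; rewrite big_nil. Qed.

Lemma gauss_span_sum (I : Type) (r : seq I) (F : I -> T -> R) :
  (forall i, gauss_span (F i)) -> gauss_span (fun w => \sum_(i <- r) F i w).
Proof.
move=> hF; elim: r => [|i r IH].
  by under eq_fun do rewrite big_nil; exact: gauss_span0.
by under eq_fun do rewrite big_cons; exact: gauss_spanD.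
Qed.

Lemma gauss_span_gaussian G : gauss_span G -> gaussian_rv P G.
Proof.
move=> [s ->]; have [/(_ (size s)) gB _ _ _] := fbmB.
have := gB (fun i => (nth (0, 0) s i).2) (fun i => (nth (0, 0) s i).1).
congr gaussian_rv; apply/funext => w.
by rewrite (big_nth (0, 0)) big_mkord.
Qed.

Lemma B_has_moments t : has_moments P (B t).
Proof.
have mB : measurable_fun setT (B t) by [].
by have [] := gaussian_has_moments mB (gauss_span_gaussian (gauss_span_B t)).
Qed.

Lemma gauss_span_has_moments G : gauss_span G -> has_moments P G.
Proof.
move=> [s ->]; apply: has_moments_sum => p; apply: has_momentsZ.
exact: B_has_moments.
Qed.

Lemma gauss_span_mean0 G : gauss_span G -> E G = 0.
Proof.
move=> [s ->]; have hB t : has_moments P (B t) := B_has_moments t.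
rewrite (mean_sum s (fun p => has_momentsZ p.1 (hB p.2))).
rewrite big1// => p _; rewrite (meanZ p.1 (hB p.2)).
have [_ /(_ p.2) B0 _ _] := fbmB.
by rewrite /Rintegral; move: B0; rewrite unlock => ->; rewrite mulr0.
Qed.

Definition fbm_cov t s : R :=
  2^-1 * (`|t| `^ (2 * H) + `|s| `^ (2 * H) - `|t - s| `^ (2 * H)).

Lemma mean_BB t s : E (fun w => B t w * B s w) = fbm_cov t s.
Proof.
have [_ _ /(_ t s) + _] := fbmB.
by rewrite unlock /Rintegral => ->.
Qed.

Lemma gauss_span_even q G : gauss_span G ->
  E (fun w => G w ^+ (2 * q)) = odd_fact R q * E (fun w => G w ^+ 2) ^+ q.
Proof.
move=> hG; have [mG _] := gauss_span_has_moments hG.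
have [_ H2] := gaussian_has_moments mG (gauss_span_gaussian hG).
by have [/(_ q)] := H2 (gauss_span_mean0 hG).
Qed.

Lemma mean_sumMl (I : Type) (r : seq I) (F : I -> T -> R) G :
  (forall i, has_moments P (F i)) -> has_moments P G ->
  E (fun w => (\sum_(i <- r) F i w) * G w) =
  \sum_(i <- r) E (fun w => F i w * G w).
Proof.
move=> hF hG; rewrite -mean_sum; last by move=> i; exact: has_momentsM.
by apply: eq_Rintegral => w _; rewrite mulr_suml.
Qed.

(* Isserlis' formula, by polarization of E G^4 = 3 (E G^2)^2. *)
Lemma cov_sqr_gauss_span G1 G2 : gauss_span G1 -> gauss_span G2 ->
  E (fun w => (G1 w ^+ 2 - E (fun w => G1 w ^+ 2)) *
              (G2 w ^+ 2 - E (fun w => G2 w ^+ 2))) =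
  2 * E (fun w => G1 w * G2 w) ^+ 2.
Proof.
move=> h1 h2; have m1 := gauss_span_has_moments h1.
have m2 := gauss_span_has_moments h2.
have fourth G : gauss_span G ->
    E (fun w => G w ^+ 4) = 3 * E (fun w => G w ^+ 2) ^+ 2.
  move=> hG; rewrite -[4%N]/(2 * 2)%N gauss_span_even//.
  by rewrite /odd_fact !big_ord_recl big_ord0/= mulr1 mul1r.
set u := E (fun w => G1 w ^+ 2); set v := E (fun w => G2 w ^+ 2).
set c := E (fun w => G1 w * G2 w).
have m11 := has_momentsX 2 m1; have m22 := has_momentsX 2 m2.
have m12 := has_momentsM m1 m2; have mx := has_momentsM m11 m22.
have Ep : E (fun w => (G1 w + G2 w) ^+ 2) = u + 2 * c + v.
  transitivity (E (fun w => (G1 w ^+ 2 + 2 * (G1 w * G2 w)) + G2 w ^+ 2)).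
    by apply: eq_Rintegral => w _; ring.
  by rewrite (meanD (has_momentsD m11 (has_momentsZ 2 m12)) m22)
             (meanD m11 (has_momentsZ 2 m12)) (meanZ 2 m12).
have Em : E (fun w => (G1 w - G2 w) ^+ 2) = u - 2 * c + v.
  transitivity (E (fun w => (G1 w ^+ 2 - 2 * (G1 w * G2 w)) + G2 w ^+ 2)).
    by apply: eq_Rintegral => w _; ring.
  by rewrite (meanD (has_momentsB m11 (has_momentsZ 2 m12)) m22)
             (meanB m11 (has_momentsZ 2 m12)) (meanZ 2 m12).
have Ex : E (fun w => G1 w ^+ 2 * G2 w ^+ 2) = u * v + 2 * c ^+ 2.
  have hp := has_momentsX 4 (has_momentsD m1 m2).
  have hm := has_momentsX 4 (has_momentsB m1 m2).
  have h4 := has_momentsX 4 m1; have h4' := has_momentsX 4 m2.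
  (* Adding the two fourth powers cancels the mixed terms of odd degree in each variable. *)
  have : E (fun w => (G1 w + G2 w) ^+ 4 + (G1 w - G2 w) ^+ 4) =
         E (fun w => (2 * G1 w ^+ 4 + 2 * G2 w ^+ 4) + 12 * (G1 w ^+ 2 * G2 w ^+ 2)).
    by apply: eq_Rintegral => w _; ring.
  rewrite (meanD hp hm) (fourth _ (gauss_spanD h1 h2)) (fourth _ (gauss_spanB h1 h2)).
  rewrite (meanD (has_momentsD (has_momentsZ 2 h4) (has_momentsZ 2 h4')) (has_momentsZ 12 mx)).
  rewrite (meanD (has_momentsZ 2 h4) (has_momentsZ 2 h4')) (meanZ 2 h4) (meanZ 2 h4') (meanZ 12 mx).
  rewrite (fourth _ h1) (fourth _ h2) Ep Em -/u -/v => Hx.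
  by apply: (@mulfI _ 12) => //; rewrite -[LHS](addKr (2 * (3 * u ^+ 2) + 2 * (3 * v ^+ 2))) -Hx; ring.
transitivity (E (fun w => (G1 w ^+ 2 * G2 w ^+ 2 - v * G1 w ^+ 2) - (u * G2 w ^+ 2 - u * v))).
  by apply: eq_Rintegral => w _; ring.
have hc := has_moments_cst P (u * v).
rewrite (meanB (has_momentsB mx (has_momentsZ v m11)) (has_momentsB (has_momentsZ u m22) hc)).
rewrite (meanB mx (has_momentsZ v m11)) (meanB (has_momentsZ u m22) hc) (meanZ v m11) (meanZ u m22).
by rewrite mean_cst Ex -/u -/v; ring.
Qed.

Lemma mean_sqr_sum (I : Type) (r : seq I) (F : I -> T -> R) :
  (forall i, has_moments P (F i)) ->
  E (fun w => (\sum_(i <- r) F i w) ^+ 2) =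
  \sum_(i <- r) \sum_(j <- r) E (fun w => F i w * F j w).
Proof.
move=> hF; have hS := has_moments_sum r hF.
rewrite (mean_sumMl r hF hS); apply: eq_bigr => i _.
under eq_Rintegral do rewrite mulrC.
rewrite (mean_sumMl r hF (hF i)); apply: eq_bigr => j _.
by under eq_Rintegral do rewrite mulrC.
Qed.

Lemma var_sum_sqr (I : Type) (r : seq I) (F : I -> T -> R) :
  (forall i, gauss_span (F i)) ->
  E (fun w => (\sum_(i <- r) (F i w ^+ 2 - E (fun w => F i w ^+ 2))) ^+ 2) =
  2 * \sum_(i <- r) \sum_(j <- r) E (fun w => F i w * F j w) ^+ 2.
Proof.
move=> hF; rewrite mean_sqr_sum; last first.
  move=> i; apply: has_momentsB; last exact: has_moments_cst.
  exact/has_momentsX/gauss_span_has_moments.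
rewrite mulr_sumr; apply: eq_bigr => i _; rewrite mulr_sumr.
by apply: eq_bigr => j _; exact: cov_sqr_gauss_span.
Qed.

End gaussian_span.

(** * Oscillation of the paths *)

Section chaining.
Context (R : realType).

(** A point of level [L.+1] either belongs to level [L] or is one step to the right of such a point,
    so each refinement adds at most one increment of its level. *)
Lemma dyadic_chaining (b : R -> R) (n K : nat) (D r : R) :
  (0 < n)%N -> 0 <= D -> 0 <= r -> 
  (forall l i, (i < K * 2 ^ l)%N ->
    `|b (i.+1%:R / (n * 2 ^ l)%:R) - b (i%:R / (n * 2 ^ l)%:R)| <= D * r ^+ l) ->
  forall L k j, (k < K)%N -> (k * 2 ^ L <= j <= k.+1 * 2 ^ L)%N ->
    `|b (j%:R / (n * 2 ^ L)%:R) - b (k%:R / n%:R)| <= D * \sum_(l < L.+1) r ^+ l.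
Proof.
move=> n0 D0 r0 hb; elim=> [|L IH] k j kK.
  rewrite !muln1 => jk; have [->|->] : j = k \/ j = k.+1 by lia.
    by rewrite subrr normr0 mulr_ge0// big_ord1.
  by have := hb 0%N k; rewrite !muln1 big_ord1; exact.
rewrite !expnS => jk.
have half i : (2 * i)%:R / (n * (2 * 2 ^ L))%:R = i%:R / (n * 2 ^ L)%:R :> R.
  rewrite !natrM; field.
  by rewrite !pnatr_eq0 -!lt0n expn_gt0 n0.
have le0 (N : nat) : \sum_(l < N.+1) r ^+ l <= \sum_(l < N.+2) r ^+ l.
  by rewrite [leRHS]big_ord_recr/= lerDl exprn_ge0.
have [jE|jO] : (j = 2 * j./2 \/ j = (2 * j./2).+1)%N by lia.
  rewrite jE half (le_trans (IH k _ kK _))//; last by rewrite ler_wpM2l.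
  by nia.
rewrite -(subrK (b ((2 * j./2)%:R / (n * (2 * 2 ^ L))%:R)) (b (j%:R / _))) -addrA.
rewrite (le_trans (ler_normD _ _))// big_ord_recr/= mulrDr [leRHS]addrC lerD//; last first.
  by rewrite half IH//; nia.
have := hb L.+1 (2 * j./2)%N; rewrite -jO expnS; apply.
by nia.
Qed.

(** The dyadic points of level L rounded down from the target converge to it; continuity passes the
    chaining bound to the limit, with the geometric sum bounded by 1 / (1 - r). *)
Lemma continuous_chaining (b : R -> R) (n K : nat) (D r : R) : continuous b ->
  (0 < n)%N -> 0 <= D -> 0 <= r < 1 ->
  (forall l i, (i < K * 2 ^ l)%N ->
    `|b (i.+1%:R / (n * 2 ^ l)%:R) - b (i%:R / (n * 2 ^ l)%:R)| <= D * r ^+ l) ->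
  forall k u, (k < K)%N -> 0 <= u <= n%:R^-1 ->
    `|b (k%:R / n%:R + u) - b (k%:R / n%:R)| <= D / (1 - r).
Proof.
move=> cb n0 D0 /andP[r0 r1] hb k u kK /andP[u0 un].
set x := _ + u.
have nR0 : 0 < n%:R :> R by rewrite ltr0n.
have x0 : 0 <= x by rewrite addr_ge0// divr_ge0.
have M0 L : 0 < (n * 2 ^ L)%:R :> R by rewrite ltr0n muln_gt0 n0 expn_gt0.
pose j L := Num.truncn (x * (n * 2 ^ L)%:R).
have jx L : (j L)%:R <= x * (n * 2 ^ L)%:R < (j L).+1%:R.
  by apply: truncn_itv; rewrite mulr_ge0.
have jk L : (k * 2 ^ L <= j L <= k.+1 * 2 ^ L)%N.
  have kx : k%:R <= x * n%:R by rewrite /x mulrDl divfK ?gt_eqF// lerDl mulr_ge0// ltW.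
  have xk : x * n%:R <= k.+1%:R.
    by rewrite /x mulrDl divfK ?gt_eqF// -natr1 lerD2l -ler_pdivlMr// div1r.
  have /andP[j1 j2] := jx L; apply/andP; split.
    rewrite -ltnS -(ltr_nat R); apply: le_lt_trans j2.
    by rewrite !natrM mulrA ler_wpM2r.
  rewrite -(ler_nat R); apply: (le_trans j1).
  by rewrite !natrM mulrA ler_wpM2r.
have sL : (j L)%:R / (n * 2 ^ L)%:R @[L --> \oo] --> x.
  have H1 : n%:R^-1 * 2^-1 ^+ L @[L --> \oo] --> (n%:R^-1 * 0 : R).
    apply: cvgMr; apply: cvg_expr.
    by rewrite ger0_norm ?invr_ge0// invf_lt1// ltr1n.
  have H0 : x - n%:R^-1 * 2^-1 ^+ L @[L --> \oo] --> x - n%:R^-1 * 0.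
    exact: cvgB (@cvg_cst _ x _ _ _) H1.
  rewrite mulr0 subr0 in H0.
  apply: (squeeze_cvgr _ H0 (@cvg_cst _ x _ _ _)).
  apply: nearW => L; have /andP[j1 j2] := jx L; apply/andP; split.
    rewrite exprVn -invfM -natrX -natrM lerBlDr -[X in _ + X]mul1r -mulrDl natr1.
    by rewrite ler_pdivlMr// ltW.
  by rewrite ler_pdivrMr.
have cbL : `|b ((j L)%:R / (n * 2 ^ L)%:R) - b (k%:R / n%:R)| @[L --> \oo] -->
    `|b x - b (k%:R / n%:R)|.
  apply: cvg_norm; apply: cvgB; last exact: cvg_cst.
  by apply: (cvg_comp _ _ sL); exact: cb.
apply: (ler_cvg_to cbL (@cvg_cst _ (D / (1 - r)) _ _ _)).
apply: nearW => L; apply: (le_trans (dyadic_chaining n0 D0 r0 hb kK (jk L))).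
rewrite ler_wpM2l//.
have geo N : (1 - r) * \sum_(l < N) r ^+ l = 1 - r ^+ N.
  elim: N => [|N IH]; first by rewrite big_ord0 mulr0 subrr.
  by rewrite big_ord_recr/= mulrDr IH exprS; ring.
rewrite -[leRHS]div1r ler_pdivlMr ?subr_gt0// mulrC geo.
by rewrite gerBl exprn_ge0.
Qed.

End chaining.

Lemma cvg_powRN_nat (R : realType) (a : R) : 0 < a ->
  n%:R `^ (- a) @[n --> \oo] --> (0 : R).
Proof.
move=> a0; apply/cvgr0Pnorm_le => e e0.
near=> n; rewrite ger0_norm ?powR_ge0// powRN.
have en : e^-1 `^ a^-1 <= n%:R by near: n; exact: nbhs_infty_ger.
have n0 : 0 < n%:R `^ a :> R by rewrite powR_gt0// (lt_le_trans _ en)// powR_gt0// invr_gt0.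
rewrite -[leRHS]invrK lef_pV2 ?posrE ?invr_gt0//.
have -> : e^-1 = (e^-1 `^ a^-1) `^ a.
  by rewrite -powRrM mulVf ?gt_eqF// powRr1// invr_ge0 ltW.
by apply: ge0_ler_powR => //; rewrite ?nnegrE ?powR_ge0// ltW.
Unshelve. all: by end_near. Qed.

Section fbm_oscillation.
Context d (T : measurableType d) (R : realType) (P : probability T R).
Context (H : R) (B : R -> {RV P >-> R}).
Hypothesis H01 : 0 < H < 1.
Hypothesis fbmB : fractional_brownian_motion H B.
Local Notation E f := (\int[P]_w f w)%R.

Lemma mean_increment_sqr t s :
  E (fun w => (B t w - B s w) ^+ 2) = `|t - s| `^ (2 * H).
Proof.
have hB := B_has_moments fbmB.
have H0 : 2 * H != 0 by rewrite mulf_neq0// gt_eqF//; case/andP: H01.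
transitivity (E (fun w => (B t w * B t w + B s w * B s w) - 2 * (B t w * B s w))).
  by apply: eq_Rintegral => w _; ring.
rewrite (meanB (has_momentsD (has_momentsM (hB t) (hB t)) (has_momentsM (hB s) (hB s)))
  (has_momentsZ 2 (has_momentsM (hB t) (hB s)))).
rewrite (meanD (has_momentsM (hB t) (hB t)) (has_momentsM (hB s) (hB s))).
rewrite (meanZ 2 (has_momentsM (hB t) (hB s))) !(mean_BB fbmB) /fbm_cov !subrr normr0 powR0//.
by field.
Qed.

(** The [n ^ p.+1] cells of mesh 1/n cover the time window [[0, n ^ p]]. *)
Definition small_oscillation (p : nat) (b : R -> R) :=
  forall eps : R, 0 < eps -> exists n0, forall n, (n0 <= n)%N ->
  forall k u, (k < n ^ p.+1)%N -> 0 <= u <= n%:R^-1 ->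
    `|b (k%:R / n%:R + u) - b (k%:R / n%:R)| <= eps.

(* The [2q]-th moment of the increments over a mesh [1/M] is of order
   [M^(-2Hq)], which beats any power of [M]; hence Kolmogorov's chaining applies
   simultaneously to all the cells of a window of polynomial size. *)
Lemma fbm_small_oscillation (p : nat) :
  {ae P, forall w, small_oscillation p (fun t => B t w)}.
Proof.
have /andP[H0 H1] := H01; have H20 : 0 < 2 * H by rewrite mulr_gt0.
(* The exponent p + 4 pays for the p + 1 of the number of cells, the factor [M] in [g], and the 2 of
   summability. *)
pose q := (Num.truncn (p.+4%:R / (2 * H))).+1.
have qH : p.+4%:R <= 2 * H * q%:R.
  rewrite mulrC -ler_pdivrMr//; apply: ltW; rewrite /q.
  by have /andP[] := truncn_itv (divr_ge0 (ler0n R p.+4) (ltW H20)).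
pose D (M i : nat) w := B (i.+1%:R / M%:R) w - B (i%:R / M%:R) w.
(* The factor [M] turns [g M w <= 1] into the bound M^(-1/(2q)) on each increment, which is
   geometric in l along M = n 2^l. *)
pose g (M : nat) w := M%:R * \sum_(i < M ^ p.+1) D M i w ^+ (2 * q).
have spanD M i : gauss_span B (D M i).
  by apply: gauss_spanB; exact: gauss_span_B.
have momD M i := has_momentsX (2 * q) (gauss_span_has_moments fbmB (spanD M i)).
have momS M : has_moments P (fun w => \sum_(i < M ^ p.+1) D M i w ^+ (2 * q)).
  by apply: (has_moments_sum (index_enum _)) => i; exact: momD.
have momg M : has_moments P (g M) by exact: has_momentsZ.
have Eg M : (0 < M)%N -> (\int[P]_w (g M w)%:E <= (odd_fact R q / M%:R ^+ 2)%:E)%E.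
  move=> M0; have MR : 0 < M%:R :> R by rewrite ltr0n.
  rewrite (mean_EFin (momg M)) lee_fin /g (meanZ _ (momS M)).
  rewrite (mean_sum (index_enum _) (fun i : 'I_(M ^ p.+1) => momD M i)).
  rewrite (eq_bigr (fun=> odd_fact R q * M%:R `^ (- (2 * H * q%:R)))); last first.
    move=> i _; rewrite (gauss_span_even fbmB q (spanD M i)) mean_increment_sqr.
    have -> : `|i.+1%:R / M%:R - i%:R / M%:R| = M%:R^-1 :> R.
      rewrite -mulrBl -natr1 addrAC subrr add0r mul1r ger0_norm// invr_ge0//.
    rewrite -powR_inv1 ?ler0n// -powRrM -powR_mulrn ?powR_ge0// -powRrM.
    by congr (_ * _ `^ _); ring.
  rewrite sumr_const card_ord -[_ *+ (M ^ p.+1)]mulr_natr natrX.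
  rewrite (_ : _ * _ = odd_fact R q * (M%:R ^+ p.+2 * M%:R `^ (- (2 * H * q%:R)))); last first.
    by set z := _ `^ _; rewrite !exprS; ring.
  rewrite ler_wpM2l ?odd_fact_ge0//.
  apply: (@le_trans _ _ (M%:R ^+ p.+2 * M%:R `^ (- p.+4%:R))).
    by rewrite ler_wpM2l ?exprn_ge0// ler_powR ?ler1n// lerN2.
  rewrite powRN powR_mulrn// ler_pdivrMr ?exprn_gt0//.
  by rewrite mulrC ler_pdivlMr ?exprn_gt0// -exprD; rewrite addn2.
have g0 M w : 0 <= g M w.
  by rewrite mulr_ge0// sumr_ge0// => i _; rewrite exprM exprn_ge0// sqr_ge0.
have := @summable_expectation_cvg0 _ _ _ P g (odd_fact R q) 1 (fun M => (momg M).1) g0 Eg.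
have [_ _ _ cB] := fbmB.
apply: filterS2 cB => w cB gw eps eps0.
pose al : R := (2 * q%:R)^-1.
have al0 : 0 < al by rewrite invr_gt0 mulr_gt0// ltr0n.
pose r : R := 2 `^ (- al).
have r0 : 0 < r by rewrite powR_gt0.
have r1 : r < 1.
  have : 1 `^ al < 2 `^ al :> R by apply: gt0_ltr_powR; rewrite ?nnegrE// ltr1n.
  by rewrite powR1 /r powRN invf_lt1 ?powR_gt0.
have [M1 HM1] : exists M1, forall M, (M1 <= M)%N -> g M w <= 1.
  by have [M1 _ HM] := cvgr_le _ gw _ (@ltr01 R); exists M1.
have [N _ HN] : \forall n \near \oo, n%:R `^ (- al) <= eps * (1 - r).
  by apply: (cvgr_le _ (cvg_powRN_nat al0)); rewrite mulr_gt0// subr_gt0.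
exists (maxn M1 N).+1 => n nn k u kn un.
have n0 : (0 < n)%N by lia.
(* The l-th dyadic refinement of the window lies in the window of the mesh M = n 2^l, so the
   convergence of [g] along all meshes controls all levels at once. *)
have Hd l i : (i < n ^ p.+1 * 2 ^ l)%N ->
    `|B (i.+1%:R / (n * 2 ^ l)%:R) w - B (i%:R / (n * 2 ^ l)%:R) w| <= n%:R `^ (- al) * r ^+ l.
  move=> il; set M := (n * 2 ^ l)%N.
  have M0 : (0 < M)%N by rewrite muln_gt0 n0 expn_gt0.
  have MR : 0 < M%:R :> R by rewrite ltr0n.
  have iM : (i < M ^ p.+1)%N.
    apply: (leq_trans il); rewrite expnMn leq_mul2l; apply/orP; right.
    by rewrite -expnM leq_exp2l// leq_pmulr.
  have gM : g M w <= 1 by apply: HM1; rewrite (leq_trans _ (leq_pmulr n (expn_gt0 2 l)))//; lia.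
  have DM : D M i w ^+ (2 * q) <= M%:R^-1.
    rewrite -[leRHS]mul1r ler_pdivlMr// mulrC; apply: le_trans gM.
    rewrite /g ler_wpM2l// (bigD1 (Ordinal iM))//= lerDl sumr_ge0// => j _.
    by rewrite exprM exprn_ge0// sqr_ge0.
  have -> : n%:R `^ (- al) * r ^+ l = M%:R `^ (- al).
    rewrite /r -powR_mulrn ?powR_ge0// powRAC powR_mulrn// -powRM// ?exprn_ge0//.
    by rewrite -natrX -natrM.
  rewrite -/(D M i w) -(@ler_pXn2r _ (2 * q)) ?nnegrE ?powR_ge0//.
  rewrite -normrX ger0_norm; last by rewrite exprM exprn_ge0// sqr_ge0.
  apply: (le_trans DM); rewrite -powR_mulrn ?powR_ge0// -powRrM natrM.
  by rewrite mulNr mulVf ?powR_inv1// mulf_neq0// pnatr_eq0.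
have := @continuous_chaining R (fun t => B t w) n (n ^ p.+1) (n%:R `^ (- al)) r cB n0 (powR_ge0 _ _).
rewrite (ltW r0) r1 => /(_ isT Hd k u kn un) Hx.
apply: (le_trans Hx); rewrite ler_pdivrMr ?subr_gt0//.
by apply: HN => /=; lia.
Qed.

End fbm_oscillation.

(** * Paths of the Ornstein-Uhlenbeck equation *)

Section ornstein_uhlenbeck_path.
Context (R : realType).
Local Notation mu := (@lebesgue_measure R).

Lemma derive_le0_nonincreasing (f df : R -> R) (s t : R) : s <= t ->
  (forall v, s < v < t -> is_derive v 1 f (df v)) ->
  (forall v, s < v < t -> df v <= 0) ->
  {within `[s, t], continuous f} -> f t <= f s.
Proof.
rewrite le_eqVlt => /predU1P[->//|st] dF df0 cf.
have H v : v \in `]s, t[ -> is_derive v 1 f (df v) by rewrite in_itv; exact: dF.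
have [c cst Ec] := MVT st H cf; rewrite -subr_le0 Ec.
by rewrite mulr_le0_ge0 ?df0 ?subr_ge0 ?ltW//; move: cst; rewrite in_itv.
Qed.

Context (theta x0 : R) (b x : R -> R).
Hypothesis cb : continuous b.
Hypothesis xE : forall t : R, 0 <= t -> mu.-integrable `[0, t] (EFin \o x) /\
  x t = x0 + theta * (\int[mu]_(s in `[0, t]) x s) + b t.

Let F t := \int[mu]_(s in `[0, t]) x s.

Let cF (t : R) : 0 <= t -> {within `[0, t], continuous F}.
Proof. by move=> t0; apply: parameterized_integral_continuous => //; have [] := xE t0. Qed.

Let F0 : F 0 = 0.
Proof. by rewrite /F set_itv1 Rintegral_set1. Qed.

Lemma ou_path0 : x 0 = x0 + b 0.
Proof. by have [_ ->] := xE (lexx 0); rewrite -/(F 0) F0 mulr0 addr0. Qed.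

(** Bootstrap: integrability gives continuity of the integral, the equation then gives continuity of
    the path, and only after this is the integral differentiable. *)
Let cx (t : R) : 0 <= t -> {within `[0, t], continuous x}.
Proof.
move=> t0; have : {within `[0, t], continuous (fun u => x0 + theta * F u + b u)}.
  move=> u; apply: cvgD; last by apply: continuous_subspaceT; exact: cb.
  by apply: cvgD; [exact: cvg_cst|apply: cvgM; [exact: cvg_cst|exact: cF]].
apply: subspace_eq_continuous => u; rewrite inE/= in_itv/= => /andP[u0 _].
by rewrite /from_subspace; have [_ e] := xE u0; rewrite e.
Qed.

Let within_interior (f : R -> R) (t : R) : 0 < t -> {within `[0, t + 1], continuous f} ->
  {for t, continuous f}.
Proof.
move=> t0 /continuous_within_itvP[]; first by rewrite ltr_wpDl// ltW.
by move=> H _ _; apply: H; rewrite in_itv/= t0 ltrDl ltr01.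
Qed.

Let integral_derive (f : R -> R) (t : R) : 0 < t -> {within `[0, t + 1], continuous f} ->
  is_derive t 1 (fun u => \int[mu]_(s in `[0, u]) f s) (f t).
Proof.
move=> t0 cf.
have [] := @continuous_FTC1_closed R f 0 t (t + 1).
- by rewrite ltrDl.
- by apply: continuous_compact_integrable => //; exact: segment_compact.
- by [].
- exact: within_interior.
by move=> df <-; rewrite derive1E; apply: DeriveDef.
Qed.

Let dF (t : R) : 0 < t -> is_derive t 1 F (x t).
Proof. by move=> t0; apply: integral_derive => //; apply: cx; rewrite addr_ge0// ltW. Qed.

Lemma within_subitv (f : R -> R) (a c s t : R) : a <= s -> t <= c ->
  {within `[a, c], continuous f} -> {within `[s, t], continuous f}.
Proof.
move=> as_ tc; apply: continuous_subspaceW => v /=; rewrite !in_itv/= => /andP[sv vt].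
by rewrite (le_trans as_ sv) (le_trans vt tc).
Qed.

(** [J t] is the integral of X^2 over [[0, t]]. The two mean value bounds are all that its
    comparison with the discrete sums requires. *)
Lemma ou_primitive_sqr : exists J : R -> R, J 0 = 0 /\
  forall s t M : R, 0 <= s -> s <= t ->
    ((forall u, s <= u <= t -> x u ^+ 2 <= M) -> J t - J s <= M * (t - s)) /\
    ((forall u, s <= u <= t -> M <= x u ^+ 2) -> M * (t - s) <= J t - J s).
Proof.
pose J t := \int[mu]_(s in `[0, t]) (x s * x s).
have cx2 (t : R) : 0 <= t -> {within `[0, t], continuous (fun u => x u * x u)}.
  by move=> t0 u; apply: cvgM; exact: cx.
have dJ (t : R) : 0 < t -> is_derive t 1 J (x t ^+ 2).
  by move=> t0; apply: integral_derive => //; apply: cx2; rewrite addr_ge0// ltW.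
have cJ (t : R) : 0 <= t -> {within `[0, t], continuous J}.
  move=> t0; apply: parameterized_integral_continuous => //.
  apply: continuous_compact_integrable; first exact: segment_compact.
  exact: cx2.
exists J; split; first by rewrite /J set_itv1 Rintegral_set1.
move=> s t M s0 st; have t0 := le_trans s0 st.
have cJM (c e : R) : {within `[s, t], continuous (fun u => c * J u + e * u)}.
  move=> u; apply: cvgD; apply: cvgM; try exact: cvg_cst.
    by apply: (within_subitv s0 (lexx t)); exact: cJ.
  by apply: continuous_subspaceT => y; exact: cvg_id.
have dJM (c e v : R) : s < v < t ->
    is_derive v 1 (fun u => c * J u + e * u) (c * x v ^+ 2 + e).
  move=> /andP[sv _]; have v0 := le_lt_trans s0 sv.
  have D := is_deriveD (is_deriveZ c (dJ v v0)) (is_deriveZ e (is_derive_id v (1 : R))).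
  by apply: (is_derive_eq D); rewrite /GRing.scale/= mulr1.
split=> HM.
- have := derive_le0_nonincreasing st (dJM 1 (- M)) _ (cJM 1 (- M)).
  rewrite !mul1r => H; suff : J t + - M * t <= J s + - M * s by lra.
  apply: H => v /andP[sv vt]; rewrite mul1r subr_le0; apply: HM.
  by rewrite (ltW sv) ltW.
- have := derive_le0_nonincreasing st (dJM (-1) M) _ (cJM (-1) M).
  move=> H; suff : -1 * J t + M * t <= -1 * J s + M * s by lra.
  apply: H => v /andP[sv vt]; rewrite mulN1r addrC subr_le0; apply: HM.
  by rewrite (ltW sv) ltW.
Qed.

Hypothesis theta0 : theta != 0.

(* [G u = x_(t+u) - x_t - (b_(t+u) - b_t)] solves [G' = theta (G + x_t + b_(t+u) - b_t)];
   the bounds are those of Gronwall's lemma. *)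
Lemma ou_step (t h eps : R) : 0 <= t -> 0 <= h ->
  (forall u : R, 0 <= u <= h -> `|b (t + u) - b t| <= eps) ->
  `|x (t + h) - expR (theta * h) * x t - (b (t + h) - b t)|
    <= eps * `|expR (theta * h) - 1|.
Proof.
move=> t0 h0 osc.
have th0 : 0 <= t + h by rewrite addr_ge0.
have [_ xt] := xE t0; have [_ xth] := xE th0.
rewrite -/(F t) in xt; rewrite -/(F (t + h)) in xth.
(* Integrating factor. The sign [e] is 1 or -1 and [c] will satisfy [theta * c = x t + e * eps], so
   that the derivative has the sign of e (b_v - b_t) - eps, hence is nonpositive. *)
pose Phi c e v := e * (expR (- theta * (v - t)) * (F v - F t + c)).
have cE : continuous (fun v => expR (- theta * (v - t))).
  move=> v; apply: (@continuous_comp _ _ _ (fun v => - theta * (v - t)) expR).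
    by apply: cvgM; [exact: cvg_cst|apply: cvgB; [exact: cvg_id|exact: cvg_cst]].
  exact: continuous_expR.
have cPhi c e : {within `[t, t + h], continuous (Phi c e)}.
  move=> u; apply: cvgM; first exact: cvg_cst.
  apply: cvgM; first exact: continuous_subspaceT.
  apply: cvgD; last exact: cvg_cst.
  apply: cvgB; last exact: cvg_cst.
  by apply: (within_subitv t0 (lexx (t + h))); exact: cF.
have dE (v : R) : is_derive v 1 (fun v => expR (- theta * (v - t))) (- theta * expR (- theta * (v - t))).
  have D0 := is_deriveZ (- theta) (is_deriveB (is_derive_id v (1 : R)) (is_derive_cst t v (1 : R))).
  have D1 := @is_derive1_comp R expR (fun v => - theta * (v - t)) v _ _ (is_derive_expR _) D0.
  by apply: (is_derive_eq D1); rewrite /GRing.scale/= subr0 mulr1 mulrC.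
have dPhi c e v : t < v < t + h -> is_derive v 1 (Phi c e)
    (e * expR (- theta * (v - t)) * (x t + (b v - b t) - theta * c)).
  move=> /andP[tv _]; have v0 := le_lt_trans t0 tv.
  have D2 := is_deriveD (is_deriveB (dF v0) (is_derive_cst (F t) v (1 : R))) (is_derive_cst c v (1 : R)).
  have D3 := is_deriveZ e (is_deriveM (dE v) D2).
  apply: (is_derive_eq D3); rewrite /GRing.scale/=.
  have [_ ->] := xE (ltW v0); rewrite -/(F v) xt.
  rewrite !fctE; ring.
have Phit c e : Phi c e t = e * c.
  by rewrite /Phi !subrr mulr0 expR0 mul1r add0r.
have bound c e : (forall v, t < v < t + h -> e * (x t + (b v - b t) - theta * c) <= 0) ->
    Phi c e (t + h) <= e * c.
  move=> He; rewrite -Phit.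
  apply: (derive_le0_nonincreasing _ (dPhi c e)) => //; first by rewrite lerDl.
  move=> v tv; rewrite mulrAC mulr_le0_ge0 ?expR_ge0//; exact: He.
have oscv v : t < v < t + h -> `|b v - b t| <= eps.
  move=> /andP[tv vt]; have := osc (v - t); rewrite addrCA subrr addr0; apply.
  by rewrite subr_ge0 ltW//= lerBlDl ltW.
have pE : 0 < expR (theta * h) by exact: expR_gt0.
have EE : expR (- theta * (t + h - t)) = (expR (theta * h))^-1.
  by rewrite addrAC subrr add0r mulNr expRN.
have key (e s : R) : (e = 1 \/ e = -1) -> 
    e * (F (t + h) - F t) <= (expR (theta * h) - 1) * (e * ((x t + e * eps) / theta)).
  move=> e1; set c := (_ + _) / _; have Hb := bound c e.
  have thc : theta * c = x t + e * eps by rewrite /c; field.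
  rewrite thc /Phi EE in Hb.
  have : e * ((expR (theta * h))^-1 * (F (t + h) - F t + c)) <= e * c.
    apply: Hb => v /oscv.
    rewrite ler_norml => /andP[u1 u2].
    by case: e1 => ->; lra.
  rewrite mulrCA ler_pdivrMl// => Hc.
  by rewrite -(lerD2r (e * c)) -mulrDr (le_trans Hc)//; lra.
have k1 := key 1 0 (or_introl erefl); have k2 := key (-1) 0 (or_intror erefl).
have -> : x (t + h) - expR (theta * h) * x t - (b (t + h) - b t) =
   theta * (F (t + h) - F t) - (expR (theta * h) - 1) * x t.
  by rewrite xth xt; ring.
move: k1 k2; set g := F (t + h) - F t; set a := expR _ - 1; set X := x t.
rewrite !mul1r !mulN1r => k1 k2.
have {}k1 : g <= a * ((X + eps) / theta) by [].
have {}k2 : a * ((X - eps) / theta) <= g.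
  by move: k2; rewrite mulrN lerN2.
have ok c : theta * (a * (c / theta)) = a * c by field.
have [thp|thn|/eqP] := ltgtP theta 0; last by rewrite (negbTE theta0).
- have a0 : a <= 0 by rewrite /a subr_le0 -expR0 ler_expR mulr_le0_ge0// ltW.
  rewrite (ler0_norm a0) ler_norml.
  have := ler_wnM2l (ltW thp) k1; have := ler_wnM2l (ltW thp) k2.
  by rewrite !ok; move=> h1 h2; apply/andP; split; lra.
- have a0 : 0 <= a by rewrite /a subr_ge0 -expR0 ler_expR mulr_ge0// ltW.
  rewrite (ger0_norm a0) ler_norml.
  have := ler_wpM2l (ltW thn) k1; have := ler_wpM2l (ltW thn) k2.
  by rewrite !ok; move=> h1 h2; apply/andP; split; lra.
Qed.

End ornstein_uhlenbeck_path.

(** * Riemann sums for the Gamma function *)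

Lemma powR_continuous (R : realType) (a u : R) : 0 < u ->
  {for u, continuous (fun x : R => x `^ a)}.
Proof.
move=> u0; have Du : derivable (fun x : R => x `^ a) u 1.
  by apply: derivable_powR; rewrite in_itv/= u0.
by move/derivable1_diffP/differentiable_continuous : Du.
Qed.

Section gamma_sum.
Context (R : realType) (al : R).
Hypothesis al0 : 0 < al.
Local Notation mu := (@lebesgue_measure R).

Lemma exp_dominates_pow (k : nat) : exists2 C : R, 0 < C &
  forall y : R, 0 <= y -> y ^+ k * expR (- y) <= C.
Proof.
exists k`!%:R; first by rewrite ltr0n fact_gt0.
move=> y y0; rewrite expRN ler_pdivrMr ?expR_gt0//.
case: k => [|k]; first by rewrite expr0 fact0 mul1r -expR0 ler_expR.
have H := @expR_ge1Dxn _ _ k y0.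
rewrite -ler_pdivrMl ?ltr0n ?fact_gt0// mulrC.
by apply: le_trans H; rewrite lerDr.
Qed.

Let g (u : R) := u `^ (al - 1) * expR (- u).

Let g_ge0 (u : R) : 0 <= g u. Proof. by rewrite mulr_ge0 ?powR_ge0 ?expR_ge0. Qed.

Let cg (u : R) : 0 < u -> {for u, continuous g}.
Proof.
move=> u0; apply: cvgM.
  exact: powR_continuous.
by apply: (@continuous_comp _ _ _ -%R expR); [exact: opp_continuous|exact: continuous_expR].
Qed.

Let cgW (s t : R) : 0 < s -> {within `[s, t], continuous g}.
Proof.
move=> s0; apply: continuous_in_subspaceT => u; rewrite inE/= in_itv/= => /andP[su _].
by apply: cg; rewrite (lt_le_trans s0).
Qed.

Let ig (s t : R) : 0 < s -> mu.-integrable `[s, t] (EFin \o g).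
Proof.
by move=> s0; apply: continuous_compact_integrable; [exact: segment_compact|exact: cgW].
Qed.

Let G s v := \int[mu]_(u in `[s, v]) g u.

Let cG (s t : R) : 0 < s -> s <= t -> {within `[s, t], continuous (G s)}.
Proof. by move=> s0 st; apply: parameterized_integral_continuous => //; exact: ig. Qed.

Let dG (s v : R) : 0 < s -> s < v -> is_derive v 1 (G s) (g v).
Proof.
move=> s0 sv; have [] := @continuous_FTC1_closed R g s v (v + 1).
- by rewrite ltrDl.
- exact: ig.
- exact: sv.
- by apply: cg; rewrite (lt_trans s0).
by move=> df <-; rewrite derive1E; apply: DeriveDef.
Qed.

Let cpow (s t : R) : 0 < s -> {within `[s, t], continuous (fun x : R => x `^ al)}.
Proof.
move=> s0; apply: continuous_in_subspaceT => u; rewrite inE/= in_itv/= => /andP[su _].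
by apply: powR_continuous; rewrite (lt_le_trans s0).
Qed.

(** [al * g] is exp(-u) times the derivative of u^al, and exp(-u) lies between its values at the
    endpoints. Measuring cells by u^al removes the singularity of [g] at 0 when [al < 1]. *)
Let G_incr (s r t : R) : 0 < s -> s <= r -> r <= t ->
  expR (- t) * (t `^ al - r `^ al) <= al * (G s t - G s r) <=
  expR (- r) * (t `^ al - r `^ al).
Proof.
move=> s0 sr rt; have st := le_trans sr rt; have r0 := lt_le_trans s0 sr.
have cF (c e : R) : {within `[r, t], continuous (fun v => c * G s v + e * v `^ al)}.
  move=> u; apply: cvgD; apply: cvgM; try exact: cvg_cst.
    by apply: (within_subitv sr (lexx t)); exact: cG.
  exact: cpow.
have dF (c e v : R) : r < v < t -> is_derive v 1 (fun v => c * G s v + e * v `^ al)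
    (c * g v + e * (al * v `^ (al - 1))).
  move=> /andP[rv _]; have v0 := lt_trans r0 rv.
  exact: (is_deriveD (is_deriveZ c (dG s0 (le_lt_trans sr rv))) (is_deriveZ e (is_derive1_powR al v0))).
have pos (v : R) : 0 <= al * v `^ (al - 1) by rewrite mulr_ge0 ?powR_ge0// ltW.
have e1 c v : al * g v + c * (al * v `^ (al - 1)) = al * v `^ (al - 1) * (expR (- v) + c).
  by rewrite /g; ring.
have e2 c v : - al * g v + c * (al * v `^ (al - 1)) = al * v `^ (al - 1) * (c - expR (- v)).
  by rewrite /g; ring.
apply/andP; split.
- have H := derive_le0_nonincreasing rt (dF (- al) (expR (- t))) _ (cF (- al) (expR (- t))).
  suff : - al * G s t + expR (- t) * t `^ al <= - al * G s r + expR (- t) * r `^ al by lra.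
  apply: H => v /andP[rv vt]; rewrite e2 mulr_ge0_le0//.
  by rewrite subr_le0 ler_expR lerN2 ltW.
- have H := derive_le0_nonincreasing rt (dF al (- expR (- r))) _ (cF al (- expR (- r))).
  suff : al * G s t + - expR (- r) * t `^ al <= al * G s r + - expR (- r) * r `^ al by lra.
  apply: H => v /andP[rv vt]; rewrite e1 mulr_ge0_le0//.
  by rewrite subr_le0 ler_expR lerN2 ltW.
Qed.

Let Gs (s : R) : G s s = 0. Proof. by rewrite /G set_itv1 Rintegral_set1. Qed.

Let GE (s t : R) : 0 < s -> (\int[mu]_(u in `[s, t]) (g u)%:E = (G s t)%:E)%E.
Proof. by move=> s0; rewrite /G /Rintegral fineK//; apply: integrable_fin_num => //; exact: ig. Qed.

(** Below 1 the integral is at most that of u^(al - 1), namely 1 / al; above 1 half of the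
    exponential absorbs the power, and exp(-v/2) is integrated explicitly. *)
Let G_bounded : exists K : R, forall s t : R, 0 < s -> s <= 1 -> 1 <= t -> G s t <= K.
Proof.
pose k := (Num.truncn `|al|).+1.
have [C C0 HC] := exp_dominates_pow k.
pose C' := 2 ^+ k * C.
exists (al^-1 + 2 * C') => s t s0 s1 t1.
have st := le_trans s1 t1.
have H1 : G s 1 <= al^-1.
  have /andP[_] := G_incr s0 (lexx s) s1; rewrite Gs subr0 powR1 => H1.
  rewrite -div1r ler_pdivlMr// mulrC (le_trans H1)//.
  have : expR (- s) <= 1 by rewrite -expR0 ler_expR oppr_le0 ltW.
  have := expR_ge0 (- s); have := powR_ge0 s al; nra.
have gb (v : R) : 1 <= v -> g v <= C' * expR (- (v / 2)).
  move=> v1; have v0 := le_trans ler01 v1.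
  apply: (@le_trans _ _ (v ^+ k * expR (- v))).
    rewrite ler_wpM2r ?expR_ge0// -powR_mulrn// ler_powR//.
    have /andP[_] := truncn_itv (normr_ge0 al).
    by rewrite -/k => /ltW; have := ler_norm al; lra.
  have := HC (v / 2) (divr_ge0 v0 (ler0n _ 2)).
  have -> : expR (- v) = expR (- (v / 2)) * expR (- (v / 2)).
    by rewrite -expRD; congr expR; field.
  have -> : v ^+ k = 2 ^+ k * (v / 2) ^+ k by rewrite -exprMn; congr (_ ^+ _); field.
  move=> HCv; rewrite mulrA ler_wpM2r ?expR_ge0// /C' -mulrA.
  by rewrite ler_wpM2l// exprn_ge0.
suff H2 : G s t - G s 1 <= 2 * C' by lra.
have dF (v : R) : 1 < v < t -> is_derive v 1 (fun v => G s v + 2 * C' * expR (- 2^-1 * v))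
    (g v + 2 * C' * (expR (- 2^-1 * v) * (- 2^-1))).
  move=> /andP[v1 _].
  have D0 := is_deriveZ (- 2^-1) (is_derive_id v (1 : R)).
  have D1 := @is_derive1_comp R expR (fun v => - 2^-1 * v) v _ _ (is_derive_expR _) D0.
  have D := is_deriveD (dG s0 (le_lt_trans s1 v1)) (is_deriveZ (2 * C') D1).
  by apply: (is_derive_eq D); rewrite /GRing.scale/= mulr1.
have ce : continuous (fun v : R => expR (- 2^-1 * v)).
  move=> v; apply: (@continuous_comp _ _ _ (fun v : R => - 2^-1 * v) expR).
    by apply: cvgM; [exact: cvg_cst|exact: cvg_id].
  exact: continuous_expR.
have cF : {within `[1, t], continuous (fun v => G s v + 2 * C' * expR (- 2^-1 * v))}.
  move=> u; apply: cvgD; first by apply: (within_subitv s1 (lexx t)); exact: cG.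
  apply: cvgM; first exact: cvg_cst.
  exact: continuous_subspaceT.
have H := derive_le0_nonincreasing t1 dF _ cF.
have : G s t + 2 * C' * expR (- 2^-1 * t) <= G s 1 + 2 * C' * expR (- 2^-1 * 1).
  apply: H => v /andP[/ltW v1 _]; have := gb v v1.
  by rewrite (_ : - (v / 2) = - 2^-1 * v); [lra|field].
have C'0 : 0 <= C' by rewrite /C' mulr_ge0 ?exprn_ge0// ltW.
have h1 : 2 * C' * expR (- 2^-1 * 1) <= 2 * C'.
  apply: ler_piMr; first by rewrite mulr_ge0.
  by rewrite -[leRHS]expR0 ler_expR; lra.
have h2 : 0 <= 2 * C' * expR (- 2^-1 * t) by apply: mulr_ge0; [exact: mulr_ge0|exact: expR_ge0].
lra.
Qed.

(** Monotone convergence along compact intervals exhausting the half-line. [G_bounded] makes the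
    extended integral finite, so that [Gamma] is its true value and not the default 0 of [fine] at
    infinity. *)
Let Gamma_lim : G n.+1%:R^-1 n.+1%:R @[n --> \oo] --> Gamma al /\
  forall s t : R, 0 < s -> G s t <= Gamma al.
Proof.
have mg : measurable_fun (`](0:R), +oo[%classic : set R) g.
  apply: open_continuous_measurable_fun => // u.
  by rewrite inE/= in_itv/= andbT => u0; exact: cg.
have U : \bigcup_n `[(n.+1%:R^-1 : R), n.+1%:R]%classic = `](0:R), +oo[%classic.
  apply/seteqP; split => [u [n _]/=|u/=]; rewrite !in_itv/= ?andbT.
    by move=> /andP[nu _]; rewrite (lt_le_trans _ nu)// invr_gt0.
  move=> u0; pose N := (Num.truncn (Num.max u u^-1)).
  have uN : Num.max u u^-1 <= N.+1%:R.
    have h0 : 0 <= Num.max u u^-1 by rewrite le_max ltW.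
    by have /andP[_ /ltW] := truncn_itv h0.
  exists N => //=; rewrite in_itv/=; move: uN; rewrite ge_max => /andP[uN uN'].
  by rewrite uN andbT -[leRHS]invrK lef_pV2 ?posrE ?invr_gt0.
have C : (G n.+1%:R^-1 n.+1%:R)%:E%E @[n --> \oo] --> (\int[mu]_(u in `]0%R, +oo[) (g u)%:E)%E.
  pose I n : set (measurableTypeR R) := `[(n.+1%:R^-1 : R), n.+1%:R]%classic.
  rewrite -U; apply: cvg_trans; last first.
    apply: (@ge0_nondecreasing_set_cvg_integral _ (measurableTypeR R) R I (EFin \o g) mu).
  - apply/nondecreasing_seqP => n; rewrite subsetEset => u /=.
    rewrite /I /= !in_itv/= => /andP[nu un]; apply/andP; split.
      by rewrite (le_trans _ nu)// lef_pV2 ?posrE// ler_nat.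
    by rewrite (le_trans un)// ler_nat.
  - by move=> n; exact: measurable_itv.
  - move=> n; have n0 : 0 < n.+1%:R^-1 :> R by rewrite invr_gt0.
    exact: (measurable_int mu (ig n.+1%:R n0)).
  - by move=> n u _; rewrite lee_fin.
  by apply: near_eq_cvg; apply: nearW => n; rewrite -GE ?invr_gt0.
have [K HK] := G_bounded.
have fin : (\int[mu]_(u in `]0%R, +oo[) (g u)%:E)%E \is a fin_num.
  rewrite ge0_fin_numE; last by apply: integral_ge0 => u _; rewrite lee_fin.
  apply: (@le_lt_trans _ _ K%:E); last exact: ltry.
  rewrite -(cvg_lim _ C)//; apply: lime_le; first by apply/cvg_ex; eexists; exact: C.
  by apply: nearW => n; rewrite lee_fin HK// ?invr_gt0// ?invf_le1// ler1n.
have E : (\int[mu]_(u in `]0%R, +oo[) (g u)%:E)%E = (Gamma al)%:E.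
  by rewrite /Gamma /Rintegral fineK.
split; first by rewrite E in C; exact: (fine_cvg C).
move=> s t s0; rewrite -lee_fin -GE// -E; apply: ge0_subset_integral => //=.
- by apply/measurable_EFinP.
- by move=> u _; rewrite lee_fin.
- by move=> u /=; rewrite !in_itv/= andbT => /andP[su _]; rewrite (lt_le_trans s0).
Qed.

Let G_subset (s t s' t' : R) : 0 < s -> s <= s' -> t' <= t -> G s' t' <= G s t.
Proof.
move=> s0 ss tt; have s'0 := lt_le_trans s0 ss.
rewrite -lee_fin -!GE//; apply: ge0_subset_integral => //=.
- exact: (measurable_int mu (ig t s0)).
- by move=> u _; rewrite lee_fin.
- move=> u /=; rewrite !in_itv/= => /andP[su ut].
  by rewrite (le_trans ss su) (le_trans ut tt).
Qed.

Lemma Gamma_gt0 : 0 < Gamma al.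
Proof.
have [_ /(_ 1 2 ltr01)] := Gamma_lim; apply: lt_le_trans.
have /andP[+ _] := G_incr ltr01 (lexx 1) (ler1n R 2).
rewrite Gs subr0 powR1 -(pmulr_rgt0 _ al0); apply: lt_le_trans.
rewrite mulr_gt0 ?expR_gt0// subr_gt0 -[ltLHS](powRr0 2).
have : 1 `^ al < 2 `^ al :> R by apply: gt0_ltr_powR; rewrite ?nnegrE// ltr1n.
by rewrite powR1 powRr0.
Qed.

(** Riemann-Stieltjes sum, with right endpoints and mesh [h], of exp(-u) against u^al; the full
    integral is [al * Gamma al]. *)
Definition gamma_sum (h : R) N : R :=
  \sum_(j < N) expR (- (h * j.+1%:R)) * ((h * j.+1%:R) `^ al - (h * j%:R) `^ al).

(** The first cell contributes at most h^al. On the others the factor exp(-h) exchanges left for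
    right endpoint values, so that [G_incr] applies on both sides. *)
Let gamma_sum_bounds (h : R) N : 0 < h ->
  expR (- h) * (al * G h (h * N.+1%:R)) <= gamma_sum h N.+1 <=
  h `^ al + al * G h (h * N.+1%:R).
Proof.
move=> h0; elim: N => [|N /andP[IH1 IH2]].
  rewrite /gamma_sum big_ord1/= mulr1 mulr0 Gs !mulr0 powR0 ?gt_eqF// subr0 addr0.
  rewrite mulr_ge0 ?expR_ge0 ?powR_ge0//= ler_piMl ?powR_ge0//.
  by rewrite -[leRHS]expR0 ler_expR oppr_le0 ltW.
have hN : h <= h * N.+1%:R by rewrite ler_pMr// ler1n.
have NN : h * N.+1%:R <= h * N.+2%:R by rewrite ler_pM2l// ler_nat.
have /andP[B1 B2] := G_incr h0 hN NN.
rewrite /gamma_sum big_ord_recr/= -/(gamma_sum h N.+1).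
apply/andP; split; last by move: IH2 B1; lra.
have E : expR (- (h * N.+2%:R)) = expR (- h) * expR (- (h * N.+1%:R)).
  by rewrite -expRD; congr expR; rewrite -(natr1 N.+1); ring.
have := ler_wpM2l (expR_ge0 (- h)) B2.
by rewrite E; move: IH1; lra.
Qed.

Lemma cvg_gamma_sum (eps : R) : 0 < eps -> exists d A : R, 0 < d /\
  forall h N, 0 < h -> h <= d -> A <= h * N.+1%:R ->
    `|gamma_sum h N.+1 - al * Gamma al| <= eps.
Proof.
move=> e0; have [GL GU] := Gamma_lim; have Gp := Gamma_gt0.
have e1 : 0 < eps / (2 * al) by rewrite divr_gt0// mulr_gt0.
have [n _ /(_ n (leqnn n)) Hn] : \forall n \near \oo,
    Gamma al - eps / (2 * al) <= G n.+1%:R^-1 n.+1%:R.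
  by apply: (cvgr_ge _ GL); rewrite gtrBl.
(* In order: the integral from h captures all but a small part of [Gamma al]; the first cell is at
   most eps; the loss from the factor exp(-h) is at most eps / 2. *)
pose d := Num.min (n.+1%:R^-1) (Num.min (eps `^ al^-1) (eps / (2 * al * Gamma al))).
have d0 : 0 < d.
  rewrite !lt_min invr_gt0 ltr0n powR_gt0//=.
  by rewrite divr_gt0// !mulr_gt0.
exists d, n.+1%:R; split=> // h N h0; rewrite !le_min => /and3P[h1 h2 h3] hN.
have /andP[B1 B2] := gamma_sum_bounds N h0.
set S := gamma_sum _ _ in B1 B2 *; set g0 := G h _ in B1 B2.
have gU : g0 <= Gamma al by exact: GU.
have gL : Gamma al - eps / (2 * al) <= g0 by apply: (le_trans Hn); exact: G_subset.
have hal : h `^ al <= eps.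
  have -> : eps = (eps `^ al^-1) `^ al by rewrite -powRrM mulVf ?gt_eqF// powRr1// ltW.
  by apply: ge0_ler_powR; rewrite ?nnegrE ?powR_ge0//; exact: ltW.
have g00 : 0 <= g0 by apply: Rintegral_ge0 => u _; exact: g_ge0.
have eh : 1 - h <= expR (- h) by rewrite -(opprK h) opprK expR_ge1Dx.
have a1 : al * g0 <= al * Gamma al by rewrite ler_pM2l.
have a2 : al * Gamma al - eps / 2 <= al * g0.
  have := ler_wpM2l (ltW al0) gL.
  rewrite (_ : al * (Gamma al - _) = al * Gamma al - eps / 2)//.
  by field; rewrite gt_eqF.
have a3 : h * (al * g0) <= eps / 2.
  apply: (@le_trans _ _ (h * (al * Gamma al))); first by rewrite ler_pM2l.
  by move: h3; rewrite ler_pdivlMr ?mulr_gt0//; lra.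
have a4 : (1 - h) * (al * g0) <= expR (- h) * (al * g0).
  by rewrite ler_wpM2r// mulr_ge0// ltW.
rewrite ler_norml; apply/andP; split; lra.
Qed.

End gamma_sum.

(** * Limit of the variance input of the autoregression *)

Section noise_sum.
Context (R : realType).

(** Two summations by parts trade the second differences of [g] for its first differences, the form
    of [gamma_sum]. The boundary terms at [k] are kept exactly, since they will be divided by 1 -
    a^2. *)
Lemma sum_second_difference (g : nat -> R) (a : R) k : a != 0 ->
  g 0%N = 0 -> g 1%N = 1 ->
  2 * a * \sum_(i < k) a ^+ i * (2^-1 * (g i.+2 + g i - 2 * g i.+1)) + 1 =
  (1 - a) / a * (\sum_(j < k) a ^+ j.+1 * (g j.+1 - g j) - a ^+ k.+1 * g k)
  + (a ^+ k * g k.+1 - a ^+ k.+1 * g k).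
Proof.
move=> a0 g0 g1.
have -> : \sum_(j < k) a ^+ j.+1 * (g j.+1 - g j) - a ^+ k.+1 * g k =
    (1 - a) * \sum_(j < k) a ^+ j.+1 * g j.+1.
  elim: k => [|k IH]; first by rewrite !big_ord0 g0; ring.
  by rewrite !big_ord_recr/= [in RHS]mulrDr -IH !exprS; ring.
elim: k => [|k IH]; first by rewrite !big_ord0 g0 g1; ring.
rewrite !big_ord_recr/=; move: IH; set A := \sum_(i < k) _; set C := \sum_(i < k) _.
move=> IH; apply: (@etrans _ _ ((2 * a * A + 1) + 2 * a * (a ^+ k * (2^-1 * (g k.+2 + g k - 2 * g k.+1))))).
  by ring.
by rewrite IH !exprS; field.
Qed.

Context (al lam : R).
Hypothesis al0 : 0 < al.
Hypothesis al2 : al < 2.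
Hypothesis lam0 : 0 < lam.

Definition lag_pow (j : nat) : R := j%:R `^ al.

(* Lag-[i] autocovariance, [1 <= i], of the unit increments of fractional
   Brownian motion with [al = 2 H]. *)
Definition fgn_cov (i : nat) : R :=
  2^-1 * (lag_pow i.+1 + lag_pow i.-1 - 2 * lag_pow i).

Definition ar_coef (n : nat) : R := expR (- (lam / n%:R)).

(* The source term of the recursion [E Y_(k+1)^2 = a^2 E Y_k^2 + noise_input n k] of the
   autoregression [Y] with coefficient [a = ar_coef n]. *)
Definition noise_input (n k : nat) : R :=
  n%:R^-1 `^ al *
    (2 * ar_coef n * \sum_(i < k) ar_coef n ^+ i * fgn_cov i.+1 + 1).

Lemma ar_coef_gt0 n : 0 < ar_coef n. Proof. exact: expR_gt0. Qed.

Lemma ar_coef_lt1 n : (0 < n)%N -> ar_coef n < 1.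
Proof. by move=> n0; rewrite -expR0 ltr_expR oppr_lt0 divr_gt0// ltr0n. Qed.

(** From 1 - exp(-x) >= x / (1 + x) at x = lam / n, and n + lam <= (1 + lam) n. *)
Lemma ar_coef_gap n : (0 < n)%N -> (1 - ar_coef n)^-1 <= (1 + lam) / lam * n%:R.
Proof.
move=> n0; have nR : 1 <= n%:R :> R by rewrite ler1n.
have a1 := ar_coef_lt1 n0.
have nR0 : 0 < n%:R :> R by rewrite ltr0n.
have l1 : 0 < 1 + lam by rewrite addr_gt0.
have nl : 0 < n%:R + lam by rewrite addr_gt0.
have -> : (1 + lam) / lam * n%:R = (lam / ((1 + lam) * n%:R))^-1.
  by field; rewrite (gt_eqF nR0) (gt_eqF l1) (gt_eqF lam0).
rewrite lef_pV2 ?posrE ?subr_gt0//; last by rewrite divr_gt0// mulr_gt0.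
have x0 : 0 < lam / n%:R by rewrite divr_gt0.
have H : ar_coef n <= (1 + lam / n%:R)^-1.
  by rewrite /ar_coef expRN lef_pV2 ?posrE ?expR_gt0 ?expR_ge1Dx// addr_gt0.
rewrite lerBrDr -lerBrDl (le_trans H)//.
rewrite -subr_ge0.
have -> : 1 - lam / ((1 + lam) * n%:R) - (1 + lam / n%:R)^-1 =
  lam ^+ 2 * (n%:R - 1) / ((1 + lam) * n%:R * (n%:R + lam)).
  by field; rewrite (gt_eqF nR0) (gt_eqF l1) (gt_eqF nl).
by rewrite divr_ge0 ?mulr_ge0 ?subr_ge0 ?sqr_ge0// ltW.
Qed.

(** The numerical core of the next limit: 1 / (a (1 + a)) tends to 1/2 as a tends to 1, and the
    boundary terms [W], [W'] are small enough to survive division by 1 - a^2. *)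
Lemma ar_limit_error (a h c S W W' M e : R) : 3^-1 <= a -> a < 1 -> 1 - h <= a ->
  0 < c -> `|S - c| <= e -> 0 <= W' -> W' <= W -> (1 - a)^-1 <= M ->
  4 * h * c <= e -> W * (3 + M) <= e ->
  `|(S - W') / (a * (1 + a)) + (W - W') / (1 - a ^+ 2) - c / 2| <= 10 * e.
Proof.
move=> a3 a1 ah c0 HS W'0 W'W gap hc WM.
have W0 := le_trans W'0 W'W.
pose v := (a * (1 + a))^-1; pose X := (W - W') / (1 - a ^+ 2).
have [v0 v3 va va0] : [/\ 0 < v, v <= 3, v - 2^-1 <= 4 * h & 0 <= v - 2^-1].
  clear - a3 a1 ah.
  have a0 : 0 < a by lra.
  have p1 : 0 < a * (1 + a) by rewrite mulr_gt0//; lra.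
  have v0 : 0 < v by rewrite invr_gt0.
  split=> //.
  - by rewrite /v -[leRHS]invrK lef_pV2 ?posrE//; nra.
  - have -> : v - 2^-1 = (1 - a) * ((2 + a) / 2 * v).
      by rewrite /v; field; rewrite !gt_eqF//; lra.
    have H1 : (2 + a) / 2 * v <= 4 by rewrite /v ler_pdivrMr//; nra.
    have H2 : 0 <= (2 + a) / 2 * v by rewrite mulr_ge0 ?ltW//; lra.
    have := ler_wpM2l (_ : 0 <= 1 - a) H1.
    by rewrite subr_ge0 (ltW a1) => /(_ isT); lra.
  - by rewrite subr_ge0 /v lef_pV2 ?posrE//; nra.
have [X0 XM] : 0 <= X /\ X <= W * M.
  clear - a3 a1 W'0 W'W W0 gap.
  have a21 : 0 < 1 - a ^+ 2 by rewrite subr_gt0 expr_lt1//; lra.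
  split; first by apply: divr_ge0; [rewrite subr_ge0|exact: ltW].
  apply: (@le_trans _ _ (W * (1 - a)^-1)); last by rewrite ler_wpM2l.
  apply: ler_pM; rewrite ?subr_ge0// ?invr_ge0 ?(ltW a21)//; first by lra.
  by rewrite lef_pV2 ?posrE ?subr_gt0//; nra.
have -> : (S - W') / (a * (1 + a)) + X - c / 2 =
    (S - c) * v + (v - 2^-1) * c - W' * v + X by rewrite /v; ring.
move: HS; rewrite !ler_norml => /andP[s1 s2].
have e0 : 0 <= e by clear - s1 s2; lra.
have ev : e * v <= 3 * e by rewrite mulrC ler_wpM2r.
have t1 : (S - c) * v <= 3 * e by apply: le_trans ev; rewrite ler_pM2r.
have t2 : - (3 * e) <= (S - c) * v.
  by rewrite lerNl (le_trans _ ev)// -mulNr ler_pM2r// lerNl.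
have t3 : 0 <= (v - 2^-1) * c by rewrite mulr_ge0// ltW.
have t4 : (v - 2^-1) * c <= 4 * h * c by rewrite ler_pM2r.
have t5 : 0 <= W' * v by rewrite mulr_ge0// ltW.
have t6 : W' * v <= W * 3 by apply: ler_pM => //; exact: ltW.
rewrite mulrDr in WM.
have t7 : 0 <= W * M by exact: le_trans XM.
have t8 : 0 <= W * 3 by rewrite mulr_ge0.
clear - e0 t1 t2 t3 t4 t5 t6 t7 t8 X0 XM WM hc.
move: t1 t2 t3 t4 t5 t6 t7 t8 X0 XM WM hc.
set x1 := (S - c) * v; set x2 := (v - 2^-1) * c; set x3 := W' * v.
set x4 := W * 3; set x5 := W * M; set x6 := 4 * h * c.
by move: X => X *; apply/andP; split; lra.
Qed.

Lemma exp_tail_bound (C y : R) : y ^+ 4 * expR (- y) <= C -> 1 <= y ->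
  y `^ al * expR (- y) <= C / y ^+ 2.
Proof.
move=> HC y1; have y0 := lt_le_trans ltr01 y1.
apply: (@le_trans _ _ (y ^+ 2 * expR (- y))).
  rewrite ler_wpM2r ?expR_ge0// -powR_mulrn ?(ltW y0)//.
  by apply: ler_powR => //; exact: ltW.
rewrite ler_pdivlMr ?exprn_gt0// (le_trans _ HC)//.
by rewrite le_eqVlt; apply/orP; left; apply/eqP; ring.
Qed.

(** Self-similarity, n^(-al) = lam^(-al) h^al with h = lam / n, turns the noise sum into [gamma_sum]
    at mesh h. Since [k >= n ^ 2], the range h k is at least lam n, and the boundary terms decay
    faster than the factor O(n) lost in dividing by 1 - a^2. *)
Lemma noise_input_limit (eps : R) : 0 < eps -> exists n0, forall n k,
  (n0 <= n)%N -> (n ^ 2 <= k)%N ->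
  `|noise_input n k / (1 - ar_coef n ^+ 2) - al * Gamma al / 2 * lam `^ (- al)| <= eps.
Proof.
move=> eps0; pose L := lam `^ (- al).
have L0 : 0 < L by rewrite powR_gt0.
have Gp := Gamma_gt0 al0; have c0 : 0 < al * Gamma al by rewrite mulr_gt0.
have [C4 C40 HC4] := exp_dominates_pow R 4.
pose K := (1 + lam) / lam.
have K0 : 0 < K by apply: divr_gt0 => //; exact: addr_gt0.
(* The 10 is the constant of [ar_limit_error], and [L] the factor pulled out by self-similarity. *)
pose e1 := eps / L / 10.
have e10 : 0 < e1 by rewrite !divr_gt0.
have [dl [A [dl0 HS]]] := cvg_gamma_sum al0 e10.
pose D := 3 * C4 / lam ^+ 2 * (3 + K).
have D0 : 0 < D by rewrite !mulr_gt0 ?invr_gt0 ?exprn_gt0//; lra.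
(* The five thresholds give a fine enough mesh, a long enough range, a >= 1/3 together with lam n >=
   1, a small error from a <> 1, and small boundary terms. *)
have [n0 _ Hn0] : \forall n \near \oo, [/\ lam / dl <= n%:R, `|A| / lam <= n%:R,
    1 + 3 * lam + lam^-1 <= n%:R, 4 * lam * (al * Gamma al) / e1 <= n%:R & D / e1 <= n%:R].
  by near=> n; split; near: n; exact: nbhs_infty_ger.
exists n0 => n k nn nk; have [N1 N2 N3 N4 N5] := Hn0 n nn.
have li0 : 0 < lam^-1 by rewrite invr_gt0.
have lamp : 0 < lam := lam0; have alp : 0 < al := al0; have al2' : al < 2 := al2.
have n1 : 1 <= n%:R :> R by apply: le_trans N3; rewrite -addrA lerDl addr_ge0 ?mulr_ge0 ?ltW.
have n0' : (0 < n)%N by rewrite -(ltr_nat R); lra.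
set nR : R := n%:R in N1 N2 N3 N4 N5 n1 *.
have nR0 : 0 < nR by lra.
pose h := lam / nR; pose a := ar_coef n.
have h0 : 0 < h by rewrite divr_gt0.
have hd : h <= dl by rewrite /h ler_pdivrMr// mulrC -ler_pdivrMr.
have h1 : h <= 1 by rewrite /h ler_pdivrMr// mul1r; lra.
have a0 : 0 < a := ar_coef_gt0 n; have a0' := ltW a0; have a1 : a < 1 := ar_coef_lt1 n0'.
have ah : 1 - h <= a by exact: expR_ge1Dx.
have a3 : 3^-1 <= a.
  have : h <= 3^-1; last by lra.
  by rewrite /h ler_pdivrMr// mulrC ler_pdivlMr//; lra.
have kR : nR ^+ 2 <= k%:R by rewrite /nR -natrX ler_nat.
have k0 : (0 < k)%N by rewrite -(ltr_nat R); apply: lt_le_trans kR; rewrite exprn_gt0.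
have hk : lam * nR <= h * k%:R.
  rewrite (le_trans _ (ler_wpM2l (ltW h0) kR))// /h.
  by rewrite (_ : lam / nR * nR ^+ 2 = lam * nR)//; field; rewrite gt_eqF.
have {}HS : `|gamma_sum al h k - al * Gamma al| <= e1.
  case: k k0 {kR} hk {nk} => // k _ hk; apply: HS => //.
  apply: le_trans hk; move: N2; rewrite ler_pdivrMr// mulrC; apply: le_trans.
  exact: ler_norm.
set S := gamma_sum al h k in HS.
pose W := a ^+ k * (h * k.+1%:R) `^ al.
pose W' := a ^+ k.+1 * (h * k%:R) `^ al.
have W'0 : 0 <= W' by rewrite mulr_ge0 ?powR_ge0 ?exprn_ge0// ltW.
have W'W : W' <= W.
  rewrite /W' /W; apply: ler_pM; rewrite ?exprn_ge0 ?powR_ge0//.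
    by rewrite exprS ler_piMl ?exprn_ge0// ltW.
  have h0' := ltW h0; have al0' := ltW al0.
  have hm (j : nat) : h * j%:R \is Num.nneg by rewrite nnegrE mulr_ge0.
  apply: (ge0_ler_powR al0' (hm k) (hm k.+1)).
  by rewrite ler_wpM2l// ler_nat.
have hpow (j : nat) : (h * j%:R) `^ al = h `^ al * lag_pow j by rewrite powRM// ltW.
have hn : nR^-1 `^ al = L * h `^ al.
  rewrite /L /h powRM ?invr_ge0 ?ltW// mulrA powRN mulVf ?mul1r// gt_eqF// powR_gt0//.
have lag0 : lag_pow 0 = 0 by rewrite /lag_pow powR0// gt_eqF.
have lag1 : lag_pow 1 = 1 by rewrite /lag_pow powR1.
have a21 : 0 < 1 - a ^+ 2 by rewrite subr_gt0 expr_lt1// ltW.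
have zE : noise_input n k / (1 - a ^+ 2) =
    L * ((S - W') / (a * (1 + a)) + (W - W') / (1 - a ^+ 2)).
  rewrite /noise_input -/a -/nR /fgn_cov.
  have := @sum_second_difference lag_pow a k (lt0r_neq0 a0) lag0 lag1.
  rewrite /= => ->; rewrite hn.
  have -> : S = h `^ al * \sum_(j < k) a ^+ j.+1 * (lag_pow j.+1 - lag_pow j).
    rewrite /S /gamma_sum mulr_sumr; apply: eq_bigr => j _.
    rewrite !hpow -mulrBr mulrCA; congr (_ * (_ * _)).
    by rewrite /a /ar_coef -expRM_natl; congr expR; rewrite /h -/nR; ring.
  rewrite /W /W' !hpow.
  have -> : 1 - a ^+ 2 = (1 - a) * (1 + a) by ring.
  field; rewrite !gt_eqF// ?subr_gt0//; lra.
have Wb : W <= 3 * C4 / lam ^+ 2 / nR ^+ 2.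
  have ln1 : 1 <= lam * nR.
    rewrite mulrC -ler_pdivrMr// div1r (le_trans _ N3)// lerDr addr_ge0// mulr_ge0//.
    exact: ltW.
  have E : a ^+ k.+1 = expR (- (h * k.+1%:R)).
    by rewrite /a /ar_coef -expRM_natl /h -/nR; congr expR; ring.
  have yn : lam * nR <= h * k.+1%:R.
    by rewrite (le_trans hk)// ler_pM2l// ler_nat.
  rewrite /W; move: (h * k.+1%:R) E yn => y E yn.
  have y1 := le_trans ln1 yn; have y0 := lt_le_trans ltr01 y1.
  have Hy := exp_tail_bound (HC4 y (ltW y0)) y1.
  have ak : a ^+ k <= 3 * expR (- y).
    by rewrite -E exprS mulrA ler_peMl ?exprn_ge0// mulrC -ler_pdivrMr// div1r.
  apply: (@le_trans _ _ (3 * (y `^ al * expR (- y)))).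
    by rewrite mulrCA mulrC ler_wpM2l ?powR_ge0.
  rewrite (_ : 3 * C4 / lam ^+ 2 / nR ^+ 2 = 3 * (C4 / (lam * nR) ^+ 2)); last first.
    by rewrite -!mulrA -invfM -exprMn.
  rewrite ler_pM2l//; apply: (le_trans Hy); rewrite ler_pM2l//.
  have ln0 := lt_le_trans ltr01 ln1.
  rewrite lef_pV2 ?posrE ?exprn_gt0// lerXn2r// nnegrE; exact: ltW.
have WD : W * (3 + K * nR) <= e1.
  apply: (@le_trans _ _ (D / nR)); last first.
    by rewrite ler_pdivrMr// mulrC -ler_pdivrMr.
  apply: (@le_trans _ _ (3 * C4 / lam ^+ 2 / nR ^+ 2 * ((3 + K) * nR))).
    apply: ler_pM => //; first by rewrite (le_trans W'0).
      by rewrite addr_ge0// mulr_ge0// ltW.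
    by rewrite mulrDl lerD2r ler_peMr.
  rewrite /D le_eqVlt; apply/orP; left; apply/eqP; field.
  by rewrite !gt_eqF.
have gap := ar_coef_gap n0'; rewrite -/a -/nR -/K in gap.
have c4 : 4 * h * (al * Gamma al) <= e1.
  move: N4; rewrite ler_pdivrMr// /h => N4.
  rewrite (_ : 4 * _ * _ = (4 * lam * (al * Gamma al)) / nR); last by ring.
  by rewrite ler_pdivrMr// [leRHS]mulrC.
have B1 := ar_limit_error a3 a1 ah c0 HS W'0 W'W gap c4 WD.
rewrite zE -/L mulrC -mulrBl normrM (gtr0_norm L0).
by rewrite -ler_pdivlMr// (le_trans B1)// /e1 mulrC divfK.
Unshelve. all: by end_near. Qed.

End noise_sum.

(** * Summability of the autocovariances of fractional noise *)

Section lag_sum.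
Context (R : realType).

Lemma powR_midpoint (p x y : R) : 1 <= p -> 0 <= x -> 0 <= y ->
  (2^-1 * x + 2^-1 * y) `^ p <= 2^-1 * x `^ p + 2^-1 * y `^ p.
Proof.
move=> p1 x0 y0.
rewrite {2 4}(_ : 2^-1 = 1 - 2^-1); last by rewrite {2}(splitr 1) div1r addrK.
by apply: (convex_powR p1 (Itv01 _ _)) => //=;
  rewrite ?inE/= ?in_itv/= ?x0 ?y0// ?invr_ge0// invf_le1 ?ler1n.
Qed.

Context (al : R).
Hypothesis al0 : 0 < al.
Hypothesis al2 : al < 2.
Local Notation g := (lag_pow al).

Lemma lag_pow_ge0 j : 0 <= g j. Proof. exact: powR_ge0. Qed.

Lemma lag_pow_mono j : g j <= g j.+1.
Proof.
by apply: ge0_ler_powR; rewrite ?nnegrE ?ler_nat//; exact: ltW.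
Qed.

(** The growth exponent of the increments of j^al, hence of the partial sums of absolute
    autocovariances: 0 for H <= 1/2, and 2H - 1 under long memory. *)
Definition lag_exponent : R := Num.max 0 (al - 1).

Lemma lag_exponent_ge0 : 0 <= lag_exponent. Proof. by rewrite le_max lexx. Qed.

Lemma lag_exponent_lt1 : lag_exponent < 1.
Proof. by have := al2; rewrite gt_max ltr01/=; lra. Qed.

(** For [al <= 1] it rests on (1 + 1/j)^al <= 1 + 1/j; for [al > 1] on the same inequality with
    exponent al - 1, after writing j^al as j times j^(al - 1). *)
Lemma lag_pow_incr j : g j.+1 - g j <= 2 * j.+1%:R `^ lag_exponent.
Proof.
have [a1|a1] := leP al 1.
  have -> : lag_exponent = 0 by apply/max_idPl; lra.
  rewrite powRr0 mulr1; apply: (@le_trans _ _ 1); last by lra.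
  case: j => [|j]; first by rewrite /lag_pow powR1 powR0 ?subr0// gt_eqF.
  have j0 : 0 < j.+1%:R :> R by [].
  have i0 : 0 <= j.+1%:R^-1 :> R by rewrite invr_ge0.
  have H : (1 + j.+1%:R^-1) `^ al <= 1 + j.+1%:R^-1 :> R.
    by apply: ler1_powR => //; rewrite lerDl.
  rewrite /lag_pow -/(lag_pow al j.+1).
  have -> : j.+2%:R `^ al = g j.+1 * (1 + j.+1%:R^-1) `^ al.
    rewrite -powRM ?addr_ge0//.
    by rewrite mulrDr mulr1 divff ?gt_eqF// natr1.
  apply: (@le_trans _ _ (g j.+1 * j.+1%:R^-1)).
    by have := ler_wpM2l (lag_pow_ge0 j.+1) H; rewrite mulrDr mulr1; set u := _ * _; set v := _ * _^-1; lra.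
  rewrite ler_pdivrMr// mul1r; apply: ler1_powR => //.
  by rewrite ler1n.
have -> : lag_exponent = al - 1 by apply/max_idPr; lra.
have jp : 0 < j.+1%:R :> R by [].
have s1 : g j.+1 = j.+1%:R * j.+1%:R `^ (al - 1) by rewrite mulr_powRB1.
have s0 : g j = j%:R * j%:R `^ (al - 1) by rewrite mulr_powRB1.
have b1 : al - 1 <= 1 by have := al2; lra.
have : j%:R * (j.+1%:R `^ (al - 1) - j%:R `^ (al - 1)) <= j.+1%:R `^ (al - 1).
  case: j {s1 s0} jp => [|j] jp; first by rewrite mul0r powR_ge0.
  have j0 : 0 < j.+1%:R :> R by [].
  have i0 : 0 <= j.+1%:R^-1 :> R by rewrite invr_ge0.
  have H : (1 + j.+1%:R^-1) `^ (al - 1) <= 1 + j.+1%:R^-1 :> R.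
    by apply: ler1_powR => //; rewrite lerDl.
  have E : j.+2%:R `^ (al - 1) = j.+1%:R `^ (al - 1) * (1 + j.+1%:R^-1) `^ (al - 1).
    rewrite -powRM ?addr_ge0//.
    by rewrite mulrDr mulr1 divff ?gt_eqF// natr1.
  have m : j.+1%:R `^ (al - 1) <= j.+2%:R `^ (al - 1) :> R.
    by apply: ge0_ler_powR; rewrite ?nnegrE ?ler_nat//; lra.
  apply: le_trans m.
  have := ler_wpM2l (powR_ge0 j.+1%:R (al - 1)) H; rewrite -E mulrDr mulr1.
  rewrite -lerBlDl => K; apply: (le_trans (ler_wpM2l (ltW j0) K)).
  by rewrite mulrCA divff ?gt_eqF// mulr1.
by rewrite s1 s0 -natr1; lra.
Qed.

(** Second differences of j^al are nonnegative by convexity when [al >= 1]. The concave case follows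
    from convexity of the inverse power 1 / al. *)
Lemma fgn_cov_sign : (forall i, 0 <= fgn_cov al i.+1) \/ (forall i, fgn_cov al i.+1 <= 0).
Proof.
have mid j : j.+1%:R = 2^-1 * j.+2%:R + 2^-1 * j%:R :> R.
  by rewrite -(natr1 j.+1) -natr1; field.
have [a1|/ltW a1] := leP al 1; [right|left] => j.
  have A0 := lag_pow_ge0 j.+2; have B0 := lag_pow_ge0 j.
  have ai : 1 <= al^-1 by rewrite invf_ge1.
  have := powR_midpoint ai A0 B0.
  have E i : g i `^ al^-1 = i%:R by rewrite -powRrM divff ?gt_eqF// powRr1.
  rewrite !E -mid => H.
  have {}H : 2^-1 * g j.+2 + 2^-1 * g j <= g j.+1.
    set z := _ + _ in H *.
    have z0 : 0 <= z by rewrite addr_ge0// mulr_ge0// invr_ge0.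
    have -> : z = (z `^ al^-1) `^ al by rewrite -powRrM mulVf ?gt_eqF// powRr1.
    by apply: ge0_ler_powR; rewrite ?nnegrE ?powR_ge0//; exact: ltW.
  by rewrite /fgn_cov/=; lra.
have := powR_midpoint a1 (ler0n R j.+2) (ler0n R j); rewrite -mid.
by rewrite /fgn_cov /lag_pow/=; lra.
Qed.

(** The constant sign takes the absolute value out of the sum, which then telescopes. *)
Lemma fgn_cov_abs_sum N : \sum_(i < N) `|fgn_cov al i.+1| <= 2^-1 + N.+1%:R `^ lag_exponent.
Proof.
have tel M : \sum_(i < M) fgn_cov al i.+1 = 2^-1 * (g M.+1 - g M - 1).
  elim: M => [|M IH].
    by rewrite big_ord0 /lag_pow powR1 powR0 ?gt_eqF//; ring.
  by rewrite big_ord_recr/= IH /fgn_cov/=; ring.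
have := lag_pow_incr N; have := lag_pow_mono N; have := powR_ge0 N.+1%:R lag_exponent.
set v := _ `^ _.
have [s|s] := fgn_cov_sign.
  under eq_bigr do rewrite ger0_norm ?s//.
  by rewrite tel; lra.
under eq_bigr do rewrite ler0_norm ?s//.
by rewrite sumrN tel; lra.
Qed.

End lag_sum.

(** * Gaussian autoregression driven by fractional noise *)

Section autoregression.
Context (R : realType).

(** Started at 0, so that it is linear in the noise; the initial value of the path enters
    separately, with weight [a ^+ k]. *)
Fixpoint ar1 (a : R) (u : nat -> R) (k : nat) : R :=
  if k is k'.+1 then a * ar1 a u k' + u k' else 0.

Definition increments (b : R -> R) (n k : nat) : R :=
  b (k.+1%:R / n%:R) - b (k%:R / n%:R).

(** Here and in the next lemma, a contraction by [a] amplifies the input by at most 1 / (1 - a), in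
    the summed and in the uniform norm. *)
Lemma contraction_sum (a : R) (f g : nat -> R) N : 0 <= a <= 1 ->
  f 0%N <= 0 -> (forall k, 0 <= f k) ->
  (forall k, f k.+1 <= a * f k + g k) ->
  (1 - a) * \sum_(k < N) f k <= \sum_(k < N) g k.
Proof.
move=> /andP[a0 a1] f00 f0 fS.
suff : (1 - a) * \sum_(k < N) f k + f N <= \sum_(k < N) g k.
  by apply: le_trans; rewrite lerDl.
elim: N => [|N IH]; first by rewrite !big_ord0 mulr0 add0r.
by rewrite !big_ord_recr/= mulrDr; have := fS N; lra.
Qed.

Lemma contraction_sup (a s : R) (f : nat -> R) N : 0 <= a < 1 -> 0 <= s ->
  f 0%N <= 0 -> (forall k, f k.+1 <= a * f k + s) -> f N <= s / (1 - a).
Proof.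
move=> /andP[a0 a1] s0 f00 fS; have a1' : 0 < 1 - a by rewrite subr_gt0.
elim: N => [|N IH]; first by rewrite (le_trans f00)// divr_ge0// ltW.
apply: (le_trans (fS N)).
rewrite [leRHS](_ : _ = a * (s / (1 - a)) + s); first by rewrite lerD2r ler_wpM2l.
by field; rewrite gt_eqF.
Qed.

End autoregression.

Section ar_scheme.
Context d (T : measurableType d) (R : realType) (P : probability T R).
Context (H : R) (B : R -> {RV P >-> R}) (lam : R).
Hypothesis H01 : 0 < H < 1.
Hypothesis fbmB : fractional_brownian_motion H B.
Hypothesis lam0 : 0 < lam.
Local Notation E f := (\int[P]_w f w)%R.
Local Notation al := (2 * H).

Let al0 : 0 < al. Proof. by case/andP: H01 => H0 _; rewrite mulr_gt0. Qed.
Let al2 : al < 2. Proof. by case/andP: H01 => _ H1; lra. Qed.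

Definition noise (n k : nat) (w : T) : R := increments (fun t => B t w) n k.
Definition ou_scheme (n k : nat) (w : T) : R :=
  ar1 (ar_coef lam n) (increments (fun t => B t w) n) k.

Lemma noise_span n k : gauss_span B (noise n k).
Proof. by apply: gauss_spanB; exact: gauss_span_B. Qed.

Lemma ou_scheme_span n k : gauss_span B (ou_scheme n k).
Proof.
elim: k => [|k IH]; first exact: gauss_span0.
exact: gauss_spanD (gauss_spanZ _ IH) (noise_span n k).
Qed.

Let mN n k := gauss_span_has_moments fbmB (noise_span n k).
Let mY n k := gauss_span_has_moments fbmB (ou_scheme_span n k).

Lemma mean_increments (a b c e : R) :
  E (fun w => (B a w - B b w) * (B c w - B e w)) =
  2^-1 * (`|a - e| `^ al + `|b - c| `^ al - `|a - c| `^ al - `|b - e| `^ al).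
Proof.
have hB := B_has_moments fbmB.
have hp s t := has_momentsM (hB s) (hB t).
transitivity (E (fun w => (B a w * B c w - B a w * B e w) - (B b w * B c w - B b w * B e w))).
  by apply: eq_Rintegral => w _; ring.
rewrite (meanB (has_momentsB (hp a c) (hp a e)) (has_momentsB (hp b c) (hp b e))).
rewrite (meanB (hp a c) (hp a e)) (meanB (hp b c) (hp b e)) !(mean_BB fbmB) /fbm_cov.
by ring.
Qed.

Lemma noise_cov n l i : (0 < n)%N ->
  E (fun w => noise n l w * noise n (l + i.+1) w) = n%:R^-1 `^ al * fgn_cov al i.+1.
Proof.
move=> n0; have nR : 0 < n%:R :> R by rewrite ltr0n.
have i0 : 0 <= n%:R^-1 :> R by rewrite invr_ge0.
rewrite mean_increments /fgn_cov /=.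
have e (p q r : nat) : (p = q + r)%N -> `|q%:R / n%:R - p%:R / n%:R| `^ al = n%:R^-1 `^ al * lag_pow al r :> R.
  move=> ->; rewrite -mulrBl natrD opprD addrA subrr add0r mulNr normrN.
  by rewrite ger0_norm ?divr_ge0// mulrC powRM.
rewrite (e (l + i.+1)%N l.+1 i); last by lia.
rewrite (e (l + i.+1).+1 l i.+2); last by lia.
rewrite (e (l + i.+1).+1 l.+1 i.+1); last by lia.
rewrite (e (l + i.+1)%N l i.+1); last by lia.
by ring.
Qed.

Lemma noise_var n k : (0 < n)%N -> E (fun w => noise n k w ^+ 2) = n%:R^-1 `^ al.
Proof.
move=> n0; rewrite (mean_increment_sqr H01 fbmB) -mulrBl -natr1 addrAC subrr add0r mul1r.
by rewrite ger0_norm// invr_ge0.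
Qed.

Lemma mean_cross_bound (f g : T -> R) : has_moments P f -> has_moments P g ->
  `|E (fun w => f w * g w)| <= 2^-1 * (E (fun w => f w ^+ 2) + E (fun w => g w ^+ 2)).
Proof.
move=> hf hg; have hfg := has_momentsZ 2 (has_momentsM hf hg).
have h2 := has_momentsD (has_momentsX 2 hf) (has_momentsX 2 hg).
have p : 0 <= E (fun w => (f w ^+ 2 + g w ^+ 2) + 2 * (f w * g w)).
  by apply: mean_ge0 => w; rewrite (_ : _ + _ = (f w + g w) ^+ 2) ?sqr_ge0//; ring.
have m : 0 <= E (fun w => (f w ^+ 2 + g w ^+ 2) - 2 * (f w * g w)).
  by apply: mean_ge0 => w; rewrite (_ : _ - _ = (f w - g w) ^+ 2) ?sqr_ge0//; ring.
rewrite (meanD h2 hfg) (meanZ 2 (has_momentsM hf hg)) (meanD (has_momentsX 2 hf) (has_momentsX 2 hg)) in p.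
rewrite (meanB h2 hfg) (meanZ 2 (has_momentsM hf hg)) (meanD (has_momentsX 2 hf) (has_momentsX 2 hg)) in m.
by rewrite ler_norml; apply/andP; split; lra.
Qed.

Lemma inv_powR_le1 n : (0 < n)%N -> n%:R^-1 `^ al <= 1 :> R.
Proof.
move=> n0; have n1 : n%:R^-1 <= 1 :> R by rewrite invf_le1 ?ltr0n// ler1n.
have := ge0_ler_powR (ltW al0) _ _ n1.
by rewrite powR1 !nnegrE invr_ge0; apply.
Qed.

Lemma noise_cov_le1 n k l : (0 < n)%N ->
  `|E (fun w => noise n k w * noise n l w)| <= 1.
Proof.
move=> n0; apply: (le_trans (mean_cross_bound (mN n k) (mN n l))).
by rewrite !noise_var//; have := inv_powR_le1 n0; lra.
Qed.

(** At n = 1 this is a covariance of increments of variance 1. *)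
Lemma fgn_cov_le1 i : `|fgn_cov al i.+1| <= 1.
Proof.
have := noise_cov_le1 0 (0 + i.+1) (ltn0Sn 0).
by rewrite noise_cov// invr1 powR1 mul1r.
Qed.

(** The extra lag [m] is there for the induction: a step back in the scheme lengthens the lag by
    one. The case [m = 0] is the one applied to the second moments. *)
Lemma scheme_noise_cov n k m : (0 < n)%N ->
  E (fun w => ou_scheme n k w * noise n (k + m) w) =
  n%:R^-1 `^ al * \sum_(i < k) ar_coef lam n ^+ i * fgn_cov al (i + m).+1.
Proof.
move=> n0; elim: k m => [|k IH] m.
  rewrite big_ord0 mulr0 -[RHS](mean_cst P 0); apply: eq_Rintegral => w _.
  by rewrite /ou_scheme/= mul0r.
transitivity (E (fun w => ar_coef lam n * (ou_scheme n k w * noise n (k + m.+1) w)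
   + noise n k w * noise n (k + m.+1) w)).
  by apply: eq_Rintegral => w _; rewrite addSnnS /ou_scheme/= /noise; ring.
have h1 := has_momentsM (mY n k) (mN n (k + m.+1)).
rewrite (meanD (has_momentsZ _ h1) (has_momentsM (mN n k) (mN n _))) (meanZ _ h1) IH noise_cov//.
rewrite big_ord_recl/= expr0 mul1r mulrDr mulrCA [RHS]addrC; congr (_ + _).
congr (_ * _); rewrite mulr_sumr; apply: eq_bigr => i _.
by rewrite exprS mulrA addnS.
Qed.

Lemma scheme_second_moment n k : (0 < n)%N ->
  E (fun w => ou_scheme n k.+1 w ^+ 2) =
  ar_coef lam n ^+ 2 * E (fun w => ou_scheme n k w ^+ 2) + noise_input al lam n k.
Proof.
move=> n0; set a := ar_coef lam n.
transitivity (E (fun w => (a ^+ 2 * ou_scheme n k w ^+ 2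
   + 2 * a * (ou_scheme n k w * noise n (k + 0) w)) + noise n k w ^+ 2)).
  by apply: eq_Rintegral => w _; rewrite addn0 /ou_scheme/= -/a /noise; ring.
have h1 := has_momentsX 2 (mY n k); have h2 := has_momentsM (mY n k) (mN n (k + 0)).
rewrite (meanD (has_momentsD (has_momentsZ (a ^+ 2) h1) (has_momentsZ (2 * a) h2)) (has_momentsX 2 (mN n k))).
rewrite (meanD (has_momentsZ (a ^+ 2) h1) (has_momentsZ (2 * a) h2)) (meanZ _ h1) (meanZ _ h2).
rewrite scheme_noise_cov// noise_var// /noise_input -/a -addrA; congr (_ + _).
under eq_bigr do rewrite addn0.
by ring.
Qed.

Let a01 n : (0 < n)%N -> 0 <= ar_coef lam n < 1.
Proof. by move=> n0; rewrite (ltW (ar_coef_gt0 _ _)) (ar_coef_lt1 lam0). Qed.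

Let YS n k (f : T -> R) : has_moments P f ->
  `|E (fun w => ou_scheme n k.+1 w * f w)| <=
  ar_coef lam n * `|E (fun w => ou_scheme n k w * f w)| + `|E (fun w => noise n k w * f w)|.
Proof.
move=> hf.
have -> : E (fun w => ou_scheme n k.+1 w * f w) =
    ar_coef lam n * E (fun w => ou_scheme n k w * f w) + E (fun w => noise n k w * f w).
  rewrite -(meanZ _ (has_momentsM (mY n k) hf)).
  rewrite -(meanD (has_momentsZ _ (has_momentsM (mY n k) hf)) (has_momentsM (mN n k) hf)).
  by apply: eq_Rintegral => w _; rewrite /ou_scheme/= /noise; ring.
by rewrite (le_trans (ler_normD _ _))// normrM (gtr0_norm (ar_coef_gt0 _ _)).
Qed.

(* Never named again: [//] picks it up as the initial condition of the contraction lemmas. *)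
Let Y0 n (f : T -> R) : `|E (fun w => ou_scheme n 0 w * f w)| <= 0.
Proof.
rewrite (_ : E _ = 0) ?normr0//.
by rewrite -[RHS](mean_cst P 0); apply: eq_Rintegral => w _; rewrite mul0r.
Qed.

Let swap (f g : T -> R) : E (fun w => f w * g w) = E (fun w => g w * f w).
Proof. by apply: eq_Rintegral => w _; rewrite mulrC. Qed.

(** The uniform contraction is applied once per index, starting from noise covariances bounded by
    1. *)
Lemma scheme_cov_bound n k l : (0 < n)%N ->
  `|E (fun w => ou_scheme n k w * ou_scheme n l w)| <= (1 - ar_coef lam n)^-1 ^+ 2.
Proof.
move=> n0; have a1 := a01 n0; have /andP[_ a1'] := a1.
have i0 : 0 <= (1 - ar_coef lam n)^-1 by rewrite invr_ge0 subr_ge0 ltW.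
have H1 j : `|E (fun w => noise n j w * ou_scheme n l w)| <= (1 - ar_coef lam n)^-1.
  rewrite swap -[leRHS]mul1r.
  apply: (@contraction_sup _ _ 1 (fun l => `|E (fun w => ou_scheme n l w * noise n j w)|) l a1) => // i.
  by apply: (le_trans (YS n i (mN n j))); rewrite lerD2l noise_cov_le1.
rewrite expr2.
apply: (@contraction_sup _ _ _ (fun k => `|E (fun w => ou_scheme n k w * ou_scheme n l w)|) k a1) => // i.
by apply: (le_trans (YS n i (mY n l))); rewrite lerD2l.
Qed.

(** The square of indices grows by one row, one column and one diagonal entry; by stationarity a row
    runs through distinct lags. *)
Lemma noise_cov_abs_sum n N : (0 < n)%N ->
  \sum_(k < N) \sum_(l < N) `|E (fun w => noise n k w * noise n l w)| <=
  N%:R * (1 + 2 * \sum_(i < N) `|fgn_cov al i.+1|).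
Proof.
move=> n0; pose c k l := `|E (fun w => noise n k w * noise n l w)|.
have row M N' : (M <= N')%N -> \sum_(k < M) c k M <= \sum_(i < N') `|fgn_cov al i.+1|.
  move=> MN; apply: (@le_trans _ _ (\sum_(i < M) `|fgn_cov al i.+1|)); last first.
    rewrite -(subnKC MN) big_split_ord/= lerDl sumr_ge0//.
  rewrite (reindex_inj rev_ord_inj)/=; apply: ler_sum => i _.
  rewrite /c; have := noise_cov (M - i.+1) i n0.
  rewrite subnK ?ltn_ord// => ->.
  by rewrite normrM ger0_norm ?powR_ge0// ler_piMl// inv_powR_le1.
have cC k l : c k l = c l k by rewrite /c swap.
suff : forall M, (M <= N)%N -> \sum_(k < M) \sum_(l < M) c k l <= M%:R * (1 + 2 * \sum_(i < N) `|fgn_cov al i.+1|).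
  by apply.
elim=> [|M IH] MN; first by rewrite big_ord0 mul0r.
rewrite big_ord_recr/= big_ord_recr/=.
under eq_bigr do rewrite big_ord_recr/=.
rewrite big_split/=.
under [X in _ + (X + _)]eq_bigr do rewrite cC.
have := row M N (ltnW MN); have := IH (ltnW MN).
have : c M M <= 1 by exact: noise_cov_le1.
rewrite -natr1; set S := \sum_(i < N) _; set A := \sum_(i < M) \sum_(j < M) _.
set D := \sum_(i < M) c i M => h1 h2 h3.
by rewrite mulrDl mul1r; lra.
Qed.

(** The summed contraction, once per index, so that summability over lags passes from the noise to
    the scheme. *)
Lemma scheme_cov_abs_sum n N : (0 < n)%N ->
  \sum_(k < N) \sum_(l < N) `|E (fun w => ou_scheme n k w * ou_scheme n l w)| <=
  (1 - ar_coef lam n)^-1 ^+ 2 * (N%:R * (1 + 2 * \sum_(i < N) `|fgn_cov al i.+1|)).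
Proof.
move=> n0; have a1 := a01 n0; have /andP[a0 a1'] := a1; have a1w := ltW a1'.
have g0 : 0 < 1 - ar_coef lam n by rewrite subr_gt0.
have a01w : 0 <= ar_coef lam n <= 1 by rewrite a0.
rewrite exprVn ler_pdivlMl ?exprn_gt0//.
apply: le_trans (noise_cov_abs_sum N n0).
rewrite expr2 -mulrA.
apply: (@le_trans _ _ ((1 - ar_coef lam n) *
   \sum_(k < N) \sum_(l < N) `|E (fun w => noise n k w * ou_scheme n l w)|)).
  rewrite ler_pM2l// exchange_big/= mulr_sumr exchange_big/=.
  apply: ler_sum => l _.
  apply: (contraction_sum (f := fun k => `|E (fun w => ou_scheme n k w * ou_scheme n l w)|)
     (g := fun k => `|E (fun w => noise n k w * ou_scheme n l w)|)) => // k.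
  exact: YS.
rewrite mulr_sumr; apply: ler_sum => k _.
under eq_bigr do rewrite swap; under [leRHS]eq_bigr do rewrite swap.
apply: (contraction_sum (f := fun l => `|E (fun w => ou_scheme n l w * noise n k w)|)
  (g := fun l => `|E (fun w => noise n l w * noise n k w)|)) => // l.
exact: YS.
Qed.

End ar_scheme.

Lemma cvg_sqr0 (R : realType) (u : nat -> R) :
  u n ^+ 2 @[n --> \oo] --> (0 : R) -> u n @[n --> \oo] --> (0 : R).
Proof.
move=> u2; apply/cvgr0Pnorm_le => eps eps0.
have e2 : 0 < eps ^+ 2 by rewrite exprn_gt0.
near=> n; rewrite -(@ler_pXn2r _ 2)// ?nnegrE ?(ltW eps0)// real_normK ?num_real//.
by near: n; exact: (cvgr_le _ u2).
Unshelve. all: by end_near. Qed.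

(** * Strong law for the squares of the autoregression *)

Section scheme_lln.
Context d (T : measurableType d) (R : realType) (P : probability T R).
Context (H : R) (B : R -> {RV P >-> R}) (lam : R).
Hypothesis H01 : 0 < H < 1.
Hypothesis fbmB : fractional_brownian_motion H B.
Hypothesis lam0 : 0 < lam.
Local Notation E f := (\int[P]_w f w)%R.
Local Notation al := (2 * H).

Let al0 : 0 < al. Proof. by case/andP: H01 => H0 _; rewrite mulr_gt0. Qed.
Let al2 : al < 2.
Proof. by case/andP: H01 => _ H1; rewrite -[ltRHS]mulr1 ltr_pM2l. Qed.

Local Notation Y := (ou_scheme B lam).
Let mY n k : has_moments P (Y n k) := gauss_span_has_moments fbmB (ou_scheme_span B lam n k).

(* The stationary variance of the Ornstein-Uhlenbeck process with drift [- lam]. *)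
Definition ou_limit : R := al * Gamma al / 2 * lam `^ (- al).

Let c := ou_limit.
Let K := (1 + lam) / lam.
Let e n k := E (fun w => Y n k w ^+ 2).
Let z n k := noise_input al lam n k / (1 - ar_coef lam n ^+ 2).

Let c0 : 0 < c.
Proof. by rewrite /c /ou_limit !mulr_gt0 ?invr_gt0 ?powR_gt0 ?Gamma_gt0//; case/andP: H01. Qed.

Let K0 : 0 < K. Proof. by apply: divr_gt0 => //; exact: addr_gt0. Qed.

Let g n := (1 - ar_coef lam n)^-1.

Let gap n : (0 < n)%N -> [/\ 1 <= g n, g n <= K * n%:R & 0 < 1 - ar_coef lam n].
Proof.
move=> n0; have a1 := ar_coef_lt1 lam0 n0; have a0 := ar_coef_gt0 lam n.
have g0 : 0 < 1 - ar_coef lam n by rewrite subr_gt0.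
split=> //; last exact: ar_coef_gap.
by rewrite /g -[leLHS]invr1 lef_pV2 ?posrE// gerBl ltW.
Qed.

Let inv_gap2 n : (0 < n)%N -> 0 < (1 - ar_coef lam n ^+ 2)^-1 <= g n.
Proof.
move=> n0; have [_ _ g0] := gap n0; have a0 := ar_coef_gt0 lam n.
have h : 1 - ar_coef lam n <= 1 - ar_coef lam n ^+ 2.
  by rewrite lerD2l lerN2 expr2 ler_piMl ?ltW// -subr_gt0.
have h0 := lt_le_trans g0 h.
by rewrite invr_gt0 h0 lef_pV2 ?posrE.
Qed.

Let e_bound n k : (0 < n)%N -> 0 <= e n k <= g n ^+ 2.
Proof.
move=> n0; apply/andP; split; first by apply: mean_ge0 => w; exact: sqr_ge0.
by rewrite (le_trans _ (scheme_cov_bound H01 fbmB lam0 k k n0))// ler_norm.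
Qed.

(** The recursion reads e_(k+1) - e_k = (1 - a^2) (z_k - e_k), and its left side telescopes. *)
Let sum_e n N : (0 < n)%N ->
  \sum_(k < N) e n k = \sum_(k < N) z n k - e n N * (1 - ar_coef lam n ^+ 2)^-1.
Proof.
move=> n0; have /andP[i0 _] := inv_gap2 n0.
have d0 : 1 - ar_coef lam n ^+ 2 != 0 by rewrite -invr_eq0 gt_eqF.
elim: N => [|N IH].
  have e0 : e n 0 = 0.
    by rewrite -[RHS](mean_cst P 0); apply: eq_Rintegral => w _; rewrite expr0n.
  by rewrite !big_ord0 e0 mul0r subrr.
rewrite !big_ord_recr/= IH [e n N.+1](scheme_second_moment H01 fbmB lam0)// -/(e n N) /z.
by field.
Qed.

(** A crude bound for the first n^2 indices, where [noise_input_limit] says nothing. *)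
Let z_bound n k : (0 < n)%N -> `|z n k| <= 3 * g n ^+ 2.
Proof.
move=> n0; have [g1 _ g0] := gap n0; have /andP[i0 ig] := inv_gap2 n0.
have a0 := ar_coef_gt0 lam n; have a1 : ar_coef lam n < 1 by rewrite -subr_gt0.
rewrite /z normrM (gtr0_norm i0) expr2 mulrA.
apply: ler_pM => //; first exact: ltW.
rewrite /noise_input normrM ger0_norm ?powR_ge0//.
set S := \sum_(i < k) _.
have S_le : `|S| <= g n.
  apply: (le_trans (ler_norm_sum _ _ _)).
  apply: (@le_trans _ _ (\sum_(i < k) ar_coef lam n ^+ i)).
    apply: ler_sum => i _; rewrite normrM ger0_norm ?exprn_ge0 ?(ltW a0)//.
    by rewrite ler_piMr ?exprn_ge0 ?(ltW a0)// (fgn_cov_le1 H01 fbmB lam0).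
  have geo : (1 - ar_coef lam n) * \sum_(i < k) ar_coef lam n ^+ i = 1 - ar_coef lam n ^+ k.
    elim: k {S} => [|k IH]; first by rewrite big_ord0 mulr0 subrr.
    by rewrite big_ord_recr/= mulrDr IH exprS; ring.
  by rewrite /g -[leRHS]mul1r ler_pdivlMr// mulrC geo gerBl exprn_ge0// ltW.
have n1 := inv_powR_le1 H01 n0.
rewrite -[leRHS]mul1r; apply: ler_pM; [exact: powR_ge0|exact: normr_ge0|exact: n1|].
apply: (le_trans (ler_normD _ _)); rewrite normr1 normrM.
have a2 : `|2 * ar_coef lam n| <= 2.
  by rewrite ger0_norm ?mulr_ge0 ?(ltW a0)// ler_piMr// ltW.
have : `|2 * ar_coef lam n| * `|S| <= 2 * g n by apply: ler_pM.
by move: g1; lra.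
Qed.

Let mean_avg (M n : nat) : R := (n ^ M)%:R^-1 * \sum_(k < n ^ M) e n k.

(** The n^2 initial terms of size O(n^2) and the boundary term of size O(n^3) amount to O(n^4),
    negligible against at least n^5 cells. *)
Lemma mean_avg_cvg (M : nat) : (5 <= M)%N -> mean_avg M n @[n --> \oo] --> c.
Proof.
move=> M5; apply/cvgrPdist_le => eps eps0.
have eps2 : 0 < eps / 2 by rewrite divr_gt0.
have [n1 Hn1] := noise_input_limit al0 al2 lam0 eps2.
pose D := 3 * K ^+ 2 + c + K ^+ 3.
near=> n.
have n0 : (0 < n)%N by near: n; exact: nbhs_infty_gt.
have nn1 : (n1 <= n)%N by near: n; exact: nbhs_infty_ge.
have nD : D / (eps / 2) <= n%:R by near: n; exact: nbhs_infty_ger.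
have nR : 0 < n%:R :> R by rewrite ltr0n.
have n1R : 1 <= n%:R :> R by rewrite ler1n.
have [g1 gK g0] := gap n0; have /andP[i0 ig] := inv_gap2 n0.
have gg : 0 <= g n by exact: le_trans g1.
set N := (n ^ M)%N.
have N5 : n%:R ^+ 5 <= N%:R :> R by rewrite /N -natrX ler_nat leq_pexp2l.
have N0 : 0 < N%:R :> R by rewrite ltr0n expn_gt0 n0.
have N2 : (n ^ 2 <= N)%N by rewrite leq_pexp2l// (leq_trans _ M5).
have b1 k : `|z n k - c| <= (if (k < n ^ 2)%N then 3 * g n ^+ 2 + c else 0) + eps / 2.
  case: ltnP => [_|kn]; last by rewrite add0r; exact: Hn1.
  rewrite (le_trans (ler_normB _ _))// (gtr0_norm c0) -addrA lerD ?z_bound//.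
  by rewrite lerDl ltW.
have b2 : `|\sum_(k < N) z n k - N%:R * c| <= (n ^ 2)%:R * (3 * g n ^+ 2 + c) + N%:R * (eps / 2).
  have -> : \sum_(k < N) z n k - N%:R * c = \sum_(k < N) (z n k - c).
    by rewrite big_split/= sumrN sumr_const card_ord mulr_natl.
  apply: (le_trans (ler_norm_sum _ _ _)).
  apply: (@le_trans _ _ (\sum_(k < N) ((if (k < n ^ 2)%N then 3 * g n ^+ 2 + c else 0) + eps / 2))).
    by apply: ler_sum => k _; exact: b1.
  rewrite big_split/= [X in _ + X]sumr_const card_ord -[(eps / 2) *+ N]mulr_natl lerD2r.
  by rewrite -big_mkcond -(big_ord_widen N (fun=> 3 * g n ^+ 2 + c) N2) sumr_const card_ord -[X in X <= _]mulr_natl.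
have b3 : `|e n N * (1 - ar_coef lam n ^+ 2)^-1| <= g n ^+ 3.
  have /andP[e0 eg] := e_bound N n0.
  rewrite ger0_norm; last by rewrite mulr_ge0// ltW.
  by rewrite [g n ^+ 3]exprSr; apply: ler_pM => //; exact: (ltW i0).
have -> : c - mean_avg M n = - (N%:R^-1 * ((\sum_(k < N) z n k - N%:R * c) -
     e n N * (1 - ar_coef lam n ^+ 2)^-1)).
  rewrite /mean_avg -/N sum_e//; set v := (1 - _ ^+ 2)^-1.
  by field; rewrite gt_eqF.
rewrite normrN normrM gtr0_norm ?invr_gt0// ler_pdivrMl//.
rewrite (le_trans (ler_normB _ _))// (le_trans (lerD b2 b3))//.
have -> : N%:R * eps = N%:R * (eps / 2) + N%:R * (eps / 2) by field.
rewrite addrAC lerD2r.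
have g2 : g n ^+ 2 <= K ^+ 2 * n%:R ^+ 2.
  by rewrite -exprMn lerXn2r ?nnegrE// mulr_ge0// ltW.
have g3 : g n ^+ 3 <= K ^+ 3 * n%:R ^+ 3.
  by rewrite -exprMn lerXn2r ?nnegrE// mulr_ge0// ltW.
apply: (@le_trans _ _ (D * n%:R ^+ 4)).
  have n2 : n%:R ^+ 2 <= n%:R ^+ 4 :> R by rewrite ler_weXn2l.
  have n3 : n%:R ^+ 3 <= n%:R ^+ 4 :> R by rewrite ler_weXn2l.
  have k3 : K ^+ 3 * n%:R ^+ 3 <= K ^+ 3 * n%:R ^+ 4 by rewrite ler_pM2l// exprn_gt0.
  have c2 : c * n%:R ^+ 2 <= c * n%:R ^+ 4 by rewrite ler_pM2l.
  have q : (n ^ 2)%:R * (3 * g n ^+ 2 + c) <= 3 * K ^+ 2 * n%:R ^+ 4 + c * n%:R ^+ 4.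
    rewrite natrX mulrDr lerD//; last by rewrite mulrC.
    have := ler_wpM2l (_ : 0 <= 3 * n%:R ^+ 2) g2.
    rewrite mulr_ge0 ?exprn_ge0// => /(_ isT).
    have -> : 3 * n%:R ^+ 2 * (K ^+ 2 * n%:R ^+ 2) = 3 * K ^+ 2 * n%:R ^+ 4 by ring.
    by have -> : 3 * n%:R ^+ 2 * g n ^+ 2 = n%:R ^+ 2 * (3 * g n ^+ 2) by ring.
  rewrite /D (_ : (3 * K ^+ 2 + c + K ^+ 3) * n%:R ^+ 4 = (3 * K ^+ 2 * n%:R ^+ 4 + c * n%:R ^+ 4) + K ^+ 3 * n%:R ^+ 4); last by ring.
  by rewrite lerD// (le_trans g3).
apply: (@le_trans _ _ (n%:R ^+ 5 * (eps / 2))); last by rewrite ler_pM2r.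
rewrite [n%:R ^+ 5]exprSr -mulrA mulrC ler_pM2l ?exprn_gt0//.
by rewrite -ler_pdivrMr.
Unshelve. all: by end_near. Qed.

Let beta := lag_exponent al.

(** A sum of squared covariances is at most their supremum times their absolute sum, which costs (1
    - a)^(-4), that is n^4; two more powers of n give summability, whence the 6. *)
Let variance_bound (M n : nat) : (0 < n)%N -> 6 <= M%:R * (1 - beta) ->
  E (fun w => ((n ^ M)%:R^-1 * \sum_(k < n ^ M) (Y n k w ^+ 2 - e n k)) ^+ 2) <=
  16 * K ^+ 4 / n%:R ^+ 2.
Proof.
move=> n0 M6; have [g1 gK g0] := gap n0.
have nR : 0 < n%:R :> R by rewrite ltr0n.
have n1R : 1 <= n%:R :> R by rewrite ler1n.
have gg : 0 <= g n by exact: le_trans g1.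
have [N NE] : exists N, N = (n ^ M)%N by exists (n ^ M)%N.
rewrite -NE; have N1 : (0 < N)%N by rewrite NE expn_gt0 n0.
have N0 : 0 < N%:R :> R by rewrite ltr0n.
have b0 : 0 <= beta := lag_exponent_ge0 al.
have b1 : beta < 1 := lag_exponent_lt1 al2.
have hS : has_moments P (fun w => (\sum_(k < N) (Y n k w ^+ 2 - e n k)) ^+ 2).
  apply: has_momentsX; apply: (has_moments_sum (index_enum _)) => k.
  by apply: has_momentsB; [exact: has_momentsX|exact: has_moments_cst].
under eq_Rintegral do rewrite exprMn.
rewrite (meanZ _ hS) (@var_sum_sqr _ _ _ _ _ _ fbmB _ (index_enum _) (fun k : 'I_N => Y n k)); last first.
  by move=> k; exact: ou_scheme_span.
set V := \sum_(k < N) _.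
have RN : \sum_(i < N) `|fgn_cov al i.+1| <= 2^-1 + 2 * N%:R `^ beta.
  apply: (le_trans (fgn_cov_abs_sum al0 al2 N)); rewrite lerD2l.
  have : N.+1%:R <= 2 * N%:R :> R by rewrite -natrM ler_nat mul2n -addnn -addn1 leq_add2l.
  move=> NN; apply: (@le_trans _ _ ((2 * N%:R) `^ beta)).
    by apply: ge0_ler_powR; rewrite ?nnegrE ?mulr_ge0//; exact: ltW.
  rewrite powRM ?(ltW N0)// ler_wpM2r ?powR_ge0//.
  by apply: ler1_powR; rewrite ?ler1n// ltW.
have Nb : 1 <= N%:R `^ beta by rewrite -[leLHS](powRr0 N%:R) ler_powR// ler1n.
have sqr_le (x y : R) : `|x| <= y -> x ^+ 2 <= y * `|x|.
  by move=> xy; rewrite -(real_normK (num_real x)) expr2 ler_wpM2r.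
have VN : V <= g n ^+ 4 * (N%:R * (6 * N%:R `^ beta)).
  apply: (@le_trans _ _ (\sum_(k < N) \sum_(l < N) g n ^+ 2 * `|E (fun w => Y n k w * Y n l w)|)).
    apply: ler_sum => k _; apply: ler_sum => l _.
    apply: sqr_le; exact: (scheme_cov_bound H01 fbmB lam0).
  under eq_bigr do rewrite -mulr_sumr.
  rewrite -mulr_sumr; have -> : g n ^+ 4 = g n ^+ 2 * g n ^+ 2 by rewrite -exprD.
  rewrite -mulrA.
  rewrite ler_wpM2l ?exprn_ge0// (le_trans (scheme_cov_abs_sum H01 fbmB lam0 N n0))//.
  rewrite ler_wpM2l ?exprn_ge0// ler_wpM2l ?(ltW N0)//.
  by move: RN Nb; lra.
have g4 : g n ^+ 4 <= K ^+ 4 * n%:R ^+ 4.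
  by rewrite -exprMn lerXn2r ?nnegrE// mulr_ge0// ltW.
have Npow : n%:R ^+ 6 * (N%:R `^ beta) <= N%:R.
  have E1 : N%:R = N%:R `^ (1 - beta) * N%:R `^ beta :> R.
    rewrite -powRD ?subrK ?(powRr1 (ltW N0))//.
    by rewrite (gt_eqF N0) implybT.
  rewrite [leRHS]E1.
  rewrite ler_wpM2r ?powR_ge0// NE natrX -(powR_mulrn M)// -powRrM.
  by rewrite -powR_mulrn// ler_powR.
rewrite exprVn ler_pdivrMl ?exprn_gt0// mulrCA.
apply: (@le_trans _ _ (2 * (K ^+ 4 * n%:R ^+ 4 * (N%:R * (6 * N%:R `^ beta))))).
  by rewrite ler_pM2l//; apply: (le_trans VN); apply: ler_wpM2r.
rewrite [leRHS]mulrA ler_pdivlMr ?exprn_gt0//.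
have -> : 2 * (K ^+ 4 * n%:R ^+ 4 * (N%:R * (6 * N%:R `^ beta))) * n%:R ^+ 2 =
  12 * K ^+ 4 * N%:R * (n%:R ^+ 6 * N%:R `^ beta) by ring.
apply: (@le_trans _ _ (12 * K ^+ 4 * N%:R * N%:R)).
  by rewrite ler_wpM2l// mulr_ge0// mulr_ge0// exprn_ge0// ltW.
have q0 : 0 <= K ^+ 4 * N%:R ^+ 2 by rewrite mulr_ge0// exprn_ge0// ltW.
have -> : 12 * K ^+ 4 * N%:R * N%:R = 12 * (K ^+ 4 * N%:R ^+ 2) by ring.
by rewrite -[leRHS]mulrA ler_wpM2r// ler_nat.
Qed.

Lemma scheme_lln : exists M0, forall M, (M0 <= M)%N ->
  {ae P, forall w, (n ^ M)%:R^-1 * \sum_(k < n ^ M) Y n k w ^+ 2 @[n --> \oo] --> c}.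
Proof.
have b1 : 0 < 1 - beta by rewrite subr_gt0; exact: lag_exponent_lt1.
exists (maxn 5 (Num.truncn (6 / (1 - beta))).+1) => M; rewrite geq_max => /andP[M5 M6].
have {}M6 : 6 <= M%:R * (1 - beta).
  rewrite -ler_pdivrMr//; have h : 0 <= 6 / (1 - beta) by rewrite divr_ge0// ltW.
  have /andP[_ /ltW h1] := truncn_itv h; apply: (le_trans h1).
  by rewrite ler_nat.
pose f n w := ((n ^ M)%:R^-1 * \sum_(k < n ^ M) (Y n k w ^+ 2 - e n k)) ^+ 2.
have mf n : has_moments P (f n).
  apply: has_momentsX; apply: has_momentsZ; apply: (has_moments_sum (index_enum _)) => k.
  by apply: has_momentsB; [exact: has_momentsX|exact: has_moments_cst].
have := @summable_expectation_cvg0 _ _ _ P f (16 * K ^+ 4) 1 (fun n => (mf n).1).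
have f0 n w : 0 <= f n w by exact: sqr_ge0.
move=> /(_ f0); case; last first.
  move=> A [mA PA HA]; exists A; split=> // w /= Hw; apply: HA => /= fw; apply: Hw.
  have h1 : (n ^ M)%:R^-1 * \sum_(k < n ^ M) (Y n k w ^+ 2 - e n k) @[n --> \oo] --> (0 : R).
    exact: cvg_sqr0.
  have h2 : (n ^ M)%:R^-1 * \sum_(k < n ^ M) (Y n k w ^+ 2 - e n k) + mean_avg M n
      @[n --> \oo] --> 0 + c by exact: cvgD h1 (mean_avg_cvg M5).
  have eq_avg : (fun n => (n ^ M)%:R^-1 * \sum_(k < n ^ M) (Y n k w ^+ 2 - e n k) + mean_avg M n) =
      (fun n => (n ^ M)%:R^-1 * \sum_(k < n ^ M) Y n k w ^+ 2).
    apply/funext => n; rewrite /mean_avg -mulrDr -big_split/=.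
    by under eq_bigr do rewrite subrK.
  by rewrite eq_avg add0r in h2.
move=> n n0; rewrite (mean_EFin (mf n)) lee_fin.
exact: variance_bound.
Unshelve. all: by end_near. Qed.

End scheme_lln.

(** * Negative drift *)

Section eventually_dominated.
Context (R : realType).
Implicit Types (A B C : nat -> R) (c : R).

(** The multiplicative and additive slack lets such comparisons be chained before any of the
    sequences is known to be bounded; against a constant, domination both ways is convergence. *)
Definition eventually_dominated A B :=
  forall dl : R, 0 < dl -> \forall n \near \oo, A n <= (1 + dl) * B n + dl.

Lemma eventually_dominated_trans A B C : (forall n, 0 <= C n) ->
  eventually_dominated A B -> eventually_dominated B C -> eventually_dominated A C.
Proof.
move=> C0 AB BC dl dl0; pose e := Num.min dl 1 / 3.
have e0 : 0 < e by rewrite divr_gt0// lt_min dl0 ltr01.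
have e1 : e <= 1 / 3 by rewrite ler_pM2r ?invr_gt0// ge_min lexx orbT.
have ed : e <= dl / 3 by rewrite ler_pM2r ?invr_gt0// ge_min lexx.
near=> n; have h1 : A n <= (1 + e) * B n + e by near: n; exact: AB.
have h2 : B n <= (1 + e) * C n + e by near: n; exact: BC.
have e1' : 0 <= 1 + e by rewrite addr_ge0 ?(ltW e0).
apply: (le_trans h1); apply: (le_trans (lerD (ler_wpM2l e1' h2) (lexx e))).
have ee : e * e <= e * (1 / 3) by rewrite ler_wpM2l ?(ltW e0).
have := C0 n; move: (C n) => y y0.
have : (2 * e + e * e) * y <= dl * y by rewrite ler_wpM2r//; lra.
by clearbody e; lra.
Unshelve. all: by end_near. Qed.

Lemma cvg_of_dominated A c : 0 <= c -> (forall n, 0 <= A n) ->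
  eventually_dominated A (fun=> c) -> eventually_dominated (fun=> c) A ->
  A n @[n --> \oo] --> c.
Proof.
move=> c0 A0 Ac cA; apply/cvgrPdist_le => eps eps0.
pose e := eps / (2 + c + eps).
have s0 : 0 < 2 + c + eps by lra.
have e0 : 0 < e by rewrite divr_gt0.
have eE : e * (2 + c + eps) = eps by rewrite divfK ?gt_eqF.
near=> n; have h1 : A n <= (1 + e) * c + e by near: n; exact: Ac.
have h2 : c <= (1 + e) * A n + e by near: n; exact: cA.
have := A0 n; move: (A n) h1 h2 => y h1 h2 y0.
have ec : 0 <= e * c by rewrite mulr_ge0// ltW.
have ee : 0 < e * eps by rewrite mulr_gt0.
rewrite ler_norml; apply/andP; split; first by lra.
have [cy|cy] := leP c y; first by lra.
have : e * y <= e * c by rewrite ler_pM2l// ltW.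
lra.
Unshelve. all: by end_near. Qed.

Lemma dominated_of_cvg A c : 0 <= c -> A n @[n --> \oo] --> c ->
  eventually_dominated A (fun=> c) /\ ((forall n, 0 <= A n) -> eventually_dominated (fun=> c) A).
Proof.
move=> c0 Ac; split=> [|A0] dl dl0; near=> n.
  have : `|c - A n| <= dl by near: n; move/cvgrPdist_le : Ac; exact.
  rewrite ler_norml => /andP[h1 _]; rewrite mulrDl mul1r.
  have : 0 <= dl * c by rewrite mulr_ge0// ltW.
  lra.
have : `|c - A n| <= dl by near: n; move/cvgrPdist_le : Ac; exact.
rewrite ler_norml => /andP[_ h1]; rewrite mulrDl mul1r.
have : 0 <= dl * A n by rewrite mulr_ge0// ltW.
lra.
Unshelve. all: by end_near. Qed.

Lemma dominated_scale (s : nat -> R) A : (forall n, 0 <= A n) ->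
  s n @[n --> \oo] --> (1 : R) -> eventually_dominated (fun n => s n * A n) A.
Proof.
move=> A0 s1 dl dl0; near=> n; rewrite -[leLHS]addr0 lerD ?(ltW dl0)//.
rewrite ler_wpM2r//; near: n; apply: (cvgr_le _ s1); lra.
Unshelve. all: by end_near. Qed.

Lemma sqr_perturb (dl u v r : R) : 0 < dl -> `|u| <= `|v| + r ->
  u ^+ 2 <= (1 + dl) * v ^+ 2 + (1 + dl^-1) * r ^+ 2.
Proof.
move=> dl0 uv.
have vr0 : 0 <= `|v| + r by exact: le_trans uv.
have : u ^+ 2 <= (`|v| + r) ^+ 2.
  by rewrite -(real_normK (num_real u)) lerXn2r ?nnegrE.
move=> /le_trans; apply; rewrite -(real_normK (num_real v)).
move: `|v| => w; rewrite -subr_ge0.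
rewrite [leRHS](_ : _ = dl^-1 * (dl * w - r) ^+ 2); first by rewrite mulr_ge0 ?invr_ge0 ?sqr_ge0// ltW.
by field; rewrite gt_eqF.
Qed.

Definition mean_sqr (u : nat -> nat -> R) (N : nat -> nat) (n : nat) : R :=
  (N n)%:R^-1 * \sum_(k < N n) u n k ^+ 2.

Lemma mean_sqr_ge0 u N n : 0 <= mean_sqr u N n.
Proof. by rewrite mulr_ge0 ?invr_ge0// sumr_ge0// => k _; exact: sqr_ge0. Qed.

(** Young's inequality splits off the cross term, so the error [r] need only be small in mean
    square; this admits the transient of the initial value, which is not uniformly small. *)
Lemma mean_sqr_dominated (u v : nat -> nat -> R) (N : nat -> nat) :
  (forall eps : R, 0 < eps -> \forall n \near \oo, exists r : nat -> R,
    (forall k, (k < N n)%N -> `|u n k| <= `|v n k| + r k) /\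
    (N n)%:R^-1 * \sum_(k < N n) r k ^+ 2 <= eps) ->
  eventually_dominated (mean_sqr u N) (mean_sqr v N).
Proof.
move=> H dl dl0; have e0 : 0 < dl / (1 + dl^-1) by rewrite divr_gt0// addr_gt0// invr_gt0.
near=> n; have [r [uv rs]] : exists r : nat -> R,
    (forall k, (k < N n)%N -> `|u n k| <= `|v n k| + r k) /\
    (N n)%:R^-1 * \sum_(k < N n) r k ^+ 2 <= dl / (1 + dl^-1).
  by near: n; exact: H.
apply: (@le_trans _ _ ((1 + dl) * mean_sqr v N n + (1 + dl^-1) * ((N n)%:R^-1 * \sum_(k < N n) r k ^+ 2))); last first.
  rewrite lerD2l mulrC -ler_pdivlMr// addr_gt0// invr_gt0//.
rewrite /mean_sqr mulrCA [X in _ + X]mulrCA -mulrDr ler_wpM2l ?invr_ge0//.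
rewrite !mulr_sumr -big_split/=; apply: ler_sum => k _.
by apply: sqr_perturb => //; exact: uv.
Unshelve. all: by end_near. Qed.

End eventually_dominated.

Lemma nat_root_bounds (P T : nat) : (0 < P)%N -> exists j, (j ^ P <= T < j.+1 ^ P)%N.
Proof.
move=> P0; elim: T => [|T [j /andP[j1 j2]]]; first by exists 0%N; rewrite exp0n//= exp1n.
have [h|h] := ltnP T.+1 (j.+1 ^ P); first by exists j; rewrite h andbT (leq_trans j1).
exists j.+1; rewrite h/= (leq_ltn_trans j2)// ltn_exp2r//.
Qed.

(** Consecutive P-th powers have ratio tending to 1, so for T between two of them monotonicity
    squeezes [J T / T]. *)
Lemma cvg_mean_interpolation (R : realType) (J : R -> R) (c : R) (P : nat) : (0 < P)%N ->
  0 <= c -> (forall s t : R, 0 <= s -> s <= t -> J s <= J t) -> J 0 = 0 ->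
  J (n ^ P)%:R / (n ^ P)%:R @[n --> \oo] --> c ->
  J n%:R / n%:R @[n --> \oo] --> c.
Proof.
move=> P0 c0 Jm J0 Jc.
have Jge t : 0 <= t -> 0 <= J t by move=> t0; rewrite -J0 Jm.
have r1 : ((n.+1%:R / n%:R) ^+ P : R) @[n --> \oo] --> (1 : R).
  rewrite -[X in _ --> X](expr1n _ P); apply: (cvg_comp _ (fun y : R => y ^+ P)); last exact: exprn_continuous.
  apply/cvgrPdist_le => eps eps0; near=> n.
  have n0 : 0 < n%:R :> R by near: n; exact: nbhs_infty_gtr.
  rewrite distrC -natr1 mulrDl divff ?gt_eqF// addrAC subrr add0r ger0_norm ?divr_ge0//.
  rewrite ler_pdivrMr// mulrC -ler_pdivrMr//.
  by near: n; exact: nbhs_infty_ger.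
pose q n := J (n ^ P)%:R / (n ^ P)%:R.
have up : (q n.+1 * (n.+1%:R / n%:R) ^+ P : R) @[n --> \oo] --> c.
  rewrite -[X in _ --> X]mulr1; apply: cvgM => //.
  by rewrite (cvg_shiftS q).
have dn : (q n / (n.+1%:R / n%:R) ^+ P : R) @[n --> \oo] --> c.
  rewrite -[X in _ --> X]divr1; apply: cvgM => //.
  by apply: cvgV => //; rewrite oner_neq0.
apply/cvgrPdist_le => eps eps0.
have [n1 _ H1] : \forall n \near \oo, q n.+1 * (n.+1%:R / n%:R) ^+ P <= c + eps.
  by apply: (cvgr_le _ up); lra.
have [n2 _ H2] : \forall n \near \oo, c - eps <= q n / (n.+1%:R / n%:R) ^+ P.
  by apply: (cvgr_ge _ dn); lra.
pose n0 := maxn 1 (maxn n1 n2).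
exists (n0 ^ P)%N => // t /= nt.
have [j /andP[j1 j2]] := nat_root_bounds t P0.
have jn : (n0 <= j)%N.
  by have := leq_ltn_trans nt j2; rewrite ltn_exp2r.
have j0 : (0 < j)%N by rewrite (leq_trans _ jn)// leq_max.
have t0 : (0 < t)%N by rewrite (leq_trans _ j1)// expn_gt0 j0.
have jP0 : 0 < (j ^ P)%:R :> R by rewrite ltr0n expn_gt0 j0.
have jS0 : 0 < (j.+1 ^ P)%:R :> R by rewrite ltr0n expn_gt0.
have t0R : 0 < t%:R :> R by rewrite ltr0n.
have j1R : (j ^ P)%:R <= t%:R :> R by rewrite ler_nat.
have j2R : t%:R <= (j.+1 ^ P)%:R :> R by rewrite ler_nat ltnW.
have h1 : q j.+1 * (j.+1%:R / j%:R) ^+ P <= c + eps.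
  by apply: H1; rewrite /= (leq_trans _ jn)// /n0 !leq_max leqnn !orbT.
have h2 : c - eps <= q j / (j.+1%:R / j%:R) ^+ P.
  by apply: H2; rewrite /= (leq_trans _ jn)// /n0 !leq_max leqnn !orbT.
have e1 : q j.+1 * (j.+1%:R / j%:R) ^+ P = J (j.+1 ^ P)%:R / (j ^ P)%:R.
  rewrite /q expr_div_n -!natrX mulrA; congr (_ / _).
  by rewrite mulrVK// unitfE gt_eqF.
have e2 : q j / (j.+1%:R / j%:R) ^+ P = J (j ^ P)%:R / (j.+1 ^ P)%:R.
  rewrite /q expr_div_n -!natrX invf_div mulrA; congr (_ / _).
  by rewrite mulrVK// unitfE gt_eqF.
rewrite e1 in h1; rewrite e2 in h2; rewrite ler_norml; apply/andP; split.
  suff : J t%:R / t%:R <= c + eps by lra.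
  apply: le_trans h1; rewrite ler_pM ?Jge ?invr_ge0 ?ler0n//; first exact: Jm.
  by rewrite lef_pV2.
suff : c - eps <= J t%:R / t%:R by lra.
apply: (le_trans h2); rewrite ler_pM ?Jge ?invr_ge0 ?ler0n//; first exact: Jm.
by rewrite lef_pV2.
Unshelve. all: by end_near. Qed.

Lemma cvg_div_nat0 (R : realType) (c : R) : c / n%:R @[n --> \oo] --> (0 : R).
Proof.
apply/cvgr0Pnorm_le => eps eps0; near=> n.
have n0 : 0 < n%:R :> R by near: n; exact: nbhs_infty_gtr.
rewrite normrM normfV (gtr0_norm n0) ler_pdivrMr// mulrC -ler_pdivrMr//.
by near: n; exact: nbhs_infty_ger.
Unshelve. all: by end_near. Qed.

Lemma cvg_expn_infty m : (0 < m)%N -> (n ^ m)%N @[n --> \oo] --> \oo.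
Proof.
move=> m0; apply/cvgnyPge => A; near=> n.
have n0 : (0 < n)%N by near: n; exact: nbhs_infty_gt.
rewrite (@leq_trans n)//; first by near: n; exact: nbhs_infty_ge.
by rewrite -[leqLHS]expn1 leq_pexp2l.
Unshelve. all: by end_near. Qed.

(** * Grid values, autoregression and time integral of one path *)

Section ou_ergodic.
Context (R : realType).
Local Notation mu := (@lebesgue_measure R).
Context (lam x0 : R) (b x : R -> R).
Hypothesis lam0 : 0 < lam.
Hypothesis cb : continuous b.
Hypothesis xE : forall t : R, 0 <= t -> mu.-integrable `[0, t] (EFin \o x) /\
  x t = x0 + - lam * (\int[mu]_(s in `[0, t]) x s) + b t.

Let lamN0 : - lam != 0. Proof. by rewrite oppr_eq0 gt_eqF. Qed.
Local Notation a := (ar_coef lam).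
Local Notation xg n k := (x (k%:R / n%:R)).
Local Notation Y n := (ar1 (a n) (increments b n)).

Lemma ou_grid_step n k (eps : R) : (0 < n)%N ->
  (forall u : R, 0 <= u <= n%:R^-1 -> `|b (k%:R / n%:R + u) - b (k%:R / n%:R)| <= eps) ->
  `|xg n k.+1 - a n * xg n k - increments b n k| <= eps * (1 - a n).
Proof.
move=> n0 osc; have n0R : 0 < n%:R :> R by rewrite ltr0n.
have t0 : 0 <= k%:R / n%:R :> R by rewrite divr_ge0.
have ni0 : 0 <= n%:R^-1 :> R by rewrite invr_ge0.
have := ou_step cb xE lamN0 t0 ni0 osc.
have -> : k%:R / n%:R + n%:R^-1 = k.+1%:R / n%:R :> R by rewrite -natr1 mulrDl mul1r.
rewrite mulNr -/(ar_coef lam n) => /le_trans; apply.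
by rewrite distrC ger0_norm// subr_ge0 ltW// ar_coef_lt1.
Qed.

(** One eps comes from the increment of the noise and one from the Gronwall error. The lower bound
    carries [a n] because the homogeneous flow contracts by at most this factor within a cell. *)
Lemma ou_cell_bounds n k (eps u : R) : (0 < n)%N -> 0 <= u <= n%:R^-1 ->
  (forall u : R, 0 <= u <= n%:R^-1 -> `|b (k%:R / n%:R + u) - b (k%:R / n%:R)| <= eps) ->
  `|x (k%:R / n%:R + u)| <= `|xg n k| + 2 * eps /\
  a n * `|xg n k| <= `|x (k%:R / n%:R + u)| + 2 * eps.
Proof.
move=> n0 /andP[u0 un] osc; have n0R : 0 < n%:R :> R by rewrite ltr0n.
have t0 : 0 <= k%:R / n%:R :> R by rewrite divr_ge0.
have eps0 : 0 <= eps.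
  apply: le_trans (osc 0 _); first exact: normr_ge0.
  by rewrite lexx invr_ge0/=.
have oscu (v : R) : 0 <= v <= u -> `|b (k%:R / n%:R + v) - b (k%:R / n%:R)| <= eps.
  by move=> /andP[v0 vu]; apply: osc; rewrite v0 (le_trans vu).
have := ou_step cb xE lamN0 t0 u0 oscu; rewrite mulNr.
have bu := osc u; rewrite u0 un in bu; have {}bu := bu isT.
move: (x _) (x _) (b _ - _) bu => z y w bu.
have e1 : expR (- (lam * u)) <= 1 by rewrite -expR0 ler_expR oppr_le0 mulr_ge0// ltW.
have ea : a n <= expR (- (lam * u)) by rewrite ler_expR lerN2 ler_pM2l.
have a0 := ar_coef_gt0 lam n.
rewrite [`|expR _ - 1|]distrC (ger0_norm (_ : 0 <= 1 - _)) ?subr_ge0// => h.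
set e := expR _ in e1 ea h.
have e0 : 0 <= e by exact: expR_ge0.
have {}h : `|y - e * z - w| <= eps.
  by apply: (le_trans h); rewrite ler_piMr// gerBl.
have h2 : `|y - e * z| <= 2 * eps.
  by have := lerB_dist (y - e * z) w; lra.
have ez : `|e * z| = e * `|z| by rewrite normrM (ger0_norm e0).
have ez1 : e * `|z| <= `|z| by rewrite ler_piMl.
have ez2 : a n * `|z| <= e * `|z| by rewrite ler_wpM2r.
have := lerB_dist y (e * z); have := lerB_dist (e * z) y; rewrite distrC ez.
by clear -ez1 ez2 h2; move=> h3 h4; split; lra.
Qed.

(** Errors do not accumulate: each step multiplies the old error by [a n] and adds at most eps (1 -
    a_n), for which eps is a fixed point. *)
Lemma ou_grid_scheme n N (eps : R) : (0 < n)%N -> 0 <= eps ->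
  (forall k u, (k < N)%N -> 0 <= u <= n%:R^-1 ->
    `|b (k%:R / n%:R + u) - b (k%:R / n%:R)| <= eps) ->
  forall k, (k <= N)%N -> `|xg n k - (a n ^+ k * x 0 + Y n k)| <= eps.
Proof.
move=> n0 eps0 osc; have a1 := ar_coef_lt1 lam0 n0; have a0 := ar_coef_gt0 lam n.
elim=> [_|k IH kN]; first by rewrite mul0r expr0 mul1r addr0 subrr normr0.
have h := ou_grid_step n0 (fun u => osc k u kN).
have {}IH := IH (ltnW kN); rewrite /= exprS.
move: (xg n k) (xg n k.+1) (a n ^+ k) (Y n k) (increments b n k) IH h => y z e w v IH h.
have -> : z - (a n * e * x 0 + (a n * w + v)) =
   a n * (y - (e * x 0 + w)) + (z - a n * y - v) by ring.
apply: (le_trans (ler_normD _ _)); rewrite normrM (gtr0_norm a0).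
have := ler_wpM2l (ltW a0) IH.
lra.
Qed.

(** The geometric sum is O(n), against at least n^2 cells. *)
Lemma exp_weights_mean p : (0 < p)%N -> forall eps : R, 0 < eps ->
  \forall n \near \oo, (n ^ p.+1)%:R^-1 * \sum_(k < n ^ p.+1) (a n ^+ k * `|x 0|) ^+ 2 <= eps.
Proof.
move=> p0 eps eps0; set K := (1 + lam) / lam * x 0 ^+ 2 / eps.
near=> n; have n0 : (0 < n)%N by near: n; exact: nbhs_infty_gt.
have n0R : 0 < n%:R :> R by rewrite ltr0n.
have a1 := ar_coef_lt1 lam0 n0; have a0 := ar_coef_gt0 lam n.
have a1' : 0 < 1 - a n by rewrite subr_gt0.
have Kn : K <= n%:R by near: n; exact: nbhs_infty_ger.
have Np : 0 < (n ^ p.+1)%:R :> R by rewrite ltr0n expn_gt0 n0.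
rewrite mulrC ler_pdivrMr//.
have s1 N : \sum_(k < N) (a n ^+ k * `|x 0|) ^+ 2 <= (1 - a n)^-1 * x 0 ^+ 2.
  apply: (@le_trans _ _ (\sum_(k < N) a n ^+ k * x 0 ^+ 2)).
    apply: ler_sum => k _; rewrite exprMn real_normK ?num_real// ler_wpM2r ?sqr_ge0//.
    by rewrite expr2 ler_piMl ?exprn_ge0 ?(ltW a0)// exprn_ile1 ?ltW.
  rewrite -mulr_suml ler_wpM2r ?sqr_ge0// -[leRHS]mul1r ler_pdivlMr//.
  suff -> : (\sum_(k < N) a n ^+ k) * (1 - a n) = 1 - a n ^+ N.
    by rewrite gerBl exprn_ge0// ltW.
  by rewrite mulrC -opprB mulNr -subrX1 opprB.
apply: (le_trans (s1 _)).
apply: (@le_trans _ _ ((1 + lam) / lam * n%:R * x 0 ^+ 2)).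
  by rewrite ler_wpM2r ?sqr_ge0// ar_coef_gap.
have -> : (1 + lam) / lam * n%:R * x 0 ^+ 2 = eps * (K * n%:R).
  by rewrite /K; field; rewrite !gt_eqF.
rewrite ler_pM2l// (@le_trans _ _ (n%:R * n%:R))// ?ler_wpM2r//.
by rewrite -natrM ler_nat mulnn leq_pexp2l.
Unshelve. all: by end_near. Qed.

Lemma grid_scheme_mean p : (0 < p)%N -> small_oscillation p b ->
  let N n := (n ^ p.+1)%N in
  eventually_dominated (mean_sqr (fun n k => xg n k) N) (mean_sqr (fun n => Y n) N) /\
  eventually_dominated (mean_sqr (fun n => Y n) N) (mean_sqr (fun n k => xg n k) N).
Proof.
move=> p0 osc N.
have H (eps : R) : 0 < eps -> \forall n \near \oo, exists r : nat -> R,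
    (forall k, (k < N n)%N -> `|xg n k - Y n k| <= r k) /\
    (N n)%:R^-1 * \sum_(k < N n) r k ^+ 2 <= eps.
  move=> eps0; pose e := Num.sqrt eps / 2.
  have e0 : 0 < e by rewrite divr_gt0// sqrtr_gt0.
  have eE : e ^+ 2 = eps / 4 by rewrite expr_div_n sqr_sqrtr ?ltW//; congr (_ / _); ring.
  have [n0 oscn] := osc e e0.
  near=> n; have n1 : (0 < n)%N by near: n; exact: nbhs_infty_gt.
  have nn0 : (n0 <= n)%N by near: n; exact: nbhs_infty_ge.
  have w4 : (n ^ p.+1)%:R^-1 * \sum_(k < n ^ p.+1) (a n ^+ k * `|x 0|) ^+ 2 <= eps / 4.
    by near: n; apply: exp_weights_mean => //; rewrite divr_gt0.
  have Np : 0 < (n ^ p.+1)%:R :> R by rewrite ltr0n expn_gt0 n1.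
  exists (fun k => e + a n ^+ k * `|x 0|); split.
    move=> k kN; have := ou_grid_scheme n1 (ltW e0) (oscn n nn0) (ltnW kN).
    move=> h; have := ler_normD (xg n k - (a n ^+ k * x 0 + Y n k)) (a n ^+ k * x 0).
    rewrite (_ : _ + _ * x 0 = xg n k - Y n k); last by ring.
    move=> /le_trans; apply.
    by rewrite lerD// normrM ger0_norm// exprn_ge0// ltW// ar_coef_gt0.
  apply: (@le_trans _ _ (2 * e ^+ 2 + 2 * ((n ^ p.+1)%:R^-1 * \sum_(k < n ^ p.+1) (a n ^+ k * `|x 0|) ^+ 2))).
    set S := (X in _ <= _ + 2 * (_ * X)); set M := (n ^ p.+1)%:R.
    have -> : 2 * e ^+ 2 + 2 * (M^-1 * S) = M^-1 * (2 * e ^+ 2 * M + 2 * S).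
      by field; rewrite gt_eqF.
    rewrite ler_wpM2l ?invr_ge0 ?(ltW Np)// /S mulr_sumr.
    rewrite [X in X + _](_ : _ = \sum_(k < n ^ p.+1) (2 * e ^+ 2)); last first.
      by rewrite sumr_const card_ord -[RHS]mulr_natr.
    rewrite -big_split/=; apply: ler_sum => k _; rewrite -subr_ge0.
    move: (a n ^+ k * _) => v; rewrite [leRHS](_ : _ = (e - v) ^+ 2) ?sqr_ge0//; ring.
  by rewrite eE; lra.
split; apply: mean_sqr_dominated => eps eps0; near=> n.
- have [r [h1 h2]] : exists r : nat -> R,
    (forall k, (k < N n)%N -> `|xg n k - Y n k| <= r k) /\
    (N n)%:R^-1 * \sum_(k < N n) r k ^+ 2 <= eps by near: n; exact: H.
  exists r; split=> // k kN; rewrite -lerBlDl; exact: le_trans (lerB_dist _ _) (h1 k kN).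
- have [r [h1 h2]] : exists r : nat -> R,
    (forall k, (k < N n)%N -> `|xg n k - Y n k| <= r k) /\
    (N n)%:R^-1 * \sum_(k < N n) r k ^+ 2 <= eps by near: n; exact: H.
  exists r; split=> // k kN; rewrite -lerBlDl; apply: le_trans (h1 k kN).
  by rewrite distrC lerB_dist.
Unshelve. all: by end_near. Qed.

Lemma grid_integral_mean p (J : R -> R) : (0 < p)%N -> small_oscillation p b ->
  J 0 = 0 -> (forall s t M : R, 0 <= s -> s <= t ->
    ((forall u, s <= u <= t -> x u ^+ 2 <= M) -> J t - J s <= M * (t - s)) /\
    ((forall u, s <= u <= t -> M <= x u ^+ 2) -> M * (t - s) <= J t - J s)) ->
  let N n := (n ^ p.+1)%N in
  eventually_dominated (mean_sqr (fun n k => xg n k) N) (fun n => J (n ^ p)%:R / (n ^ p)%:R) /\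
  eventually_dominated (fun n => J (n ^ p)%:R / (n ^ p)%:R) (mean_sqr (fun n k => xg n k) N).
Proof.
move=> p0 osc J0 JE N.
have Jm (s t : R) : 0 <= s -> s <= t -> 0 <= J t - J s.
  move=> s0 st; have [_] := JE s t 0 s0 st; rewrite mul0r; apply => u _.
  exact: sqr_ge0.
(* The root mean square of the path over a cell: the time average of X^2 becomes a [mean_sqr], to
   which the perturbation lemma applies. *)
pose u n k := Num.sqrt (n%:R * (J (k.+1%:R / n%:R) - J (k%:R / n%:R))).
have grid n k : (0 < n)%N -> [/\ 0 <= k%:R / n%:R :> R,
     k.+1%:R / n%:R = k%:R / n%:R + n%:R^-1 :> R & k%:R / n%:R <= k.+1%:R / n%:R :> R].
  by move=> n0; rewrite -natr1 mulrDl mul1r lerDl divr_ge0 ?invr_ge0.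
have u2 n k : u n k ^+ 2 = n%:R * (J (k.+1%:R / n%:R) - J (k%:R / n%:R)).
  rewrite sqr_sqrtr//; have [->|n0] := posnP n; first by rewrite mul0r.
  by have [k0 _ kk] := grid n k n0; rewrite mulr_ge0// Jm.
have uJ n : mean_sqr u N n = J (n ^ p)%:R / (n ^ p)%:R.
  have [->|n0] := posnP n.
    by rewrite /mean_sqr /N exp0n// big_ord0 mulr0 exp0n// !mulr0n invr0 mulr0.
  have n0R : n%:R != 0 :> R by rewrite pnatr_eq0 -lt0n.
  rewrite /mean_sqr; under eq_bigr do rewrite u2.
  rewrite -mulr_sumr -(big_mkord xpredT (fun k => J (k.+1%:R / n%:R) - J (k%:R / n%:R))).
  rewrite (@telescope_sumr _ 0 _ (fun k => J (k%:R / n%:R)))// mul0r J0 subr0 /N expnSr !natrM mulfK//.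
  by rewrite invfM mulrA mulfVK// mulrC.
have bounds n (e : R) k : (0 < n)%N -> 0 <= e ->
   (forall v : R, 0 <= v <= n%:R^-1 -> `|b (k%:R / n%:R + v) - b (k%:R / n%:R)| <= e) ->
   u n k <= `|xg n k| + 2 * e /\ a n * `|xg n k| <= u n k + 2 * e.
  move=> n0 e0 osck; have [k0 kE kk] := grid n k n0.
  have n0R : 0 < n%:R :> R by rewrite ltr0n.
  have inv v : k%:R / n%:R <= v <= k.+1%:R / n%:R ->
      `|x v| <= `|xg n k| + 2 * e /\ a n * `|xg n k| <= `|x v| + 2 * e.
    rewrite kE => /andP[v1 v2]; have := @ou_cell_bounds n k e (v - k%:R / n%:R) n0.
    rewrite (_ : k%:R / n%:R + (v - _) = v); last by rewrite addrC subrK.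
    by apply => //; rewrite subr_ge0 v1/= lerBlDl.
  have dt : k.+1%:R / n%:R - k%:R / n%:R = n%:R^-1 :> R by rewrite kE addrAC subrr add0r.
  split.
    rewrite -[leRHS]ger0_norm ?addr_ge0 ?mulr_ge0// -sqrtr_sqr ler_sqrt ?sqr_ge0//.
    have [+ _] := JE _ _ ((`|xg n k| + 2 * e) ^+ 2) k0 kk.
    rewrite dt => JJ; rewrite [leLHS]mulrC -ler_pdivlMr//; apply: JJ => v /inv[h _].
    by rewrite -(real_normK (num_real (x v))) lerXn2r ?nnegrE// addr_ge0 ?mulr_ge0.
  rewrite -lerBlDr; have [h|h] := leP (a n * `|xg n k|) (2 * e).
    by rewrite (@le_trans _ _ 0) ?subr_le0// sqrtr_ge0.
  have h0 : 0 <= a n * `|xg n k| - 2 * e by rewrite subr_ge0 ltW.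
  rewrite -[leLHS]ger0_norm// -sqrtr_sqr ler_sqrt ?mulr_ge0 ?Jm//.
  have [_ +] := JE _ _ ((a n * `|xg n k| - 2 * e) ^+ 2) k0 kk.
  rewrite dt => JJ; rewrite [leRHS]mulrC -ler_pdivrMr//; apply: JJ => v /inv[_ h1].
  by rewrite -(real_normK (num_real (x v))) lerXn2r ?nnegrE// lerBlDr.
have consts (e : R) n : (0 < n)%N -> (N n)%:R^-1 * \sum_(k < N n) e ^+ 2 = e ^+ 2.
  move=> n0; rewrite sumr_const card_ord -[X in _ * X]mulr_natr mulrCA mulVf ?mulr1//.
  by rewrite pnatr_eq0 -lt0n expn_gt0 n0.
rewrite -(funext uJ); split.
(* The lower cell bound controls only [a n] times the grid value; the intermediate sequence carries
   the inverse factor, which tends to 1. *)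
- apply: (@eventually_dominated_trans _ _ (mean_sqr (fun n k => (a n)^-1 * u n k) N)).
  + exact: mean_sqr_ge0.
  + apply: mean_sqr_dominated => eps eps0; pose e := Num.sqrt eps / (2 * expR lam).
    have E0 := expR_gt0 lam.
    have e0 : 0 < e by rewrite divr_gt0 ?sqrtr_gt0// mulr_gt0.
    have [n0 oscn] := osc e e0.
    near=> n; have n1 : (0 < n)%N by near: n; exact: nbhs_infty_gt.
    have nn0 : (n0 <= n)%N by near: n; exact: nbhs_infty_ge.
    have a0 := ar_coef_gt0 lam n.
    have al : (a n)^-1 <= expR lam.
      rewrite /ar_coef expRN invrK ler_expR ler_piMr ?(ltW lam0)//.
      by rewrite invf_le1 ?ltr0n// ler1n.
    exists (fun k => (a n)^-1 * (2 * e)); split.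
      move=> k kN; have [_] := bounds n e k n1 (ltW e0) (fun v => oscn n nn0 k v kN).
      rewrite [`|_ * u n k|]normrM ![`|u _ _|]ger0_norm ?sqrtr_ge0// ger0_norm ?invr_ge0 ?(ltW a0)//.
      by rewrite -mulrDr ler_pdivlMl.
    rewrite consts// -[leRHS](sqr_sqrtr (ltW eps0)).
    rewrite lerXn2r ?nnegrE ?sqrtr_ge0 ?mulr_ge0 ?invr_ge0 ?(ltW a0) ?(ltW e0)//.
    rewrite (@le_trans _ _ (expR lam * (2 * e)))// ?ler_wpM2r ?mulr_ge0 ?(ltW e0)//.
    rewrite le_eqVlt; apply/orP; left; apply/eqP; rewrite /e; field; rewrite gt_eqF//.
  + rewrite (_ : mean_sqr _ _ = fun n => (a n)^-1 ^+ 2 * mean_sqr u N n); last first.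
      apply/funext => n; rewrite /mean_sqr mulrCA; congr (_ * _).
      by rewrite mulr_sumr; apply: eq_bigr => k _; rewrite exprMn.
    apply: dominated_scale; first exact: mean_sqr_ge0.
    rewrite (_ : (fun n => (a n)^-1 ^+ 2) = expR \o (fun n => lam * 2 / n%:R)); last first.
      apply/funext => n; rewrite /ar_coef expRN invrK -expRM_natl /=; congr expR.
      by rewrite mulrCA mulrA.
    rewrite -[X in _ --> X]expR0; apply: continuous_cvg; first exact: continuous_expR.
    exact: cvg_div_nat0.
- apply: mean_sqr_dominated => eps eps0; pose e := Num.sqrt eps / 2.
  have e0 : 0 < e by rewrite divr_gt0// sqrtr_gt0.
  have [n0 oscn] := osc e e0.
  near=> n; have n1 : (0 < n)%N by near: n; exact: nbhs_infty_gt.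
  have nn0 : (n0 <= n)%N by near: n; exact: nbhs_infty_ge.
  exists (fun k => 2 * e); split.
    move=> k kN; have [+ _] := bounds n e k n1 (ltW e0) (fun v => oscn n nn0 k v kN).
    by rewrite [`|u _ _|]ger0_norm ?sqrtr_ge0.
  by rewrite consts// /e mulrC divfK// sqr_sqrtr// ltW.
Unshelve. all: by end_near. Qed.

Lemma ou_discrete_mean_cvg M m (c : R) : (1 < M)%N -> (1 < m)%N ->
  small_oscillation M.-1 b -> small_oscillation m.-1 b -> 0 <= c ->
  mean_sqr (fun n => Y n) (fun n => n ^ M)%N n @[n --> \oo] --> c ->
  mean_sqr (fun n k => xg n k) (fun n => n ^ m)%N n @[n --> \oo] --> c.
Proof.
case: M => // M M0; case: m => // m m0 /= oscM oscm c0 Yc.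
have [J [J0 JE]] := ou_primitive_sqr cb xE.
have Jm (s t : R) : 0 <= s -> s <= t -> J s <= J t.
  move=> s0 st; have [_] := JE s t 0 s0 st; rewrite mul0r subr_ge0; apply => u _.
  exact: sqr_ge0.
have JT0 p n : 0 <= J (n ^ p)%:R / (n ^ p)%:R.
  by rewrite divr_ge0// -J0 Jm.
have [YC CY] := dominated_of_cvg c0 Yc.
have {}CY := CY (mean_sqr_ge0 _ _).
have [XY YX] := grid_scheme_mean M0 oscM.
have [XJ JX] := grid_integral_mean M0 oscM J0 JE.
have JM : J (n ^ M)%:R / (n ^ M)%:R @[n --> \oo] --> c.
  apply: cvg_of_dominated => //.
    apply: (eventually_dominated_trans _ JX); first by move=> n; exact: c0.
    by apply: (eventually_dominated_trans _ XY) => // n; exact: c0.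
  apply: (eventually_dominated_trans _ CY) => //.
  by apply: (eventually_dominated_trans _ YX).
have Jc : J n%:R / n%:R @[n --> \oo] --> c := cvg_mean_interpolation M0 c0 Jm J0 JM.
have Jmc : J (n ^ m)%:R / (n ^ m)%:R @[n --> \oo] --> c.
  apply: (cvg_comp (fun n => n ^ m)%N (fun t : nat => J t%:R / t%:R) _ Jc).
  exact: cvg_expn_infty.
have [Jmc1 Jmc2] := dominated_of_cvg c0 Jmc.
have {}Jmc2 := Jmc2 (JT0 m).
have [XJm JXm] := grid_integral_mean m0 oscm J0 JE.
apply: cvg_of_dominated => //; first exact: mean_sqr_ge0.
  by apply: (eventually_dominated_trans _ XJm).
apply: (eventually_dominated_trans _ Jmc2) => //; exact: mean_sqr_ge0.
Qed.

End ou_ergodic.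

Lemma ae_and d (T : measurableType d) (R : realType) (P : probability T R) (A C : T -> Prop) :
  {ae P, forall w, A w} -> {ae P, forall w, C w} -> {ae P, forall w, A w /\ C w}.
Proof. by move=> PA PC; apply: filterS2 PA PC. Qed.

Section decaying_drift.
Context d (T : measurableType d) (R : realType) (P : probability T R).
Context (H : R) (B X : R -> {RV P >-> R}) (m : nat) (x0 theta : R).
Hypothesis H01 : 0 < H < 1.
Hypothesis m_gt1 : (1 < m)%N.
Hypothesis fbmB : fractional_brownian_motion H B.
Hypothesis fouX : fractional_ornstein_uhlenbeck x0 theta B X.
Hypothesis theta_lt0 : theta < 0.

Lemma theta3_consistent : strongly_consistent P (theta3 H X m) theta.
Proof.
have /andP[H0 _] := H01; have al0 : 0 < 2 * H by rewrite mulr_gt0.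
pose lam := - theta; have lam0 : 0 < lam by rewrite oppr_gt0.
have [M0 HM] := scheme_lln H01 fbmB lam0.
pose M := maxn M0 2; have M1 : (1 < M)%N by rewrite leq_max orbT.
have {}HM := HM M (leq_maxl _ _).
have [_ _ _ cB] := fbmB.
have oM := fbm_small_oscillation H01 fbmB M.-1.
have om := fbm_small_oscillation H01 fbmB m.-1.
have A := ae_and (ae_and HM cB) (ae_and (ae_and oM om) fouX).
rewrite /strongly_consistent; apply: filterS A => w [[Yc cb] [[oscM oscm] xE]].
have xE' (t : R) : 0 <= t -> lebesgue_measure.-integrable `[0, t] (EFin \o X ^~ w) /\
    X t w = x0 + - lam * (\int[lebesgue_measure]_(s in `[0, t]) X s w) + B t w.
  by rewrite opprK; exact: xE.
have c0 : 0 < ou_limit H lam.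
  by rewrite /ou_limit !mulr_gt0 ?invr_gt0 ?powR_gt0 ?Gamma_gt0.
have Xc := ou_discrete_mean_cvg lam0 cb xE' M1 m_gt1 oscM oscm (ltW c0) Yc.
have HG : H * Gamma (2 * H) != 0 by rewrite gt_eqF// mulr_gt0// Gamma_gt0.
(* [ou_limit] equals H Gamma(2H) lam^(-2H). After normalization the limit is positive, a point of
   continuity of the power -1/(2H). *)
have lim1 : (H * Gamma (2 * H))^-1 * mean_sqr (fun n k => X (k%:R / n%:R) w) (fun n => n ^ m)%N n
    @[n --> \oo] --> lam `^ (- (2 * H)).
  have -> : lam `^ (- (2 * H)) = (H * Gamma (2 * H))^-1 * ou_limit H lam.
    by rewrite /ou_limit; field; rewrite !gt_eqF// Gamma_gt0.
  by apply: cvgM => //; exact: cvg_cst.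
have pc := @powR_continuous R (- (2 * H)^-1) _ (powR_gt0 (- (2 * H)) lam0).
have E n : theta3 H X m n w = - ((H * Gamma (2 * H))^-1 *
   mean_sqr (fun n k => X (k%:R / n%:R) w) (fun n => (n ^ m)%N) n) `^ (- (2 * H)^-1).
  by rewrite /theta3 /mean_sqr /sum_sq_obs big_mkord (invfM (H * _)) mulrA.
rewrite (funext E) [X in _ --> X](_ : _ = - (lam `^ (- (2 * H)) `^ (- (2 * H)^-1))).
  by apply: cvgN; exact: continuous_cvg pc lim1.
by rewrite -powRrM mulrNN mulfV ?gt_eqF// powRr1 ?(ltW lam0)// opprK.
Qed.

End decaying_drift.

(** * Positive drift *)

(** Adding or subtracting the geometric tail C r^n / (1 - r) makes the sequence nonincreasing or
    nondecreasing, which gives the limit together with its rate. *)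
Lemma geometric_limit (R : realType) (u : nat -> R) (C r : R) : 0 <= r < 1 ->
  (forall n, `|u n.+1 - u n| <= C * r ^+ n) ->
  exists l, forall n, `|u n - l| <= C / (1 - r) * r ^+ n.
Proof.
move=> /andP[r0 r1] Hu; have r1' : 0 < 1 - r by rewrite subr_gt0.
pose K := C / (1 - r).
have KE : K * (1 - r) = C by rewrite /K divfK// gt_eqF.
have C0 : 0 <= C by have := le_trans (normr_ge0 _) (Hu 0%N); rewrite mulr1.
have K0 : 0 <= K by rewrite divr_ge0// ltW.
have st n : u n.+1 + K * r ^+ n.+1 <= u n + K * r ^+ n /\
            u n - K * r ^+ n <= u n.+1 - K * r ^+ n.+1.
  have := Hu n; rewrite ler_norml -KE exprS; move: (r ^+ n) => z /andP[h1 h2].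
  by split; lra.
have hz : nonincreasing_seq (fun n => u n + K * r ^+ n).
  by apply/nonincreasing_seqP => n; have [] := st n.
have hv : nondecreasing_seq (fun n => u n - K * r ^+ n).
  by apply/nondecreasing_seqP => n; have [] := st n.
have vz n k : u n - K * r ^+ n <= u k + K * r ^+ k.
  apply: (@le_trans _ _ (u (maxn n k) - K * r ^+ maxn n k)); first exact/hv/leq_maxl.
  apply: (@le_trans _ _ (u (maxn n k) + K * r ^+ maxn n k)); last exact/hz/leq_maxr.
  by rewrite lerD2l ge0_cp// mulr_ge0// exprn_ge0.
have cz : cvgn (fun n => u n + K * r ^+ n).
  apply: nonincreasing_is_cvgn => //; exists (u 0%N - K * r ^+ 0) => _ [n _ <-].
  exact: vz.
exists (limn (fun n => u n + K * r ^+ n)) => n.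
rewrite ler_distlC; apply/andP; split.
  by apply: limr_ge => //; apply: nearW => k; exact: vz.
exact: nonincreasing_cvgn_ge.
Qed.

(** * Convergence of the discounted path *)

Section explosive_path.
Context (R : realType).
Local Notation mu := (@lebesgue_measure R).
Context (theta x0 : R) (b x : R -> R).
Hypothesis theta0 : 0 < theta.
Hypothesis cb : continuous b.
Hypothesis xE : forall t : R, 0 <= t -> mu.-integrable `[0, t] (EFin \o x) /\
  x t = x0 + theta * (\int[mu]_(s in `[0, t]) x s) + b t.

Let y (t : R) := expR (- (theta * t)) * x t.

Lemma discounted_step (t h eps : R) : 0 <= t -> 0 <= h ->
  (forall u : R, 0 <= u <= h -> `|b (t + u) - b t| <= eps) ->
  `|y (t + h) - y t - expR (- (theta * (t + h))) * (b (t + h) - b t)|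
    <= eps * (expR (- (theta * t)) - expR (- (theta * (t + h)))).
Proof.
move=> t0 h0 osc; have thN0 : theta != 0 by rewrite gt_eqF.
have := ou_step cb xE thN0 t0 h0 osc.
have e1 : 0 <= expR (theta * h) - 1 by rewrite subr_ge0 -expR0 ler_expR mulr_ge0// ltW.
have E : expR (- (theta * t)) = expR (- (theta * (t + h))) * expR (theta * h).
  by rewrite -expRD; congr expR; ring.
rewrite (ger0_norm e1) /y E; set e := expR (- _); have e0 : 0 < e by exact: expR_gt0.
move=> hs; rewrite [leRHS](_ : _ = e * (eps * (expR (theta * h) - 1))); last by ring.
rewrite [X in `|X|](_ : _ = e * (x (t + h) - expR (theta * h) * x t - (b (t + h) - b t))); last by ring.
by rewrite normrM (gtr0_norm e0) ler_pM2l.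
Qed.

Lemma discounted_increment (t h eps : R) : 0 <= t -> 0 <= h ->
  (forall u : R, 0 <= u <= h -> `|b (t + u) - b t| <= eps) ->
  `|y (t + h) - y t| <= eps * expR (- (theta * t)).
Proof.
move=> t0 h0 osc; have := discounted_step t0 h0 osc.
have := osc h; rewrite h0 lexx => /(_ isT).
set e' := expR (- (theta * (t + h))); set e := expR _ => h1 h2.
have e'0 : 0 < e' by exact: expR_gt0.
have h3 : `|e' * (b (t + h) - b t)| <= e' * eps by rewrite normrM (gtr0_norm e'0) ler_pM2l.
have := lerB_dist (y (t + h) - y t) (e' * (b (t + h) - b t)).
lra.
Qed.

Hypothesis osc1 : small_oscillation 1 b.

(** At mesh 1/(K + 1) the unit interval starting at K consists of K + 1 cells of the window, each of
    oscillation at most 1. Linear growth is enough against an exponential discount. *)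
Lemma unit_oscillation : exists n0, forall K (u : R), (n0 <= K)%N -> 0 <= u <= 1 ->
  `|b (K%:R + u) - b K%:R| <= K.+1%:R.
Proof.
have [n0 osc] := osc1 ltr01; exists n0 => K u nK /andP[u0 u1].
have nR : 0 < K.+1%:R :> R by [].
have inv i (v : R) : (i < K.+1)%N -> 0 <= v <= K.+1%:R^-1 ->
    `|b (K%:R + i%:R / K.+1%:R + v) - b (K%:R + i%:R / K.+1%:R)| <= 1.
  move=> iK hv; have := osc K.+1 (leqW nK) (K * K.+1 + i)%N v _ hv.
  rewrite natrD natrM mulrDl mulfK ?gt_eqF//; apply.
  by rewrite expnS expn1; lia.
have grid i : (i <= K.+1)%N -> `|b (K%:R + i%:R / K.+1%:R) - b K%:R| <= i%:R.
  elim: i => [_|i IH iK]; first by rewrite mul0r addr0 subrr normr0.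
  have := inv i K.+1%:R^-1 iK; rewrite lexx invr_ge0 ler0n => /(_ isT).
  rewrite -addrA -[X in _ + (_ + X)]mul1r -mulrDl natr1 => h.
  have := IH (ltnW iK); have := ler_distD (b (K%:R + i%:R / K.+1%:R)) (b (K%:R + i.+1%:R / K.+1%:R)) (b K%:R).
  by move=> h1 h2; apply: (le_trans h1); apply: (le_trans (lerD h h2)); rewrite addrC natr1.
have un0 : 0 <= u * K.+1%:R by rewrite mulr_ge0.
have /andP[h1 h2] := truncn_itv un0; set i := Num.truncn _ in h1 h2.
have [iK|iK] := ltnP i K.+1; last first.
  have -> : u = K.+1%:R / K.+1%:R.
    rewrite divff ?gt_eqF//; apply/eqP; rewrite eq_le u1 -(@ler_pM2r _ K.+1%:R)// mul1r.
    by rewrite (le_trans _ h1)// ler_nat.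
  exact: grid.
have ui : u = i%:R / K.+1%:R + (u - i%:R / K.+1%:R) by rewrite addrC subrK.
have := inv i (u - i%:R / K.+1%:R) iK; rewrite -addrA -ui.
have hv : 0 <= u - i%:R / K.+1%:R <= K.+1%:R^-1.
  rewrite subr_ge0 ler_pdivrMr// h1/= lerBlDr -[X in X + _]mul1r -mulrDl ler_pdivlMr//.
  by rewrite addrC natr1 ltW.
move=> /(_ hv) h3; have := grid i (ltnW iK).
have := ler_distD (b (K%:R + i%:R / K.+1%:R)) (b (K%:R + u)) (b K%:R).
have : i%:R + 1 <= K.+1%:R :> R by rewrite natr1 ler_nat.
lra.
Qed.

(** Half of the discount absorbs the linear oscillation over unit intervals, and the other half
    leaves the ratio r = exp(-theta/2) for the geometric limit. *)
Lemma discounted_limit : exists l : R, forall eps : R, 0 < eps ->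
  exists K : nat, forall t : R, K%:R <= t -> `|y t - l| <= eps.
Proof.
have [n0 osc] := unit_oscillation; have [C1 C10 HC1] := exp_dominates_pow R 1.
pose r := expR (- (theta / 2)); have th2 : 0 < theta / 2 by rewrite divr_gt0.
have r1 : r < 1 by rewrite -expR0 ltr_expR oppr_lt0.
have r0 : 0 < r by exact: expR_gt0.
pose C := C1 / (theta / 2) / r; have C0 : 0 < C by rewrite !divr_gt0.
have step K (h : R) : (n0 <= K)%N -> 0 <= h <= 1 -> `|y (K%:R + h) - y K%:R| <= C * r ^+ K.
  move=> nK /andP[h0 h1].
  have oscK (u : R) : 0 <= u <= h -> `|b (K%:R + u) - b K%:R| <= K.+1%:R.
    by move=> /andP[u0 uh]; apply: osc; rewrite // u0 (le_trans uh).
  apply: (le_trans (discounted_increment (ler0n _ K) h0 oscK)).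
  have -> : expR (- (theta * K%:R)) = r ^+ K * r ^+ K.
    by rewrite /r -expRM_natl -expRD; congr expR; field.
  rewrite mulrA ler_pM2r ?exprn_gt0//.
  have hC := HC1 _ (mulr_ge0 (ltW th2) (ler0n R K.+1)).
  rewrite /C ler_pdivlMr// ler_pdivlMr//; apply: le_trans hC.
  have -> : expR (- (theta / 2 * K.+1%:R)) = r ^+ K.+1.
    by rewrite /r -expRM_natl; congr expR; ring.
  by rewrite expr1 exprS le_eqVlt; apply/orP; left; apply/eqP; ring.
have [l Hl] : exists l, forall n, `|y (n0 + n)%:R - l| <= C / (1 - r) * r ^+ n.
  apply: geometric_limit; first by rewrite (ltW r0).
  move=> n; rewrite addnS -natr1; apply: (le_trans (step _ 1 (leq_addr _ _) _)).
    by rewrite ler01 lexx.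
  by rewrite ler_pM2l// exprD ler_piMl ?exprn_ge0 ?(ltW r0)// exprn_ile1 ?ltW.
exists l => eps eps0; pose D := C + C / (1 - r).
have D0 : 0 < D by rewrite addr_gt0// divr_gt0// subr_gt0.
have rc : (r ^+ n : R) @[n --> \oo] --> (0 : R).
  by apply: cvg_expr; rewrite gtr0_norm.
have [N _ HN] : \forall n \near \oo, r ^+ n <= eps / D.
  by apply: (cvgr_le _ rc); rewrite divr_gt0.
exists (n0 + N)%N => t Kt; have t0 : 0 <= t by exact: le_trans Kt.
have /andP[h1 h2] := truncn_itv t0; set i := Num.truncn _ in h1 h2.
have iN : (n0 + N <= i)%N by rewrite -ltnS -(@ltr_nat R) (le_lt_trans Kt).
have i0 : (n0 <= i)%N by rewrite (leq_trans _ iN)// leq_addr.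
have s1 : `|y t - y i%:R| <= C * r ^+ i.
  rewrite (_ : t = i%:R + (t - i%:R)); last by rewrite addrC subrK.
  by apply: step => //; rewrite subr_ge0 h1 lerBlDr addrC natr1 ltW.
have := Hl (i - n0)%N; rewrite subnKC// => s2.
have s3 : r ^+ i <= r ^+ (i - n0).
  by rewrite ler_wiXn2l ?(ltW r0) ?(ltW r1)// leq_subr.
have s4 : r ^+ (i - n0) <= eps / D by apply: HN => /=; rewrite leq_subRL.
have := ler_distD (y i%:R) (y t) l.
have s5 : C * r ^+ i <= C * r ^+ (i - n0) by rewrite ler_pM2l.
have s6 : D * r ^+ (i - n0) <= eps by rewrite mulrC -ler_pdivlMr.
by rewrite /D mulrDl in s6; lra.
Qed.
(** Riemann-Stieltjes sum, with right endpoint weights, of exp(-theta s) against the noise. *)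
Definition discounted_noise (n N : nat) : R :=
  \sum_(j < N) expR (- (theta * (j.+1%:R / n%:R))) * increments b n j.

(** The step errors are eps times differences of the discount; they telescope to at most eps
    whatever the number of cells. *)
Lemma discounted_noise_error n N (eps : R) : (0 < n)%N -> 0 <= eps ->
  (forall k u, (k < N)%N -> 0 <= u <= n%:R^-1 ->
    `|b (k%:R / n%:R + u) - b (k%:R / n%:R)| <= eps) ->
  `|y (N%:R / n%:R) - (x 0 + discounted_noise n N)| <= eps.
Proof.
move=> n0 eps0 osc; have n0R : 0 < n%:R :> R by rewrite ltr0n.
pose q k := expR (- (theta * (k%:R / n%:R))).
suff H k : (k <= N)%N -> `|y (k%:R / n%:R) - (x 0 + discounted_noise n k)| <= eps * (1 - q k).
  apply: (le_trans (H N (leqnn N))); rewrite ler_piMr// gerBl; exact: expR_ge0.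
elim: k => [_|k IH kN].
  by rewrite /q /y /discounted_noise big_ord0 mul0r mulr0 oppr0 expR0 mul1r addr0 !subrr normr0 mulr0.
have k0 : 0 <= k%:R / n%:R :> R by rewrite divr_ge0.
have i0 : 0 <= n%:R^-1 :> R by rewrite invr_ge0.
have := discounted_step k0 i0 (fun u => osc k u kN).
have -> : k%:R / n%:R + n%:R^-1 = k.+1%:R / n%:R :> R by rewrite -natr1 mulrDl mul1r.
rewrite -/(increments b n k) -/(q k) -/(q k.+1) => h; have {}IH := IH (ltnW kN).
rewrite /discounted_noise big_ord_recr/= -/(q k.+1) -/(discounted_noise n k).
move: (y (k%:R / n%:R)) (y (k.+1%:R / n%:R)) (discounted_noise n k) (increments b n k) IH h => y1 y2 g i h1 h2.
have -> : y2 - (x 0 + (g + q k.+1 * i)) = (y1 - (x 0 + g)) + (y2 - y1 - q k.+1 * i) by ring.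
by apply: (le_trans (ler_normD _ _)); lra.
Qed.

Lemma discounted_noise_cvg (l : R) :
  (forall eps : R, 0 < eps -> exists K : nat, forall t : R, K%:R <= t -> `|y t - l| <= eps) ->
  x 0 + discounted_noise n (n ^ 2) @[n --> \oo] --> l.
Proof.
move=> yl; apply/cvgrPdist_le => eps eps0; have e2 : 0 < eps / 2 by rewrite divr_gt0.
have [K HK] := yl _ e2; have [n0 osc] := osc1 e2.
near=> n; have n1 : (0 < n)%N by near: n; exact: nbhs_infty_gt.
have nn0 : (n0 <= n)%N by near: n; exact: nbhs_infty_ge.
have nK : K%:R <= n%:R :> R by rewrite ler_nat; near: n; exact: nbhs_infty_ge.
have := discounted_noise_error n1 (ltW e2) (osc n nn0).
have -> : (n ^ 2)%:R / n%:R = n%:R :> R.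
  by rewrite expnS expn1 natrM mulfK// pnatr_eq0 -lt0n.
have := HK n%:R nK; rewrite distrC => h1 h2.
by have := ler_distD (y n%:R) l (x 0 + discounted_noise n (n ^ 2)); lra.
Unshelve. all: by end_near. Qed.

Lemma discounted_bounded (l : R) :
  (forall eps : R, 0 < eps -> exists K : nat, forall t : R, K%:R <= t -> `|y t - l| <= eps) ->
  exists2 A : R, 0 <= A & forall t : R, 0 <= t -> `|y t| <= A.
Proof.
move=> yl; have [K HK] := yl 1 ltr01.
have cf : {within `[0, K%:R], continuous (fun u : R => `|b u - b 0|)}.
  apply: continuous_subspaceT => u; apply: cvg_norm; apply: cvgB; [exact: cb|exact: cvg_cst].
have [c _ Hc] := EVT_max (ler0n R K) cf; set M := `|_| in Hc; have M0 : 0 <= M by exact: normr_ge0.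
exists (`|l| + 1 + `|x 0| + M); first by rewrite !addr_ge0.
move=> t t0; have [Kt|tK] := leP K%:R t.
  have := HK t Kt; have := lerB_dist (y t) l.
  by have := normr_ge0 (x 0); lra.
have osct (u : R) : 0 <= u <= t -> `|b (0 + u) - b 0| <= M.
  by move=> /andP[u0 ut]; rewrite add0r; apply: Hc; rewrite in_itv/= u0 (le_trans ut)// ltW.
have := discounted_increment (lexx 0) t0 osct.
rewrite add0r mulr0 oppr0 expR0 mulr1 {2}/y mulr0 oppr0 expR0 mul1r.
by have := lerB_dist (y t) (x 0); have := normr_ge0 l; lra.
Qed.

End explosive_path.

Lemma cvg_expR_slope (R : realType) (theta : R) : 0 < theta ->
  n%:R * ((ar_coef (2 * theta) n)^-1 - 1) / 2 @[n --> \oo] --> theta.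
Proof.
move=> theta0; pose g n := expR (2 * theta / n%:R).
have ag n : (ar_coef (2 * theta) n)^-1 = g n by rewrite /ar_coef expRN invrK.
have g1 : theta * g n @[n --> \oo] --> theta.
  have gc : (expR \o (fun n => 2 * theta / n%:R)) n @[n --> \oo] --> expR 0.
    exact: cvg_comp (cvg_div_nat0 (2 * theta)) (@continuous_expR R 0).
  rewrite expR0 in gc; rewrite -[X in _ --> X]mulr1.
  by apply: cvgM; [exact: cvg_cst|exact: gc].
apply: (squeeze_cvgr _ (cvg_cst theta) g1); near=> n.
have n0 : 0 < n%:R :> R by near: n; exact: nbhs_infty_gtr.
rewrite ag; have h1 := expR_ge1Dx (2 * theta / n%:R).
have g0 : 0 < g n by exact: expR_gt0.
have h2 : (1 - 2 * theta / n%:R) * g n <= 1.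
  by rewrite -ler_pdivlMr// mul1r -expRN expR_ge1Dx.
have e : 2 * theta = 2 * theta / n%:R * n%:R by rewrite divfK// gt_eqF.
rewrite -/(g n) in h1; move: (2 * theta / n%:R) e h1 h2 => h e h1 h2.
have {}h1 := ler_wpM2r (ltW n0) h1; have {}h2 := ler_wpM2r (ltW n0) h2.
apply/andP; split; rewrite ?ler_pdivlMr// ?ler_pdivrMr//.
  by lra.
rewrite [leRHS](_ : _ = 2 * theta * g n); last by ring.
by rewrite e; lra.
Unshelve. all: by end_near. Qed.

(** * Limit of the estimator along an explosive path *)

Section explosive_ratio.
Context (R : realType) (theta l : R) (x : R -> R).
Hypothesis theta0 : 0 < theta.
Hypothesis l0 : l != 0.
Let y (t : R) := expR (- (theta * t)) * x t.
Hypothesis yl : forall eps : R, 0 < eps ->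
  exists K : nat, forall t : R, K%:R <= t -> `|y t - l| <= eps.
Hypothesis yb : exists2 A : R, 0 <= A & forall t : R, 0 <= t -> `|y t| <= A.

Local Notation a := (ar_coef (2 * theta)).

Let v n k := y (k%:R / n%:R) ^+ 2.
Let W n N := \sum_(k < N) (a n)^-1 ^+ k.

Let th20 : 0 < 2 * theta. Proof. by rewrite mulr_gt0. Qed.

Let xv n k : x (k%:R / n%:R) ^+ 2 = (a n)^-1 ^+ k * v n k.
Proof.
rewrite /v /y exprMn mulrA [X in _ = X * _](_ : _ = 1) ?mul1r// /ar_coef expRN invrK.
rewrite -!expRM_natl -expRD -expR0; congr expR; ring.
Qed.

(* The error on a bounded time interval is dominated by an exponential so that,
   against the geometric weights, it sums to [O(n)]. *)
Let sqr_error : exists2 C : R, 0 <= C & forall eps : R, 0 < eps -> exists K : nat,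
  forall t : R, 0 <= t ->
  `|y t ^+ 2 - l ^+ 2| <= eps + C * expR (4 * theta * (K%:R - t)).
Proof.
have [A A0 HA] := yb; exists (A ^+ 2 + l ^+ 2); first by rewrite addr_ge0 ?sqr_ge0.
move=> eps eps0; have Al : 0 < A + `|l| by rewrite ltr_wpDl// normr_gt0.
have [K HK] := yl (divr_gt0 eps0 Al); exists K => t t0.
have E0 : 0 < expR (4 * theta * (K%:R - t)) by exact: expR_gt0.
have C0 : 0 <= A ^+ 2 + l ^+ 2 by rewrite addr_ge0 ?sqr_ge0.
have [Kt|tK] := leP K%:R t.
  apply: (@le_trans _ _ eps); last by rewrite lerDl mulr_ge0// ltW.
  rewrite subr_sqr normrM; apply: (@le_trans _ _ (eps / (A + `|l|) * (A + `|l|))).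
    rewrite ler_pM//; first exact: HK.
    by rewrite (le_trans (ler_normD _ _))// lerD2r HA.
  by rewrite divfK// gt_eqF.
apply: (@le_trans _ _ (A ^+ 2 + l ^+ 2)).
  apply: (le_trans (ler_normB _ _)); rewrite !ger0_norm ?sqr_ge0// lerD2r.
  by rewrite -(real_normK (num_real (y t))) lerXn2r ?nnegrE ?HA.
apply: (@le_trans _ _ ((A ^+ 2 + l ^+ 2) * expR (4 * theta * (K%:R - t)))); last first.
  by rewrite lerDr ltW.
rewrite ler_peMr// -[leLHS]expR0 ler_expR mulr_ge0//; last by rewrite subr_ge0 ltW.
by rewrite mulr_ge0// ltW.
Qed.

Let W_ge n N : (0 < n)%N -> N%:R <= W n N.
Proof.
move=> n0; have -> : N%:R = \sum_(k < N) (1 : R) by rewrite sumr_const card_ord.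
apply: ler_sum => k _; have a0 := ar_coef_gt0 (2 * theta) n.
by rewrite exprn_ege1// invf_ge1// ltW// ar_coef_lt1.
Qed.

(** The sum of squares is a sum of y^2 with geometric weights whose total [W] is at least n^2, so an
    error of order n, or small relative to the weights, disappears. *)
Let weighted_mean_cvg m : (1 < m)%N ->
  (\sum_(k < n ^ m) x (k%:R / n%:R) ^+ 2) / W n (n ^ m) @[n --> \oo] --> l ^+ 2.
Proof.
move=> m1; have [C C0 HC] := sqr_error; apply/cvgrPdist_le => eps eps0.
have e2 : 0 < eps / 2 by rewrite divr_gt0.
have [K HK] := HC _ e2; pose D := C * expR (4 * theta * K%:R) * ((1 + 2 * theta) / (2 * theta)).
near=> n; have n0 : (0 < n)%N by near: n; exact: nbhs_infty_gt.
have nR : 0 < n%:R :> R by rewrite ltr0n.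
have Dn : D / n%:R <= eps / 2.
  rewrite ler_pdivrMr// mulrC -ler_pdivrMr//.
  by near: n; exact: nbhs_infty_ger.
have a0 := ar_coef_gt0 (2 * theta) n; have a1 := ar_coef_lt1 th20 n0.
have N2 : n%:R * n%:R <= (n ^ m)%:R :> R by rewrite -natrM ler_nat mulnn leq_pexp2l.
have W2 : n%:R * n%:R <= W n (n ^ m) by rewrite (le_trans N2)// W_ge.
have W0 : 0 < W n (n ^ m) by rewrite (lt_le_trans _ W2)// mulr_gt0.
have Wn0 : W n (n ^ m) != 0 by rewrite gt_eqF.
rewrite distrC -[l ^+ 2](mulfK Wn0) -mulrBl normrM normfV (gtr0_norm W0) ler_pdivrMr//.
rewrite {1}/W mulr_sumr -sumrB; apply: (le_trans (ler_norm_sum _ _ _)).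
(* The decay exp(-4 theta k / n) of the error is [a n ^+ (2 * k)]; against the weight
   [(a n)^-1 ^+ k] it leaves the summable [a n ^+ k]. *)
have term (k : 'I_(n ^ m)) : true -> `|x (k%:R / n%:R) ^+ 2 - l ^+ 2 * (a n)^-1 ^+ k| <=
   eps / 2 * (a n)^-1 ^+ k + C * expR (4 * theta * K%:R) * a n ^+ k.
  move=> _; rewrite xv [l ^+ 2 * _]mulrC -mulrBr normrM [`|_ ^+ k|]ger0_norm; last first.
    by rewrite exprn_ge0// invr_ge0 ltW.
  have p0 : 0 < (a n)^-1 ^+ k by rewrite exprn_gt0// invr_gt0.
  have := HK (k%:R / n%:R); rewrite divr_ge0// => /(_ isT) h.
  apply: (le_trans (ler_wpM2l (ltW p0) h)); rewrite mulrDr [X in X + _]mulrC lerD2l.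
  have -> : expR (4 * theta * (K%:R - k%:R / n%:R)) = expR (4 * theta * K%:R) * (a n ^+ k * a n ^+ k).
    by rewrite /ar_coef -!expRM_natl -!expRD; congr expR; ring.
  rewrite exprVn le_eqVlt; apply/orP; left; apply/eqP; field.
  by rewrite expf_neq0// gt_eqF.
apply: (le_trans (ler_sum _ term)); rewrite big_split/= -!mulr_sumr -/(W n (n ^ m)).
have geo : \sum_(k < n ^ m) a n ^+ k <= (1 + 2 * theta) / (2 * theta) * n%:R.
  apply: le_trans (ar_coef_gap th20 n0).
  rewrite -[leRHS]mul1r ler_pdivlMr ?subr_gt0//.
  suff -> : (\sum_(k < n ^ m) a n ^+ k) * (1 - a n) = 1 - a n ^+ (n ^ m).
    by rewrite gerBl exprn_ge0// ltW.
  by rewrite mulrC -opprB mulNr -subrX1 opprB.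
have E0 : 0 <= C * expR (4 * theta * K%:R) by rewrite mulr_ge0// expR_ge0.
have h1 : C * expR (4 * theta * K%:R) * \sum_(k < n ^ m) a n ^+ k <= D * n%:R.
  by rewrite /D -[leRHS]mulrA ler_wpM2l.
have h2 : D * n%:R <= eps / 2 * (n%:R * n%:R).
  by rewrite mulrA ler_wpM2r// -ler_pdivrMr.
have h3 : eps / 2 * (n%:R * n%:R) <= eps / 2 * W n (n ^ m) by rewrite ler_pM2l.
have := le_trans h1 (le_trans h2 h3).
rewrite -(lerD2l (eps / 2 * W n (n ^ m))) => /le_trans; apply.
by rewrite -mulrDl -splitr.
Unshelve. all: by end_near. Qed.

(** Since [W] is an explicit geometric sum, the ratio factors exactly into n (1/a - 1) / 2, which
    tends to theta, a correction 1 / (1 - a^(n^m)), and the final y^2 divided by its weighted mean;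
    the last two tend to 1. *)
Lemma explosive_ratio_cvg m : (1 < m)%N ->
  n%:R * x (n ^ m.-1)%:R ^+ 2 / (2 * \sum_(k < n ^ m) x (k%:R / n%:R) ^+ 2)
    @[n --> \oo] --> theta.
Proof.
case: m => // m m0 /=; have m1 : (1 < m.+1)%N by [].
have l20 : l ^+ 2 != 0 by rewrite expf_neq0.
have aN0 : a n ^+ (n ^ m.+1) @[n --> \oo] --> (0 : R).
  have c1 : (2 * theta)^-1 / n%:R @[n --> \oo] --> (0 : R) by exact: cvg_div_nat0.
  apply: (squeeze_cvgr _ (cvg_cst 0) c1); near=> n.
  have n0 : (0 < n)%N by near: n; exact: nbhs_infty_gt.
  have nR : 0 < n%:R :> R by rewrite ltr0n.
  rewrite exprn_ge0 ?(ltW (ar_coef_gt0 _ _))//=.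
  have -> : a n ^+ (n ^ m.+1) = (expR (2 * theta * (n ^ m)%:R))^-1.
    rewrite /ar_coef -expRM_natl -expRN; congr expR.
    by rewrite expnSr natrM; field; rewrite gt_eqF.
  rewrite -invfM lef_pV2 ?posrE ?expR_gt0 ?mulr_gt0//.
  apply: (@le_trans _ _ (1 + 2 * theta * (n ^ m)%:R)); last exact: expR_ge1Dx.
  apply: (@le_trans _ _ (2 * theta * (n ^ m)%:R)); last by rewrite lerDr.
  by rewrite ler_pM2l// ler_nat -[leqLHS]expn1 leq_pexp2l.
have y1 : y (n ^ m)%:R @[n --> \oo] --> l.
  apply/cvgrPdist_le => eps eps0; have [K HK] := yl eps0; near=> n.
  rewrite distrC; apply: HK; rewrite ler_nat; near: n.
  have := cvg_expn_infty m0; move/cvgnyPge; exact.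
have f1 : y (n ^ m)%:R ^+ 2 / ((\sum_(k < n ^ m.+1) x (k%:R / n%:R) ^+ 2) / W n (n ^ m.+1))
    @[n --> \oo] --> (1 : R).
  rewrite -[X in _ --> X](divff l20); apply: cvgM.
    by under eq_fun do rewrite expr2; rewrite expr2; exact: cvgM.
  by apply: cvgV => //; exact: weighted_mean_cvg.
have f2 : n%:R * ((a n)^-1 - 1) / 2 / (1 - a n ^+ (n ^ m.+1)) @[n --> \oo] --> theta.
  rewrite -[X in _ --> X]divr1; apply: cvgM; first exact: cvg_expR_slope.
  apply: cvgV; first exact: oner_neq0.
  by rewrite -[X in _ --> X]subr0; apply: cvgB => //; exact: cvg_cst.
suff E n : n%:R * x (n ^ m)%:R ^+ 2 / (2 * \sum_(k < n ^ m.+1) x (k%:R / n%:R) ^+ 2) =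
    n%:R * ((a n)^-1 - 1) / 2 / (1 - a n ^+ (n ^ m.+1)) *
    (y (n ^ m)%:R ^+ 2 / ((\sum_(k < n ^ m.+1) x (k%:R / n%:R) ^+ 2) / W n (n ^ m.+1))).
  by rewrite (funext E) -[X in _ --> X]mulr1; exact: cvgM f2 f1.
have [->|n0] := posnP n; first by rewrite !mul0r.
have a0 := ar_coef_gt0 (2 * theta) n; have a1 := ar_coef_lt1 th20 n0.
have TE : (n ^ m)%:R = (n ^ m.+1)%:R / n%:R :> R.
  by rewrite expnSr natrM mulfK// pnatr_eq0 -lt0n.
have A0 : 0 < a n ^+ (n ^ m.+1) by rewrite exprn_gt0.
have A1 : a n ^+ (n ^ m.+1) < 1.
  by rewrite exprn_ilt1 ?(ltW a0)// -lt0n expn_gt0 n0.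
have := subrX1 (a n)^-1 (n ^ m.+1); rewrite -/(W n (n ^ m.+1)) exprVn.
have -> : x (n ^ m)%:R ^+ 2 = (a n ^+ (n ^ m.+1))^-1 * y (n ^ m)%:R ^+ 2.
  by rewrite TE xv exprVn.
rewrite invf_div invfM; set s := (\sum_(k < _) _)^-1.
move: (W _ _) s (y _ ^+ 2) (a n ^+ _) A0 A1 => w s z A A0 A1 WE.
have -> : w = (A^-1 - 1) / ((a n)^-1 - 1).
  by rewrite WE mulrC mulKf// subr_eq0 gt_eqF// invf_gt1.
field; rewrite mulN1r !gt_eqF ?subr_gt0//.
Unshelve. all: by end_near. Qed.

End explosive_ratio.

(** * Small ball probabilities and nonvanishing limits *)

Section small_balls.
Context d (T : measurableType d) (R : realType) (P : probability T R).

(** The peak of the density times the length 2 eps of the interval; the bound is uniform in the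
    shift [c] and sees the variance only through [kap]. *)
Lemma gaussian_small_ball (f : T -> R) (s kap c eps : R) : 0 < kap -> kap <= s ^+ 2 -> 0 <= eps ->
  (forall A, measurable A -> P (f @^-1` A) = gaussian_law 0 s A) ->
  (P [set w | `|c + f w|%R <= eps]%R <= (2 * (Num.sqrt (kap * pi *+ 2))^-1 * eps)%:E)%E.
Proof.
move=> kap0 ks eps0 law; have s2 : 0 < s ^+ 2 by exact: lt_le_trans ks.
have s0 : s != 0 by apply: contraTneq s2 => ->; rewrite expr0n/= ltxx.
pose A : set R := `[- eps - c, eps - c]%classic.
have -> : [set w | `|c + f w| <= eps] = f @^-1` A.
  apply/seteqP; split=> w; rewrite /A/= in_itv/= ler_norml => /andP[h1 h2]; apply/andP; split.
  - by rewrite lerBlDl.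
  - by rewrite lerBrDl.
  - by rewrite -lerBlDl.
  - by rewrite -lerBrDl.
rewrite law; last exact: measurable_itv.
rewrite /gaussian_law (negbTE s0) /normal_prob.
apply: (@le_trans _ _ (\int[lebesgue_measure]_(x in A) (normal_peak s)%:E)%E).
  apply: ge0_le_integral => //.
  - exact: measurable_itv.
  - by move=> x _; rewrite lee_fin normal_pdf_ge0.
  - by apply/measurable_EFinP; apply: measurable_funTS; exact: measurable_normal_pdf.
  - by move=> x _; rewrite lee_fin normal_pdf_ub.
rewrite integral_cst//; last exact: measurable_itv.
have muA : (@lebesgue_measure R A <= (2 * eps)%:E)%E.
  rewrite /A lebesgue_measure_itv/= lte_fin; case: ifPn => _.
    by rewrite -EFinB lee_fin le_eqVlt; apply/orP; left; apply/eqP; ring.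
  by rewrite lee_fin mulr_ge0.
have p0 := normal_peak_ge0 s.
have peak : normal_peak s <= (Num.sqrt (kap * pi *+ 2))^-1.
  rewrite /normal_peak lef_pV2 ?posrE ?sqrtr_gt0 ?mulrn_wgt0 ?(mulr_gt0 _ (pi_gt0 R))//.
  by apply: ler_wsqrtr; rewrite ler_wMn2r// ler_wpM2r// pi_ge0.
apply: (@le_trans _ _ ((normal_peak s)%:E * (2 * eps)%:E)%E).
  by apply: lee_wpmul2l => //; rewrite lee_fin.
rewrite -EFinM lee_fin [leRHS]mulrAC [leRHS]mulrC ler_wpM2r// mulr_ge0//.
Qed.

(** Convergence to 0 puts the point in the lower limit [U eps] of the small ball events for every
    eps. Continuity from below gives [U eps] probability at most C eps, so no law of the limit has
    to be identified. *)
Lemma ae_not_cvg0 (Z : nat -> T -> R) (C : R) : (forall n, measurable_fun setT (Z n)) ->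
  (forall eps : R, 0 < eps -> \forall n \near \oo,
     (P [set w | `|Z n w|%R <= eps]%R <= (C * eps)%:E)%E) ->
  {ae P, forall w, ~ (Z n w @[n --> \oo] --> (0 : R))}.
Proof.
move=> mZ small.
pose A (eps : R) n := [set w | `|Z n w| <= eps].
have mA eps n : measurable (A eps n).
  rewrite -[A eps n]setTI; apply: (@measurable_fun_le _ _ _ setT (fun w => `|Z n w|) (cst eps)) => //.
  exact: measurableT_comp.
pose U (eps : R) := \bigcup_N \bigcap_n A eps (N + n)%N.
have mD eps N : measurable (\bigcap_n A eps (N + n)%N) by exact: bigcapT_measurable.
have mU eps : measurable (U eps) by exact: bigcupT_measurable.
have PU eps : 0 < eps -> (P (U eps) <= (C * eps)%:E)%E.
  move=> eps0; have [N0 _ HN0] := small eps eps0.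
  have nd : nondecreasing_seq (fun N => \bigcap_n A eps (N + n)%N).
    move=> N M NM; apply/subsetPset => w Dw n _; have := Dw (M - N + n)%N I.
    by rewrite addnA subnKC.
  have cv := @nondecreasing_cvg_mu _ _ _ P _ (mD eps) (mU eps) nd.
  rewrite -(cvg_lim (@ereal_hausdorff R) cv); apply: lime_le; first exact: cvgP cv.
  apply: nearW => N /=; apply: (@le_trans _ _ (P (A eps (N + N0)%N))).
    by apply: le_measure; rewrite ?inE// => w; apply.
  by apply: HN0; rewrite /= leq_addl.
pose V := \bigcap_k U (k.+1%:R^-1 : R).
have mV : measurable V by apply: bigcapT_measurable => k; exact: mU.
have PV : P V = 0%E.
  apply/eqP; rewrite eq_le measure_ge0 andbT.
  have h k : (P V <= (C * k.+1%:R^-1)%:E)%E.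
    apply: le_trans (PU _ _); last by rewrite invr_gt0.
    by apply: le_measure; rewrite ?inE// => w; apply.
  have PVfin : P V \is a fin_num by rewrite fin_num_measure.
  rewrite -(fineK PVfin) lee_fin leNgt; apply/negP => p0.
  have c0 : (C * k.+1%:R^-1 : R) @[k --> \oo] --> (0 : R).
    by rewrite (cvg_shiftS (fun k => C / k%:R)); exact: cvg_div_nat0.
  have [k _ Hk] : \forall k \near \oo, C * k.+1%:R^-1 < fine (P V).
    exact: (cvgr_lt _ c0).
  have := h k; rewrite -(fineK PVfin) lee_fin leNgt => /negP; apply.
  by apply: Hk => /=.
exists V; split=> // w /= nZ; apply: contrapT => nV; apply: nZ => Zc; apply: nV => k _.
have k0 : 0 < k.+1%:R^-1 :> R by rewrite invr_gt0.
have [N _ HN] : \forall n \near \oo, `|Z n w| <= k.+1%:R^-1.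
  by move/cvgr0Pnorm_le : Zc; exact.
by exists N => // n _; apply: HN; rewrite /= leq_addr.
Qed.

End small_balls.

(* Abel summation: [s N = \sum_(k < N) (q k - q k.+1) * c k + q N * c N]. *)
Lemma abel_lower_bound (R : realFieldType) (c q s : nat -> R) n : (forall k, 0 <= q k.+1 <= q k) ->
  (forall k, 0 <= c k) -> (forall k, (n <= k)%N -> 2^-1 <= c k) -> s 0%N = q 0%N * c 0%N ->
  (forall k, s k.+1 = s k + q k.+1 * (c k.+1 - c k)) ->
  forall N, (n <= N)%N -> 2^-1 * q n <= s N.
Proof.
move=> qm c0 ch s0 sS.
have q0 k : 0 <= q k by have /andP[h1 h2] := qm k; exact: le_trans h2.
have D0 k : q k * c k <= s k.
  elim: k => [|k IH]; first by rewrite s0.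
  have /andP[_ h] := qm k; have := ler_wpM2r (c0 k) h.
  by rewrite sS mulrBr; lra.
suff D N : (n <= N)%N -> 2^-1 * (q n - q N) <= s N - q N * c N.
  move=> N nN; have := D N nN; have := ler_wpM2l (q0 N) (ch N nN).
  by lra.
elim: N => [|N IH].
  by rewrite leqn0 => /eqP->; rewrite subrr mulr0 subr_ge0.
rewrite leq_eqVlt => /predU1P[<-|nN]; first by rewrite subrr mulr0 subr_ge0.
have {}IH := IH nN; have /andP[_ h] := qm N.
have h' : 0 <= q N - q N.+1 by rewrite subr_ge0.
have := ler_wpM2l h' (ch N nN).
by rewrite sS mulrBr; lra.
Qed.

(** * Variance of the discounted noise *)

Section discounted_noise_law.
Context d (T : measurableType d) (R : realType) (P : probability T R).
Context (H : R) (B : R -> {RV P >-> R}) (theta : R).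
Hypothesis H01 : 0 < H < 1.
Hypothesis fbmB : fractional_brownian_motion H B.
Hypothesis theta0 : 0 < theta.
Local Notation E f := (\int[P]_w f w)%R.

(** The term [B 0] is kept because it vanishes only almost surely, and the path starts at
    [x0 + B 0]. *)
Definition discounted_fbm n N w := B 0 w + discounted_noise theta (fun t => B t w) n N.

Lemma discounted_fbm_span n N : gauss_span B (discounted_fbm n N).
Proof.
apply: gauss_spanD; first exact: gauss_span_B.
apply: gauss_span_sum => j; apply: gauss_spanZ.
by apply: gauss_spanB; exact: gauss_span_B.
Qed.

(** Monotonicity of the power suffices, whatever H. This is what makes [B 1] a good test variable,
    whereas the sign of the correlation between increments changes at H = 1/2. *)
Lemma fbm_cov1_ge (t : R) : 0 <= t -> 0 <= fbm_cov H t 1 /\ (1 <= t -> 2^-1 <= fbm_cov H t 1).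
Proof.
have /andP[H0 _] := H01; have al0 : 0 < 2 * H by rewrite mulr_gt0.
have one : (1 : R) `^ (2 * H) = 1 by rewrite powR1.
move=> t0; rewrite /fbm_cov normr1 one (ger0_norm t0).
have [t1|t1] := leP t 1.
  have h : `|t - 1| `^ (2 * H) <= 1.
    rewrite -[leRHS]one ge0_ler_powR ?nnegrE ?(ltW al0)//.
    by rewrite distrC ger0_norm ?subr_ge0// gerBl.
  have tp := powR_ge0 t (2 * H); split; first by rewrite mulr_ge0// ?invr_ge0//; lra.
  move=> t1'; have -> : t = 1 by lra.
  by rewrite one subrr normr0 powR0 ?gt_eqF//; lra.
have h : `|t - 1| `^ (2 * H) <= t `^ (2 * H).
  rewrite ge0_ler_powR ?nnegrE ?(ltW al0)//.
  by rewrite ger0_norm ?subr_ge0 ?(ltW t1)// gerBl.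
have : 2^-1 <= 2^-1 * (t `^ (2 * H) + 1 - `|t - 1| `^ (2 * H)) by lra.
by move=> h1; split=> [|_]//; apply: le_trans h1; rewrite invr_ge0.
Qed.

Lemma discounted_fbm_variance n N : (0 < n)%N -> (n <= N)%N ->
  (expR (- theta) / 2) ^+ 2 <= E (fun w => discounted_fbm n N w ^+ 2).
Proof.
move=> n0 nN; have /andP[H0 _] := H01; have al0 : 0 < 2 * H by rewrite mulr_gt0.
have nR : 0 < n%:R :> R by rewrite ltr0n.
have mG k := gauss_span_has_moments fbmB (discounted_fbm_span n k).
have mB t := B_has_moments fbmB t.
pose e := E (fun w => discounted_fbm n N w * B 1 w).
have B1 : E (fun w => B 1 w ^+ 2) = 1.
  under eq_Rintegral do rewrite expr2.
  rewrite (mean_BB fbmB) /fbm_cov normr1 powR1 subrr normr0 powR0 ?gt_eqF//.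
  by rewrite subr0 -mulr2n -mulr_natl mulr1 mulVf.
(* Cauchy-Schwarz, as nonnegativity of the residual variance after projection on [B 1], which has
   unit variance. *)
have CS : e ^+ 2 <= E (fun w => discounted_fbm n N w ^+ 2).
  have : 0 <= E (fun w => (discounted_fbm n N w - e * B 1 w) ^+ 2).
    by apply: mean_ge0 => w; exact: sqr_ge0.
  have -> : E (fun w => (discounted_fbm n N w - e * B 1 w) ^+ 2) =
     E (fun w => discounted_fbm n N w ^+ 2) - e ^+ 2.
    transitivity (E (fun w => discounted_fbm n N w ^+ 2 +
        ((- (2 * e)) * (discounted_fbm n N w * B 1 w) + e ^+ 2 * B 1 w ^+ 2))).
      by apply: eq_Rintegral => w _; ring.
    have h1 := has_momentsX 2 (mG N).
    have h2 := has_momentsM (mG N) (mB 1).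
    have h3 := has_momentsX 2 (mB 1).
    rewrite (meanD h1 (has_momentsD (has_momentsZ (- (2 * e)) h2) (has_momentsZ (e ^+ 2) h3))).
    rewrite (meanD (has_momentsZ (- (2 * e)) h2) (has_momentsZ (e ^+ 2) h3)).
    by rewrite (meanZ _ h2) (meanZ _ h3) B1 -/e; ring.
  by rewrite subr_ge0.
suff eE : expR (- theta) / 2 <= e.
  have p0 : 0 <= expR (- theta) / 2 by rewrite divr_ge0 ?expR_ge0.
  by apply: le_trans CS; rewrite lerXn2r ?nnegrE// (le_trans p0).
pose c k := fbm_cov H (k%:R / n%:R) 1.
pose q k := expR (- (theta * (k%:R / n%:R))).
(* The index [n] is time 1, from which on the covariance with [B 1] is at least 1/2; Abel summation
   against the decreasing discount [q] keeps that part. *)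
have -> : expR (- theta) / 2 = 2^-1 * q n by rewrite /q divff ?gt_eqF// mulr1 mulrC.
have gr k : 0 <= k%:R / n%:R :> R by rewrite divr_ge0.
apply: (@abel_lower_bound _ c q (fun k => E (fun w => discounted_fbm n k w * B 1 w)) n) => //.
- move=> k; rewrite expR_ge0/= ler_expR lerN2 ler_pM2l// ler_pM2r ?invr_gt0//.
  by rewrite ler_nat.
- by move=> k; have [] := fbm_cov1_ge (gr k).
- by move=> k nk; have [_] := fbm_cov1_ge (gr k); apply; rewrite ler_pdivlMr// mul1r ler_nat.
- rewrite /q /c mul0r mulr0 oppr0 expR0 mul1r -(mean_BB fbmB).
  by apply: eq_Rintegral => w _; rewrite /discounted_fbm /discounted_noise big_ord0 addr0.
move=> k; have h1 := has_momentsM (mG k) (mB 1).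
have h2 := has_momentsM (mB (k.+1%:R / n%:R)) (mB 1).
have h3 := has_momentsM (mB (k%:R / n%:R)) (mB 1).
rewrite /c -!(mean_BB fbmB) -(meanB h2 h3) -(meanZ (q k.+1) (has_momentsB h2 h3)).
rewrite -(meanD h1 (has_momentsZ (q k.+1) (has_momentsB h2 h3))).
apply: eq_Rintegral => w _; rewrite /discounted_fbm /discounted_noise big_ord_recr/= /increments -/(q k.+1).
ring.
Qed.

Lemma discounted_fbm_not_cvg (x0 : R) :
  {ae P, forall w, ~ (x0 + discounted_fbm n (n ^ 2) w @[n --> \oo] --> (0 : R))}.
Proof.
pose kap := (expR (- theta) / 2) ^+ 2 : R.
have kap0 : 0 < kap by rewrite exprn_gt0// divr_gt0// expR_gt0.
apply: (@ae_not_cvg0 _ _ _ P (fun n w => x0 + discounted_fbm n (n ^ 2) w) (2 * (Num.sqrt (kap * pi *+ 2))^-1)).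
  move=> n; apply: measurable_funD => //.
  by have [] := gauss_span_has_moments fbmB (discounted_fbm_span n (n ^ 2)).
move=> eps eps0; near=> n.
have n0 : (0 < n)%N by near: n; exact: nbhs_infty_gt.
have hG := discounted_fbm_span n (n ^ 2).
have [mG _] := gauss_span_has_moments fbmB hG.
have [_] := gaussian_has_moments mG (gauss_span_gaussian fbmB hG).
move=> /(_ (gauss_span_mean0 fbmB hG))[_ [s sE law]].
have ks : kap <= s ^+ 2.
  by rewrite sE; apply: discounted_fbm_variance => //; rewrite -[leqLHS]expn1 leq_pexp2l.
exact: (@gaussian_small_ball _ _ _ P _ s kap x0 eps kap0 ks (ltW eps0) law).
Unshelve. all: by end_near. Qed.

End discounted_noise_law.

Section explosive_drift.
Context d (T : measurableType d) (R : realType) (P : probability T R).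
Context (H : R) (B X : R -> {RV P >-> R}) (m : nat) (x0 theta : R).
Hypothesis H01 : 0 < H < 1.
Hypothesis m_gt1 : (1 < m)%N.
Hypothesis fbmB : fractional_brownian_motion H B.
Hypothesis fouX : fractional_ornstein_uhlenbeck x0 theta B X.
Hypothesis theta_gt0 : 0 < theta.

Lemma theta4_consistent : strongly_consistent P (theta4 X m) theta.
Proof.
have [_ _ _ cB] := fbmB.
have A := ae_and (ae_and (discounted_fbm_not_cvg H01 fbmB theta_gt0 x0) cB)
                 (ae_and (fbm_small_oscillation H01 fbmB 1) fouX).
rewrite /strongly_consistent; apply: filterS A => w [[nz cb] [osc xE]].
have xE' (t : R) : 0 <= t -> lebesgue_measure.-integrable `[0, t] (EFin \o X ^~ w) /\
    X t w = x0 + theta * (\int[lebesgue_measure]_(s in `[0, t]) X s w) + B t w.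
  exact: xE.
have [l yl] := discounted_limit theta_gt0 cb xE' osc.
have yb := discounted_bounded theta_gt0 cb xE' yl.
have Gl := discounted_noise_cvg theta_gt0 cb xE' osc yl.
(* A zero limit would make [x0 + discounted_fbm] tend to 0 along the same meshes, which almost
   surely does not happen. *)
have l0 : l != 0.
  apply/eqP => l0; apply: nz; rewrite l0 in Gl.
  have E n : x0 + discounted_fbm B theta n (n ^ 2) w =
      X 0 w + discounted_noise theta (fun t => B t w) n (n ^ 2).
    by rewrite (ou_path0 xE') addrA.
  by rewrite (funext E).
have E n : theta4 X m n w = n%:R * X (n ^ m.-1)%:R w ^+ 2 /
    (2 * \sum_(k < n ^ m) X (k%:R / n%:R) w ^+ 2).
  by rewrite /theta4 /sum_sq_obs big_mkord.
rewrite (funext E).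
have Q := @explosive_ratio_cvg R theta l (fun t => X t w) theta_gt0 l0 yl yb m m_gt1.
exact: Q.
Qed.

End explosive_drift.

Theorem theorem3p3 (R : realType) (d : measure_display) (T : measurableType d)
    (P : probability T R) (H : R) (m : nat) (x0 theta : R)
    (B X : R -> {RV P >-> R})
    (H01 : 0 < H < 1) (m_gt1 : (1 < m)%N)
    (fbmB : fractional_brownian_motion H B)
    (fouX : fractional_ornstein_uhlenbeck x0 theta B X) :
  (theta < 0 -> strongly_consistent P (theta3 H X m) theta) /\
  (0 < theta -> strongly_consistent P (theta4 X m) theta).
Proof.
split=> theta0; first exact: theta3_consistent fbmB fouX theta0.
exact: theta4_consistent fbmB fouX theta0.
Qed.
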